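(* Let $f\in L^\infty(\Omega)$ with $f\ge0$ and $f\not\equiv0$. Let $u\in W_0^{1,p}(\Omega)\cap L^\infty(\Omega)$ and $v\in W_0^{1,p}(\Omega)$ be such that $(u,v)$ is a weak solution of the system $$-H_pu+(-\Delta_p)^su=f(x)\,v^{p-1}\ \text{in }\Omega,\quad u>0\ \text{in }\Omega,$$ $$-H_pv+(-\Delta_p)^sv=f(x)\Big(\frac{v^2}{u}\Big)^{p-1}\ \text{in }\Omega,\quad v>0\ \text{in }\Omega.$$ Then there exists a constant $k>0$ such that $v=ku$ in $\Omega$.
   Context: $\Omega\subset\mathbb{R}^N$, $N\ge2$, is a bounded $C^1$ domain, $1<p<\infty$, $0<s<1$, and $d\mu=|x-y|^{-N-ps}\,dx\,dy$. $H:\mathbb{R}^N\to[0,\infty)$ is a Finsler–Minkowski norm: $H\in C^1(\mathbb{R}^N\setminus\{0\})$; $H(x)=0$ iff $x=0$; $H(tx)=|t|H(x)$ for all $t\in\mathbb{R}$, $x\in\mathbb{R}^N$; there are constants $C_1,C_2>0$ with $C_1|x|\le H(x)\le C_2|x|$ for all $x$; and $H$ is strictly convex as a norm, i.e. $H(x+y)<H(x)+H(y)$ for linearly independent $x,y$. The vector field $H(\xi)^{p-1}\nabla H(\xi)$ is understood as $0$ at $\xi=0$. $H_pu=\mathrm{div}(H(\nabla u)^{p-1}\nabla H(\nabla u))$ and $(-\Delta_p)^su(x)=\mathrm{P.V.}\int_{\mathbb{R}^N}|u(x)-u(y)|^{p-2}(u(x)-u(y))|x-y|^{-N-ps}\,dy$.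 $W_0^{1,p}(\Omega)=\{u\in W^{1,p}(\mathbb{R}^N):u=0\text{ in }\mathbb{R}^N\setminus\Omega\}$. $w\in W_0^{1,p}(\Omega)$ is a weak solution of $-H_pw+(-\Delta_p)^sw=F$ in $\Omega$ (with $F$ a function on $\Omega$, here the right-hand side of the respective equation) if for every $\phi\in W_0^{1,p}(\Omega)$ (the integral $\int_\Omega F\phi\,dx$ being finite) $$\int_\Omega H(\nabla w)^{p-1}\nabla H(\nabla w)\cdot\nabla\phi\,dx+\iint_{\mathbb{R}^{2N}}|w(x)-w(y)|^{p-2}(w(x)-w(y))(\phi(x)-\phi(y))\,d\mu=\int_\Omega F\,\phi\,dx.$$ $(u,v)$ is a weak solution of the system if both equations hold in this sense. *)

(* Defs.v *)
From HB Require Import structures.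
From mathcomp Require Import all_boot all_order all_algebra.
From mathcomp Require Import all_classical all_reals all_analysis.

Set Implicit Arguments.
Unset Strict Implicit.
Unset Printing Implicit Defensive.

Import Order.TTheory GRing.Theory Num.Theory.
Import numFieldNormedType.Exports.

Local Open Scope classical_set_scope.
Local Open Scope ring_scope.

(* ['rV[T]_n] carries the product sigma-algebra, as [n.-tuple T] does in the
   library; for T = R this is the Borel sigma-algebra of R^n. *)

Definition measure_rV_display : measure_display -> measure_display.
Proof. exact. Qed.

Section measurable_rV.
Context {d} {T : measurableType d}.
Variable n : nat.

Let coors : 'I_n -> 'rV[T]_n -> T := fun i x => x ord0 i.

Let rV_set0 : g_sigma_preimage coors set0.
Proof. exact: sigma_algebra0. Qed.

Let rV_setC A : g_sigma_preimage coors A -> g_sigma_preimage coors (~` A).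
Proof. exact: sigma_algebraC. Qed.

Let rV_bigcup (F : _^nat) : (forall i, g_sigma_preimage coors (F i)) ->
  g_sigma_preimage coors (\bigcup_i (F i)).
Proof. exact: sigma_algebra_bigcup. Qed.

HB.instance Definition _ := @isMeasurable.Build (measure_rV_display d)
  'rV[T]_n (g_sigma_preimage coors) rV_set0 rV_setC rV_bigcup.

End measurable_rV.

Lemma measurable_coord d (T : measurableType d) n (i : 'I_n) :
  measurable_fun [set: 'rV[T]_n] (fun x : 'rV[T]_n => x ord0 i).
Proof.
move=> _ Y mY; rewrite setTI; apply: sub_sigma_algebra => /=.
rewrite -bigcup_seq/=; exists i => /=; first by rewrite mem_index_enum.
by exists Y => //; rewrite setTI.
Qed.

Lemma measurable_fun_rV d1 d2 (T1 : measurableType d1) (T2 : measurableType d2)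
    n (f : T1 -> 'rV[T2]_n) :
  (forall i, measurable_fun [set: T1] (fun x => f x ord0 i)) ->
  measurable_fun [set: T1] f.
Proof.
move=> mf.
have H : g_sigma_preimage (fun i => (fun x : 'rV[T2]_n => x ord0 i) \o f)
    `<=` measurable.
  apply: smallest_sub; first exact: sigma_algebra_measurable.
  case: n => [|n] in f mf *; first by rewrite big_ord0.
  rewrite -bigcup_mkord_ord; apply: bigcup_sub => i Ii.
  by move=> A [B mB <-]; exact: mf.
rewrite g_sigma_preimage_comp in H.
by move=> _ A mA; apply: H; exists A.
Qed.

(* Lebesgue measure on R^n: the n-fold product of the one on R. *)

Section lebesgue_rV.
Context {R : realType}.

Definition rV_cons n (z : measurableTypeR R * 'rV[R]_n) : 'rV[R]_n.+1 := row_mx z.1%:M z.2.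

Fixpoint leb n : set 'rV[R]_n -> \bar R :=
  match n with
  | 0 => \d_(0 : 'rV[R]_0)
  | n'.+1 => pushforward (lebesgue_measure \x leb (n := n'))%E (@rV_cons n')
  end.

Let rV_uncons n (x : 'rV[R]_n.+1) : measurableTypeR R * 'rV[R]_n :=
  (x ord0 ord0, \row_j x ord0 (lift ord0 j)).

Lemma rV_cons0 n (z : measurableTypeR R * 'rV[R]_n) : rV_cons z ord0 ord0 = z.1.
Proof.
have -> : ord0 = lshift n ord0 :> 'I_(1 + n) by apply: val_inj.
by apply: etrans (row_mxEl _ _ _ _) _; rewrite mxE.
Qed.

Lemma rV_consS n (z : measurableTypeR R * 'rV[R]_n) (j : 'I_n) :
  rV_cons z ord0 (lift ord0 j) = z.2 ord0 j.
Proof.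
have -> : lift ord0 j = rshift 1 j :> 'I_(1 + n) by apply: val_inj.
exact: row_mxEr.
Qed.

Lemma measurable_rV_cons n : measurable_fun setT (@rV_cons n).
Proof.
apply: measurable_fun_rV => i.
case: (unliftP ord0 i) => [j|] ->; last first.
  by under eq_fun do rewrite rV_cons0; exact: measurable_fst.
under eq_fun do rewrite rV_consS.
by apply: (measurableT_comp (measurable_coord j)); exact: measurable_snd.
Qed.

Let measurable_rV_uncons n : measurable_fun setT (@rV_uncons n).
Proof.
apply/measurable_fun_pairP; split; first exact: measurable_coord.
apply: measurable_fun_rV => i /=.
rewrite (_ : (fun x => _) = fun y : 'rV[R]_n.+1 => y ord0 (lift ord0 i)).
  exact: measurable_coord.
by apply/funext => x /=; rewrite mxE.
Qed.

Let rV_consK n : cancel (@rV_cons n) (@rV_uncons n).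
Proof.
move=> [a y]; rewrite /rV_uncons rV_cons0; congr pair.
by apply/rowP => j; rewrite mxE rV_consS.
Qed.

Let measure_spec n (m : set 'rV[R]_n -> \bar R) :=
  [/\ m set0 = 0%E, forall A, (0 <= m A)%E,
      semi_sigma_additive m & sigma_finite setT m].

Let pushforward_rV_cons n (m : {sigma_finite_measure set 'rV[R]_n -> \bar R}) :
  measure_spec (pushforward (lebesgue_measure \x m)%E (@rV_cons n)).
Proof.
have mP A : measurable A -> measurable (@rV_cons n @^-1` A).
  by move=> mA; rewrite -[X in measurable X]setTI; exact: measurable_rV_cons.
split.
- by rewrite /pushforward preimage_set0 measure0.
- by move=> A; exact: (measure_ge0 (lebesgue_measure \x m)%E).
- move=> F mF tF mUF; rewrite /pushforward preimage_bigcup.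
  apply: measure_semi_sigma_additive.
  + by move=> i; exact: mP.
  + apply/trivIsetP => /= i j _ _ ij; rewrite -preimage_setI.
    by move/trivIsetP : tF => /(_ _ _ _ _ ij) ->//; rewrite preimage_set0.
  + by rewrite -preimage_bigcup; exact: mP.
- have /sigma_finiteP[F [TF ndF Foo]] := sigma_finiteT (@lebesgue_measure R).
  have /sigma_finiteP[G [TG ndG Goo]] := sigma_finiteT m.
  exists (fun k => @rV_uncons n @^-1` (F k `*` G k)).
    rewrite -preimage_bigcup -[LHS](preimage_setT (@rV_uncons n)).
    congr (_ @^-1` _); apply/esym/seteqP; split => // -[x y] _.
    have [i _ Fix] : (\bigcup_i F i) x by rewrite -TF.
    have [j _ Gjy] : (\bigcup_i G i) y by rewrite -TG.
    exists (maxn i j) => //; split => /=.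
      by move: x Fix; exact/subsetPset/ndF/leq_maxl.
    by move: y Gjy; exact/subsetPset/ndG/leq_maxr.
  move=> k; have [mFk Fk] := Foo k; have [mGk Gk] := Goo k; split.
    rewrite -[X in measurable X]setTI; apply: measurable_rV_uncons => //.
    exact: measurableX.
  rewrite /pushforward (_ : _ @^-1` _ = F k `*` G k); last first.
    rewrite -comp_preimage (_ : _ \o _ = id) ?preimage_id//.
    by apply/funext => z; exact: rV_consK.
  by rewrite product_measure1E// lte_mul_pinfty// ge0_fin_numE.
Qed.

Let leb_measure n : measure_spec (@leb n).
Proof.
elim: n => [|n [l0 lge lsa lsf]].
  pose m : {measure set 'rV[R]_0 -> \bar R} := @dirac _ 'rV[R]_0 0 R.
  split; [exact: (measure0 m)|exact: (measure_ge0 m)| |].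
    exact: (@measure_semi_sigma_additive _ _ _ m).
  exists (fun=> setT); first by rewrite bigcup_const.
  by move=> _; split => //=; rewrite diracT ltry.
pose m : {measure set 'rV[R]_n -> \bar R} :=
  HB.pack_for {measure set 'rV[R]_n -> \bar R} (@leb n)
    (isMeasure.Build _ _ _ (@leb n) l0 lge lsa).
pose ms : {sigma_finite_measure set 'rV[R]_n -> \bar R} :=
  HB.pack_for {sigma_finite_measure set 'rV[R]_n -> \bar R} (Measure.sort m)
    (Measure_isSigmaFinite.Build _ _ _ (Measure.sort m) lsf).
exact: (pushforward_rV_cons ms).
Qed.

HB.instance Definition _ n := isMeasure.Build _ 'rV[R]_n R (@leb n)
  (let: And4 l0 _ _ _ := leb_measure n in l0)
  (let: And4 _ lge _ _ := leb_measure n in lge)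
  (let: And4 _ _ lsa _ := leb_measure n in lsa).

HB.instance Definition _ n := Measure_isSigmaFinite.Build _ 'rV[R]_n R (@leb n)
  (let: And4 _ _ _ lsf := leb_measure n in lsf).

End lebesgue_rV.
Arguments leb {R} n.

Section euclidean.
Context {R : realType} {n : nat}.
Implicit Types (x y : 'rV[R]_n) (f : 'rV[R]_n -> R) (U : set 'rV[R]_n).

Definition dotp x y : R := \sum_(i < n) x ord0 i * y ord0 i.

(* the library norm [`|x|] on ['rV[R]_n] is the sup norm *)
Definition enorm x : R := Num.sqrt (dotp x x).

Definition partial f (i : 'I_n) x : R := 'D_(delta_mx ord0 i) f x.

Definition gradient f x : 'rV[R]_n := \row_i partial f i x.

(* [Ck k U f]: f is of class C^k on the open set U *)
Fixpoint Ck (k : nat) U f : Prop :=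
  {in U, continuous f} /\
  match k with
  | 0 => True
  | k'.+1 => forall i : 'I_n,
      (forall x, U x -> derivable f x (delta_mx ord0 i)) /\
      Ck k' U (partial f i)
  end.

Definition test_function f : Prop :=
  (forall k, Ck k setT f) /\ compact (closure [set x | f x != 0]).

End euclidean.

(* Near each boundary point, up to relabeling and reorienting the coordinate
   axes, Omega is the region above the graph of a C^1 function of the other
   n - 1 coordinates. *)
Definition C1_boundary {R : realType} {n : nat} (Omega : set 'rV[R]_n) : Prop :=
  forall x0, (closure Omega `\` interior Omega) x0 ->
    exists (i : 'I_n) (sgn : bool) (gamma : 'rV[R]_n.-1 -> R),
      Ck 1 setT gamma /\
      \forall x \near x0,
        Omega x <-> gamma (col' i x) < (-1) ^+ sgn * x ord0 i.

Record bounded_C1_domain {R : realType} {n : nat} (Omega : set 'rV[R]_n) :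
    Prop := {
  domain_nonempty : Omega !=set0 ;
  domain_open : open Omega ;
  domain_connected : connected Omega ;
  domain_bounded : bounded_set Omega ;
  domain_C1_boundary : C1_boundary Omega }.

Record finsler_minkowski {R : realType} {n : nat} (H : 'rV[R]_n -> R) :
    Prop := {
  finsler_ge0 : forall x, 0 <= H x ;
  finsler_C1 : Ck 1 [set x | x != 0] H ;
  finsler_eq0 : forall x, H x = 0 <-> x = 0 ;
  finsler_homogeneous : forall t x, H (t *: x) = `|t| * H x ;
  finsler_equiv : exists C1 C2 : R, [/\ 0 < C1, 0 < C2 &
    forall x, C1 * enorm x <= H x <= C2 * enorm x] ;
  finsler_strictly_convex : forall x y, free [:: x; y] ->
    H (x + y) < H x + H y }.

Section sobolev.
Context {R : realType} {n : nat}.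
Local Notation mu := (@leb R n).
Implicit Types (p : R) (Omega : set 'rV[R]_n) (u v : 'rV[R]_n -> R).

Definition is_weak_gradient p u (G : 'rV[R]_n -> 'rV[R]_n) : Prop :=
  forall i : 'I_n, (fun x => G x ord0 i) \in Lfun mu p%:E /\
    forall phi, test_function phi ->
      (\int[mu]_x (u x * partial phi i x)%:E =
       - \int[mu]_x (G x ord0 i * phi x)%:E)%E.

Definition W1p p u : Prop :=
  u \in Lfun mu p%:E /\ exists G, is_weak_gradient p u G.

(* a representative of the weak gradient (unique almost everywhere) *)
Definition weak_gradient p u : 'rV[R]_n -> 'rV[R]_n :=
  xget (fun=> 0) [set G | is_weak_gradient p u G].

Definition W01p p Omega u : Prop :=
  W1p p u /\ {ae mu, forall x, ~ Omega x -> u x = 0}.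

Definition in_Linfty Omega u : Prop := (u \_ Omega) \in Lfun mu +oo%E.

End sobolev.

Section weak_solution.
Context {R : realType} {n : nat}.
Local Notation mu := (@leb R n).
Variables (p s : R) (H : 'rV[R]_n -> R) (Omega : set 'rV[R]_n).
Implicit Types (w phi F : 'rV[R]_n -> R).

Definition finsler_flux (xi : 'rV[R]_n) : 'rV[R]_n :=
  if xi == 0 then 0 else (H xi `^ (p - 1)) *: gradient H xi.

Definition finsler_form w phi : \bar R :=
  (\int[mu]_(x in Omega)
    (dotp (finsler_flux (weak_gradient p w x)) (weak_gradient p phi x))%:E)%E.

Definition fractional_form w phi : \bar R :=
  (\int[mu \x mu]_z
    (`|w z.1 - w z.2| `^ (p - 2) * (w z.1 - w z.2) * (phi z.1 - phi z.2) *
     enorm (z.1 - z.2) `^ (- (n%:R + p * s)))%:E)%E.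

Definition weak_solution w F : Prop :=
  W01p p Omega w /\
  forall phi, W01p p Omega phi ->
    mu.-integrable Omega (fun x => (F x * phi x)%:E) /\
    (finsler_form w phi + fractional_form w phi =
     \int[mu]_(x in Omega) (F x * phi x)%:E)%E.

End weak_solution.

(* Main.v *)
Require Import Defs.
From HB Require Import structures.
From mathcomp Require Import all_boot all_order all_algebra.
From mathcomp Require Import ring lra.
From mathcomp Require Import all_classical all_reals all_analysis.
From mathcomp Require Import measurable_realfun.

(** Test the equation of [u] with [u] itself, and the equation of [v] with
    [phi = u `^ p * (v + e) `^ (1 - p)] for a small [e > 0]; then subtract.

    The gradient terms compare by Picone's inequality [finsler_picone]: the gradient of
    [H] has dual norm at most [1], so Young's inequality bounds the flux of [v] paired
    with the gradient of [phi] by the p-th power of [H] at the gradient of [u]. The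
    nonlocal terms compare by [discrete_picone], a convexity inequality for four numbers,
    in which equality holds exactly when [u / v] takes the same value at the two points.
    So the integral of the nonlocal deficit, which is nonnegative, is at most the
    difference of the right-hand sides. As [e] tends to [0] that difference tends to [0]
    by dominated convergence. Fatou's lemma ([ae_cvg0_of_integral_cvg0]) then makes the
    limit deficit vanish for almost every pair of points of [Omega], and the case of
    equality says that [u / v] is constant.

    The other half of the work is to see that [phi] is an admissible test function and
    to compute its weak gradient ([picone_fun_spec]). The product and chain rule needed
    there rests on a characterization of weak derivatives by increments: [g] is the i-th
    weak derivative of [u] exactly when, for every [h > 0], the increment
    [u (x + h e_i) - u x] is for almost every [x] the integral of [g] on the segment from
    [x] to [x + h e_i] ([weak_partial_increment] and [weak_partial_of_increments]). On
    almost every line both functions are then absolutely continuous, and the rule follows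
    by telescoping over finer and finer grids. The characterization itself needs enough
    test functions, namely products of the bumps made from [exp (-1/x)], and a function
    orthogonal to all of them vanishes almost everywhere ([fundamental_lemma]). *)

Set Implicit Arguments.
Unset Strict Implicit.
Unset Printing Implicit Defensive.

Import Order.TTheory GRing.Theory Num.Theory.
Import numFieldNormedType.Exports.

Local Open Scope classical_set_scope.
Local Open Scope ring_scope.

(** * Power inequalities and the discrete Picone inequality *)

Section power_inequalities.
Context {R : realType} (p : R).
Hypothesis p_gt1 : 1 < p.
Implicit Types a b c d x y t : R.

Let p_gt0 : 0 < p. Proof. exact: lt_trans p_gt1. Qed.
Let p_neq0 : p != 0. Proof. by rewrite gt_eqF. Qed.

(** The exponential lies strictly above its tangent at [t * A], both at [A] and at
    [0]; the combination with weights [t] and [1 - t] cancels the slopes. *)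
Lemma expR_lt_interpolation t (A : R) : 0 < t < 1 -> A != 0 ->
  expR (t * A) < t * expR A + (1 - t).
Proof.
move=> /andP[t0 t1] A0.
have E : expR A = expR (t * A) * expR ((1 - t) * A).
  by rewrite -expRD; congr expR; ring.
have h1 : 1 + (1 - t) * A < expR ((1 - t) * A).
  by apply: expR_gt1Dx; rewrite mulf_neq0 // gt_eqF // subr_gt0.
have h2 : 1 + - (t * A) < expR (- (t * A)).
  by apply: expR_gt1Dx; rewrite oppr_eq0 mulf_neq0 // gt_eqF.
have F : 1 = expR (t * A) * expR (- (t * A)) by rewrite -expRD subrr expR0.
have e0 := expR_gt0 (t * A).
have k1 : t * expR A > t * (expR (t * A) * (1 + (1 - t) * A)).
  by rewrite E ltr_pM2l // ltr_pM2l.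
have k2 : (1 - t) > (1 - t) * (expR (t * A) * (1 + - (t * A))).
  by rewrite -[ltRHS]mulr1 [X in _ < _ * X]F ltr_pM2l ?subr_gt0 // ltr_pM2l.
have -> : expR (t * A) = t * (expR (t * A) * (1 + (1 - t) * A)) +
   (1 - t) * (expR (t * A) * (1 + - (t * A))) by ring.
exact: ltrD.
Qed.

(** This is strict convexity of the exponential between [0] and [p * ln x], with
    weight [1 / p]. *)
Lemma bernoulli_lt x : 0 <= x -> x != 1 -> p * x < x `^ p + (p - 1).
Proof.
move=> x0 x1; have [->|xn0] := eqVneq x 0.
  by rewrite powR0 // mulr0 add0r subr_gt0.
have xp : 0 < x by rewrite lt_neqAle eq_sym xn0.
have L : p * ln x != 0.
  by rewrite mulf_neq0 // ln_eq0.
have := @expR_lt_interpolation p^-1 (p * ln x) _ L.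
rewrite invr_gt0 p_gt0 invf_lt1 // => /(_ p_gt1).
rewrite mulrA mulVf // mul1r lnK ?posrE // => h.
have := h; rewrite -(ltr_pM2l p_gt0); rewrite /powR (negbTE xn0).
by rewrite mulrDr mulrA mulfV // mul1r mulrBr mulr1 mulfV.
Qed.

(** Homogeneous form of the previous inequality, at the ratio [x / y]. The strict
    version is kept because it decides the equality case of Picone's inequality. *)
Lemma young_lt x y : 0 <= x -> 0 <= y -> x != y ->
  p * x * y `^ (p - 1) < x `^ p + (p - 1) * y `^ p.
Proof.
move=> x0 y0 xy; have [y00|yn0] := eqVneq y 0.
  rewrite y00 !powR0 // ?subr_eq0 ?(gt_eqF p_gt1) // !mulr0 addr0.
  rewrite powR_gt0 // lt_neqAle x0 andbT eq_sym; by rewrite y00 in xy.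
have yp : 0 < y by rewrite lt_neqAle eq_sym yn0.
have q0 : 0 <= x / y by rewrite divr_ge0.
have q1 : x / y != 1.
  by apply: contra xy => /eqP h; rewrite -(divfK yn0 x) h mul1r.
have := bernoulli_lt q0 q1.
have ypp : 0 < y `^ p by rewrite powR_gt0.
rewrite -(ltr_pM2r ypp) mulrDl -powRM // divfK // => h.
have -> // : p * x * y `^ (p - 1) = p * (x / y) * y `^ p.
by rewrite -[in RHS](mulr_powRB1 y0 p_gt0); field.
Qed.

Lemma young_le x y : 0 <= x -> 0 <= y ->
  p * x * y `^ (p - 1) <= x `^ p + (p - 1) * y `^ p.
Proof.
move=> x0 y0; have [->|xy] := eqVneq x y; last exact/ltW/young_lt.
by rewrite -mulrA mulr_powRB1 // mulrBl mul1r addrC subrK.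
Qed.

(** Put [al = a / c], [be = b / d] and [g = `|a - b| / (c - d)]. Since
    [c = d + (c - d)], the ratio [al] is at most the mean of [be] and [g] with
    weights [d] and [c - d], so convexity of the p-th power bounds [c * al `^ p].
    The convexity is used as two tangent inequalities at [al], because strictness
    of the one at [be] gives [al = be] in the case of equality. *)
Let picone_ordered a b c d : 0 <= a -> 0 <= b -> 0 < d -> d < c ->
  (c - d) `^ (p - 1) * (c * (a / c) `^ p - d * (b / d) `^ p) <= `|a - b| `^ p
  ?= iff (a / c == b / d).
Proof.
move=> a0 b0 d0 dc; have c0 := lt_trans d0 dc.
have cd : 0 < c - d by rewrite subr_gt0.
set al := a / c; set be := b / d.
have al0 : 0 <= al by rewrite divr_ge0 // ltW.
have be0 : 0 <= be by rewrite divr_ge0 // ltW.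
have aE : a = al * c by rewrite /al divfK // gt_eqF.
have bE : b = be * d by rewrite /be divfK // gt_eqF.
set g := `|a - b| / (c - d).
have g0 : 0 <= g by rewrite divr_ge0 // ltW.
have -> : `|a - b| `^ p = (c - d) `^ (p - 1) * ((c - d) * g `^ p).
  rewrite mulrA (mulrC _ (c - d)) mulr_powRB1 // ?(ltW cd) // -powRM // ?(ltW cd) //.
  by rewrite /g mulrC divfK // gt_eqF.
have cdp : 0 < (c - d) `^ (p - 1) by rewrite powR_gt0.
have key : al * c <= be * d + g * (c - d).
  by rewrite -aE -bE /g divfK ?gt_eqF // addrC -lerBlDr ler_norm.
have hg := young_le g0 al0.
have alp : 0 <= al `^ (p - 1) by exact: powR_ge0.
have EA : al `^ p = al * al `^ (p - 1) by rewrite mulr_powRB1.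
have kk : 0 <= p * al `^ (p - 1) * (be * d + g * (c - d) - al * c).
  by rewrite mulr_ge0 ?subr_ge0 // mulr_ge0 // ltW.
split.
  rewrite ler_pM2l // lerBlDl.
  have hb := young_le be0 al0.
  move: hb hg; rewrite EA => hb hg.
  have hb' : 0 <= d * (be `^ p + (p - 1) * (al * al `^ (p - 1)) - p * be * al `^ (p - 1)).
    by rewrite mulr_ge0 ?subr_ge0 // ltW.
  have hg' : 0 <= (c - d) * (g `^ p + (p - 1) * (al * al `^ (p - 1)) - p * g * al `^ (p - 1)).
    by rewrite mulr_ge0 ?subr_ge0 // ltW.
  rewrite -subr_ge0; apply: le_trans (addr_ge0 (addr_ge0 hb' hg') kk) _.
  by rewrite le_eqVlt; apply/orP; left; apply/eqP; ring.
rewrite (inj_eq (mulfI (lt0r_neq0 cdp))).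
apply/idP/idP => [|/eqP h].
  apply: contraLR => nab; rewrite lt_eqF //.
  rewrite ltrBlDl.
  have := @young_lt be al be0 al0; rewrite eq_sym => /(_ nab) hb.
  move: hb hg; rewrite EA => hb hg.
  have hb' : 0 < d * (be `^ p + (p - 1) * (al * al `^ (p - 1)) - p * be * al `^ (p - 1)).
    by rewrite mulr_gt0 ?subr_gt0.
  have hg' : 0 <= (c - d) * (g `^ p + (p - 1) * (al * al `^ (p - 1)) - p * g * al `^ (p - 1)).
    by rewrite mulr_ge0 ?subr_ge0 // ltW.
  rewrite -subr_gt0; apply: lt_le_trans (ltr_wpDr kk (ltr_wpDr hg' hb')) _.
  by rewrite le_eqVlt; apply/orP; left; apply/eqP; ring.
have -> : g = al.
  rewrite /g aE bE -h -mulrBr normrM (ger0_norm al0) (gtr0_norm cd) mulfK //.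
  by rewrite gt_eqF.
by rewrite h; apply/eqP; ring.
Qed.

(** The nonlinearity of the fractional p-Laplacian, applied to a difference of
    two values. *)
Definition jump (a : R) : R := `|a| `^ (p - 2) * a.

Lemma jumpN a : jump (- a) = - jump a.
Proof. by rewrite /jump normrN mulrN. Qed.

Lemma jump_pos a : 0 < a -> jump a = a `^ (p - 1).
Proof.
move=> a0; rewrite /jump gtr0_norm // mulrC.
rewrite -{1}(powRr1 (ltW a0)) -powRD; last by rewrite (gt_eqF a0) implybT.
by congr (_ `^ _); ring.
Qed.

Lemma jump_mul a : jump a * a = `|a| `^ p.
Proof.
have [->|a0] := eqVneq a 0; first by rewrite mulr0 normr0 powR0.
have {}a0 : 0 < `|a| by rewrite normr_gt0.
rewrite /jump -mulrA -expr2 -[a ^+ 2]ger0_norm ?sqr_ge0 // normrX.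
rewrite -powR_mulrn // -powRD; last by rewrite (gt_eqF a0) implybT.
by rewrite subrK.
Qed.

(** Picone's inequality for the fractional p-Laplacian: [a], [b] are the values of
    one function at two points and [c], [d] those of another. The equality case is
    what forces the ratio of two solutions to be constant. *)
Lemma discrete_picone a b c d : 0 <= a -> 0 <= b -> 0 < c -> 0 < d ->
  jump (c - d) * (c * (a / c) `^ p - d * (b / d) `^ p) <= `|a - b| `^ p
  ?= iff (a / c == b / d).
Proof.
move=> a0 b0 c0 d0; have [cd|dc|->] := ltgtP c d.
- rewrite -opprB jumpN jump_pos ?subr_gt0 // mulNr -mulrN opprB distrC eq_sym.
  exact: picone_ordered.
- by rewrite jump_pos ?subr_gt0 //; exact: picone_ordered.
- rewrite subrr /jump normr0 mulr0 mul0r; split; first exact: powR_ge0.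
  rewrite (inj_eq (mulIf _)) ?invr_eq0 ?lt0r_neq0 // eq_sym.
  by rewrite powR_eq0 p_neq0 andbT normr_eq0 subr_eq0.
Qed.

End power_inequalities.

(** * Finsler-Minkowski norms and the anisotropic Picone inequality *)

Section finsler.
Context {R : realType} {n : nat} (H : 'rV[R]_n -> R).
Hypothesis hH : finsler_minkowski H.
Implicit Types x y z : 'rV[R]_n.

Lemma dotpDr x y z : dotp x (y + z) = dotp x y + dotp x z.
Proof. by rewrite /dotp -big_split; apply: eq_bigr => i _ /=; rewrite mxE mulrDr. Qed.

Lemma dotpZl (a : R) x y : dotp (a *: x) y = a * dotp x y.
Proof. by rewrite /dotp mulr_sumr; apply: eq_bigr => i _ /=; rewrite mxE mulrA. Qed.

Lemma dotpZr (a : R) x y : dotp x (a *: y) = a * dotp x y.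
Proof. by rewrite /dotp mulr_sumr; apply: eq_bigr => i _ /=; rewrite mxE mulrCA. Qed.

Lemma dotpN x y : dotp x (- y) = - dotp x y.
Proof. by rewrite -scaleN1r dotpZr mulN1r. Qed.

Lemma dotp0l x : dotp 0 x = 0.
Proof. by rewrite /dotp big1 // => i _; rewrite mxE mul0r. Qed.

Lemma finsler0 : H 0 = 0.
Proof. exact/(finsler_eq0 hH). Qed.

(** Strict convexity speaks of independent vectors; for dependent ones, homogeneity
    reduces the claim to the triangle inequality in [R]. *)
Lemma finsler_triangle x y : H (x + y) <= H x + H y.
Proof.
have [->|y0] := eqVneq y 0; first by rewrite finsler0 !addr0.
have [/(finsler_strictly_convex hH)/ltW//|] := boolP (free [:: x; y]).
rewrite free_cons seq1_free y0 andbT negbK span_seq1 => /vlineP[k ->].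
have -> : k *: y + y = (k + 1) *: y by rewrite scalerDl scale1r.
rewrite !(finsler_homogeneous hH).
have := finsler_ge0 hH y; set h := H y => h0.
by have := ler_normD k 1; rewrite normr1; nra.
Qed.

Lemma finsler_sum (I : Type) (r : seq I) (F : I -> 'rV[R]_n) :
  H (\sum_(i <- r) F i) <= \sum_(i <- r) H (F i).
Proof.
elim/big_ind2: _ => //; first by rewrite finsler0.
by move=> a b c d ab cd; apply: le_trans (finsler_triangle _ _) _; exact: lerD.
Qed.

(** The hypotheses give partial derivatives, not directional ones. Since
    [x + t *: y] is the mean of the [n] points obtained from [x] by moving the
    i-th coordinate by [n * t * y_i], convexity of [H] turns partial derivatives
    into an upper bound for the slope in any direction, up to [e]. *)
Lemma finsler_upper_slope x y (e : R) : x != 0 -> 0 < e ->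
  exists2 t : R, 0 < t & H (x + t *: y) <= H x + t * (dotp (gradient H x) y + e).
Proof.
move=> x0 e0.
have n0 : 0 < n%:R :> R.
  rewrite ltr0n lt0n; apply: contra x0 => /eqP n0; apply/eqP/rowP => -[i i_lt].
  by exfalso; rewrite n0 in i_lt.
(* [S] dominates every coordinate of [y] and the sum of the [n] errors, whence the
   tolerance [e / S] for each partial derivative *)
pose S : R := \sum_(i < n) `|y ord0 i| + 1.
have S0 : 0 < S by rewrite ltr_wpDl // sumr_ge0.
have eS : 0 < e / S by rewrite divr_gt0.
have : \forall s \near (0 : R)^', forall i : 'I_n,
    `|partial H i x - s^-1 * (H (s *: delta_mx ord0 i + x) - H x)| <= e / S.
  apply: filter_forall => i.
  have [_ /(_ i)[/(_ x x0) dH _]] := finsler_C1 hH.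
  by move/cvgrPdist_le : dH => /(_ _ eS).
move=> /nbhs_ballP[d /= d0 hd].
pose M : R := n%:R * S.
have M0 : 0 < M by rewrite mulr_gt0.
exists (d / 2 / M); first by rewrite !divr_gt0.
set t := d / 2 / M.
have t0 : 0 < t by rewrite !divr_gt0.
have step i : H (x + (n%:R * t * y ord0 i) *: delta_mx ord0 i) <=
    H x + n%:R * t * (partial H i x * y ord0 i + e / S * `|y ord0 i|).
  have [->|yi] := eqVneq (y ord0 i) 0.
    by rewrite normr0 !mulr0 addr0 mulr0 scale0r !addr0.
  set s := n%:R * t * y ord0 i.
  have s0 : s != 0 by rewrite mulf_neq0 // mulf_neq0 ?(lt0r_neq0 n0) // lt0r_neq0.
  have sd : ball (0 : R) d s.
    rewrite /ball /= sub0r normrN /s normrM gtr0_norm ?(mulr_gt0 n0 t0) //.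
    have yS : `|y ord0 i| <= S.
      by rewrite /S (bigD1 i) //= -addrA lerDl addr_ge0 // sumr_ge0.
    have -> : n%:R * t * `|y ord0 i| = d / 2 * (`|y ord0 i| / S).
      by rewrite /t /M; field; rewrite ?lt0r_neq0.
    rewrite (@le_lt_trans _ _ (d / 2)) // ?ltr_pdivrMr ?ltr_pMr ?ltr1n //.
    by rewrite ler_piMr ?ler_pdivrMr ?mul1r // divr_ge0 // ltW.
  have := hd _ sd s0 i; rewrite (addrC _ x).
  set A := H (x + _) - H x => hA.
  have {}hA : `|s * (partial H i x) - A| <= `|s| * (e / S).
    apply: le_trans (ler_wpM2l (normr_ge0 s) hA).
    by rewrite -normrM mulrBr mulrA mulfV // mul1r.
  rewrite -lerBlDl -/A.
  have {hA} : A <= s * partial H i x + `|s| * (e / S).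
    by move: hA; rewrite ler_distl => /andP[+ _]; rewrite lerBlDr.
  move/le_trans; apply; rewrite /s normrM (gtr0_norm (mulr_gt0 _ t0)) //.
  by rewrite le_eqVlt; apply/orP; left; apply/eqP; ring.
rewrite -(ler_pM2l n0).
have -> : n%:R * H (x + t *: y) = H (n%:R *: (x + t *: y)).
  by rewrite (finsler_homogeneous hH) ger0_norm.
have -> : n%:R *: (x + t *: y) =
    \sum_(i < n) (x + (n%:R * t * y ord0 i) *: delta_mx ord0 i).
  rewrite big_split /= sumr_const card_ord scalerDr scaler_nat scalerA; congr (_ + _).
  rewrite {1}(row_sum_delta y) scaler_sumr; apply: eq_bigr => i _.
  by rewrite scalerA.
apply: le_trans (finsler_sum _ _) _.
apply: le_trans (ler_sum _ (fun i _ => step i)) _.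
rewrite big_split /= sumr_const card_ord -[X in X + _ <= _]mulr_natl.
rewrite [leRHS]mulrDr lerD2l.
rewrite -mulr_sumr [leRHS]mulrA (ler_pM2l (mulr_gt0 n0 t0)) big_split /= -mulr_sumr.
rewrite {1}/dotp.
have -> : \sum_(i < n) gradient H x ord0 i * y ord0 i =
  \sum_(i < n) partial H i x * y ord0 i by apply: eq_bigr => i _; rewrite mxE.
rewrite lerD2l mulrAC ler_pdivrMr // ler_pM2l //.
by rewrite /S lerDl.
Qed.

(** The dual norm of the gradient is at most [1]: going from [x] to [x - t *: y]
    decreases [H] by at most [t * H y], by the triangle inequality, and the slope
    in the direction [- y] is bounded by the gradient. *)
Lemma gradient_finsler_le x y : x != 0 -> dotp (gradient H x) y <= H y.
Proof.
move=> x0; apply/ler_addgt0Pr => e e0.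
have [t t0 ht] := finsler_upper_slope (- y) x0 e0.
have : H x <= H (x + t *: - y) + t * H y.
  have {1}-> : x = (x + t *: - y) + t *: y by rewrite scalerN addrNK.
  apply: le_trans (finsler_triangle _ _) _.
  by rewrite (finsler_homogeneous hH) gtr0_norm.
rewrite dotpN in ht => h; rewrite -(ler_pM2l t0); nra.
Qed.

(** Euler's identity. The inequality that the dual bound does not give comes from
    the slope in the direction [x], along which [H] is linear. *)
Lemma gradient_finsler_self x : x != 0 -> dotp (gradient H x) x = H x.
Proof.
move=> x0; apply/eqP; rewrite eq_le gradient_finsler_le //=.
apply/ler_addgt0Pr => e e0.
have [t t0] := finsler_upper_slope x x0 e0.
have -> : x + t *: x = (1 + t) *: x by rewrite scalerDl scale1r.
rewrite (finsler_homogeneous hH) gtr0_norm ?addr_gt0 // => h.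
by rewrite -(ler_pM2l t0); nra.
Qed.

Variable p : R.
Hypothesis p_gt1 : 1 < p.

Lemma flux_le x y : dotp (finsler_flux p H x) y <= H x `^ (p - 1) * H y.
Proof.
rewrite /finsler_flux; case: ifPn => [_|x0].
  by rewrite dotp0l mulr_ge0 ?powR_ge0 ?(finsler_ge0 hH).
by rewrite dotpZl ler_wpM2l ?powR_ge0 // gradient_finsler_le.
Qed.

Lemma flux_self x : dotp (finsler_flux p H x) x = H x `^ p.
Proof.
rewrite /finsler_flux; case: ifPn => [/eqP ->|x0].
  by rewrite dotp0l finsler0 powR0 // gt_eqF // (lt_trans ltr01).
by rewrite dotpZl gradient_finsler_self // mulrC mulr_powRB1 ?(finsler_ge0 hH) // (lt_trans ltr01).
Qed.

(** Picone's inequality for the anisotropic operator: for [x], [y] the gradients of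
    [u], [v] and [t = u / (v + e)], the vector paired with the flux is the gradient
    of [u `^ p * (v + e) `^ (1 - p)]. It follows from the dual bound on the gradient
    of [H] and Young's inequality for [H x] and [t * H y]. *)
Lemma finsler_picone x y (t : R) : 0 <= t ->
  dotp (finsler_flux p H y)
    ((p * t `^ (p - 1)) *: x - ((p - 1) * t `^ p) *: y) <= H x `^ p.
Proof.
move=> t0; rewrite dotpDr dotpN !dotpZr flux_self.
have Hx := finsler_ge0 hH x; have Hy := finsler_ge0 hH y.
have := young_le p_gt1 Hx (mulr_ge0 t0 Hy); rewrite !powRM //.
have := ler_wpM2l (mulr_ge0 (ltW (lt_trans ltr01 p_gt1)) (powR_ge0 t (p - 1)))
   (flux_le y x).
by lra.
Qed.

End finsler.

(** * Measurability in Euclidean space *)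

Section measurable_euclidean.
Context {R : realType} {n : nat}.
Implicit Types (x y : 'rV[R]_n) (U : set 'rV[R]_n).

Lemma measurable_rV_box (A : 'I_n -> set R) : (forall i, measurable (A i)) ->
  measurable [set x : 'rV[R]_n | forall i, A i (x ord0 i)].
Proof.
move=> mA.
have -> : [set x : 'rV[R]_n | forall i, A i (x ord0 i)] =
    \bigcap_(i in [set: 'I_n]) ((fun x : 'rV[R]_n => x ord0 i) @^-1` A i).
  by apply/seteqP; split => [x h i _|x h i]; apply: h.
apply: fin_bigcap_measurable => // i _.
by rewrite -[X in measurable X]setTI; exact: measurable_coord.
Qed.

Lemma ball_rVE x (e : R) : 0 < e ->
  ball x e = [set y | forall i, ball (x ord0 i) e (y ord0 i)].
Proof.
move=> e0; apply/seteqP; split => [y [_ h] i|y h]; first exact: h.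
by split => // i j; rewrite !ord1.
Qed.

(** The norm is the sup norm, so balls are boxes, which the coordinates make
    measurable; an open set is the union of the countably many balls with rational
    center and radius [1 / k] that it contains. *)
Lemma open_measurable_rV U : open U -> measurable U.
Proof.
move=> oU.
pose I := ('rV[rat]_n * nat)%type.
pose q (z : I) : 'rV[R]_n := map_mx ratr z.1.
pose B (z : I) : set 'rV[R]_n := ball (q z) (z.2.+1%:R^-1).
pose C (z : I) := B z `&` [set _ | B z `<=` U].
have -> : U = \bigcup_(z in [set: I]) C z.
  apply/seteqP; split => [x Ux|x [z _]]; last first.
    by case=> + zU => /zU.
  have /nbhs_ballP[e /= e0 eU] : nbhs x U by exact: open_nbhs_nbhs.
  have [k ke] : exists k : nat, k.+1%:R^-1 < e / 2.
    have /(cvgrPdist_lt (fun k => k.+1%:R^-1 : R) 0).1 := @cvg_harmonic R.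
    move=> /(_ (e / 2)); rewrite divr_gt0 // => /(_ isT)[k _ /(_ k (leqnn k))] /=.
    by rewrite sub0r normrN ger0_norm // => h; exists k.
  have kp : 0 < k.+1%:R^-1 :> R by rewrite invr_gt0.
  have rx i : {r : rat | ball (x ord0 i) k.+1%:R^-1 (ratr r : R)}.
    apply: cid.
    have [r] : exists r : rat, (ratr r : R) \in `](x ord0 i - k.+1%:R^-1), (x ord0 i + k.+1%:R^-1)[.
      by apply: rat_in_itvoo; rewrite ltrD2l gtrN.
    rewrite in_itv /= => h; exists r; rewrite /ball /= distrC.
    by rewrite ltr_distl.
  exists (\row_i sval (rx i), k) => //; split.
    rewrite /B ball_rVE // => i; rewrite /q /= !mxE /=; apply: ball_sym.
    exact: svalP (rx i).
  move=> y; rewrite /B ball_rVE // => /= hy; apply: eU; rewrite ball_rVE // => i.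
  have -> : e = e / 2 + e / 2 by rewrite -splitr.
  apply: (@ball_triangle _ _ (ratr (sval (rx i)) : R)).
    by apply: (le_ball (ltW ke)); exact: svalP (rx i).
  by apply: (le_ball (ltW ke)); have := hy i; rewrite /q /= !mxE.
apply: countable_bigcupT_measurable; first exact: countableP.
move=> z; rewrite /C; have [zU|zU] := pselect (B z `<=` U); last first.
  by rewrite (_ : [set _ | _] = set0) ?setI0 //; apply/seteqP; split.
rewrite (_ : [set _ | _] = setT) ?setIT; last by apply/seteqP; split.
rewrite /B ball_rVE ?invr_gt0 //; apply: (measurable_rV_box (A := fun i => ball (q z ord0 i) z.2.+1%:R^-1)).
by move=> i; apply: open_measurable; exact: ball_open.
Qed.

Lemma continuous_measurable_rV U (f : 'rV[R]_n -> R) :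
  open U -> {in U, continuous f} -> measurable_fun U f.
Proof.
move=> oU cf mU; apply: (measurability _ (RGenOInfty.measurableE R)) => //.
move=> _ [_ [y ->] <-]; apply: open_measurable_rV.
rewrite openE => x [Ux /= fx]; have := cf x; rewrite inE => /(_ Ux) cfx.
have : nbhs (f x) [set` `]y, +oo[] by apply: open_nbhs_nbhs; split => //; exact: interval_open.
move=> /cfx h; rewrite /interior.
by apply: filterI => //; exact: open_nbhs_nbhs.
Qed.

End measurable_euclidean.

(** * Translation invariance of Lebesgue measure *)

Section leb_translation.
Context {R : realType}.

Definition cube n (r : R) : set 'rV[R]_n :=
  [set x | forall i, - r < x ord0 i < r].

Lemma measurable_cube n (r : R) : measurable (@cube n r).
Proof.
apply: (measurable_rV_box (A := fun=> [set y : R | - r < y < r])) => i.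
have -> : [set y : R | - r < y < r] = `](- r), r[%classic.
  by apply/seteqP; split => y /=; rewrite in_itv.
exact: measurable_itv.
Qed.

Lemma leb_cube_lty n (r : R) : (leb n (cube r) < +oo)%E.
Proof.
elim: n => [|n IHn].
  by rewrite /= diracE; case: (_ \in _); rewrite ltry.
rewrite /= /pushforward.
have -> : @rV_cons R n @^-1` cube r = [set` `](- r), r[] `*` cube r.
  apply/seteqP; split => [z h|z [h1 h2] i] /=.
    split; first by have := h ord0; rewrite rV_cons0 /= in_itv.
    by move=> i; have := h (lift ord0 i); rewrite rV_consS.
  case: (unliftP ord0 i) => [j|] ->; first by rewrite rV_consS; exact: h2.
  by rewrite rV_cons0; move: h1; rewrite /= in_itv.
rewrite product_measure1E //; last exact: measurable_cube.
have L : (lebesgue_measure `](- r)%R, r[%classic < +oo)%E.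
  by rewrite lebesgue_measure_itv /=; case: ifP; rewrite ltry.
by apply: lte_mul_pinfty => //; rewrite ge0_fin_numE.
Qed.

Lemma lebesgue_measure_translate (a : R) (A : set (measurableTypeR R)) :
  measurable A -> lebesgue_measure ((fun x => x + a) @^-1` A) = lebesgue_measure A.
Proof.
move=> mA; apply/esym.
have mf : measurable_fun setT (fun x : measurableTypeR R => x + a : measurableTypeR R).
  exact: measurable_funD.
pose m : {measure set (measurableTypeR R) -> \bar R} :=
  pushforward (@lebesgue_measure R) (fun x : measurableTypeR R => x + a : measurableTypeR R).
apply: (lebesgue_measure_unique (mu := m mf)) => //.
move=> _ [[x y] _ <-]; rewrite /m /= /pushforward.
have -> : (fun t => t + a) @^-1` [set` `]x, y]] = [set` `](x - a), (y - a)]] :> set R.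
  by apply/seteqP; split => t /=; rewrite !in_itv /= ltrBlDr lerBrDr.
rewrite !lebesgue_measure_itv /= !lte_fin ltrD2r.
by case: ifP => // _; rewrite -!EFinB; congr EFin; ring.
Qed.

Lemma measurable_translate n (a : 'rV[R]_n) :
  measurable_fun setT (fun x : 'rV[R]_n => x + a).
Proof.
apply: measurable_fun_rV => i; under eq_fun do rewrite mxE.
by apply: measurable_funD => //; exact: measurable_coord.
Qed.

(** By induction on the dimension: a set is measured by integrating the measures of
    its slices, and translating the set translates the slices and the variable of
    integration. *)
Lemma leb_translate n (a : 'rV[R]_n) (A : set 'rV[R]_n) :
  measurable A -> leb n ((fun x => x + a) @^-1` A) = leb n A.
Proof.
elim: n a A => [|n IHn] a A mA.
  rewrite (thinmx0 a); congr leb; apply/seteqP.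
  by split => x /=; rewrite addr0.
pose a0 : R := a ord0 ord0.
pose a' := (\row_j a ord0 (lift ord0 j) : 'rV[R]_n).
rewrite /= /pushforward /product_measure1.
have mB : measurable (@rV_cons R n @^-1` A).
  by rewrite -[X in measurable X]setTI; exact: measurable_rV_cons.
set B := @rV_cons R n @^-1` A in mB *.
have mf : measurable_fun setT (fun x : measurableTypeR R => x + a0 : measurableTypeR R).
  exact: measurable_funD.
have mx : measurable_fun setT (leb n \o xsection B).
  exact: measurable_fun_xsection.
transitivity (\int[lebesgue_measure]_x
    ((leb n \o xsection B) \o (fun x : measurableTypeR R => (x + a0)%R)) x)%E.
  apply: eq_integral => x _ /=.
  rewrite -[RHS](IHn a'); last exact: measurable_xsection.
  have E y : rV_cons (x, y) + a = rV_cons (x + a0, y + a').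
    apply/rowP => i; rewrite mxE.
    case: (unliftP ord0 i) => [j|] ->; first by rewrite !rV_consS /= !mxE.
    by rewrite !rV_cons0.
  congr leb; apply/seteqP; split => y /= /xsectionP h; apply/xsectionP; move: h.
    by rewrite /B /= E.
  by rewrite /B /= E.
rewrite -(@ge0_integral_pushforward _ _ _ _ _ _ mf lebesgue_measure setT (leb n \o xsection B)) //.
apply: eq_measure_integral => C mC _; exact: lebesgue_measure_translate.
Qed.

End leb_translation.

(** * Local integrability and flows along a coordinate axis *)

Section integral_translation.
Context {R : realType} {n : nat}.
Local Notation mu := (@leb R n).
Local Notation lambda := (@lebesgue_measure R).
Implicit Types (f g u psi : 'rV[R]_n -> R) (x a : 'rV[R]_n) (i : 'I_n).

Lemma ge0_integral_translate (f : 'rV[R]_n -> \bar R) a :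
  measurable_fun setT f -> (forall x, 0 <= f x)%E ->
  (\int[mu]_x f (x + a)%R = \int[mu]_x f x)%E.
Proof.
move=> mf f0.
rewrite -(@ge0_integral_pushforward _ _ _ _ _ _ (measurable_translate a) mu setT f) //.
by apply: eq_measure_integral => [|? A mA _]; [exact: measurable_translate|exact: leb_translate].
Qed.

Lemma integrable_translate f a : mu.-integrable setT (EFin \o f) ->
  mu.-integrable setT (fun x => (f (x + a))%:E).
Proof.
move=> /integrableP[mf fi]; apply/integrableP; split.
  exact: (measurableT_comp mf (measurable_translate a)).
rewrite (@ge0_integral_translate (fun x => `|(f x)%:E|%E)) //.
exact: measurableT_comp.
Qed.

Lemma integral_translate f a : mu.-integrable setT (EFin \o f) ->
  (\int[mu]_x (f (x + a)%R)%:E = \int[mu]_x (f x)%:E)%E.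
Proof.
move=> fi; have /integrableP[mf _] := fi.
have := @integral_pushforward _ _ _ _ _ _ (measurable_translate a) mu setT
  _ mf (integrable_translate a fi) measurableT.
rewrite preimage_setT /= => <-.
by apply: eq_measure_integral => [|? A mA _]; [exact: measurable_translate|exact: leb_translate].
Qed.

Lemma ae_translate (P : 'rV[R]_n -> Prop) a :
  {ae mu, forall x, P x} -> {ae mu, forall x, P (x + a)}.
Proof.
move=> [A [mA A0 PA]]; exists ((fun x => x + a) @^-1` A); split.
- by rewrite -[X in measurable X]setTI; exact: measurable_translate.
- by have := leb_translate a mA; rewrite A0.
- by move=> x /= Px; exact: PA.
Qed.

(** Local integrability; cubes exhaust the space and each test function vanishes
    outside one of them. *)
Definition cube_integrable g :=
  measurable_fun setT g /\ forall r, mu.-integrable (cube r) (EFin \o g).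

(** The multipliers that make a locally integrable function integrable. Unlike test
    functions, they include the indicators of cubes. *)
Definition bounded_in_cube (r : R) psi :=
  [/\ measurable_fun setT psi, exists C : R, forall x, `|psi x| <= C &
      forall x, psi x != 0 -> cube r x].

Lemma cube_cover x : exists r : nat, cube r%:R x.
Proof.
exists (Num.bound (\sum_(i < n) `|x ord0 i|)) => i.
rewrite -ltr_norml; apply: le_lt_trans (archi_boundP _); last exact: sumr_ge0.
by rewrite (bigD1 i) //= lerDl sumr_ge0.
Qed.

Lemma cube_integrable_Lfun (p : R) g : 1 <= p ->
  g \in Lfun mu p%:E -> cube_integrable g.
Proof.
move=> p1 gL; have mg : measurable_fun setT g.
  by move: gL => /sub_Lfun_mfun; rewrite inE.
split=> // r; have ip := Lfun_integrable p1 gL.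
have ic : mu.-integrable (cube r) (EFin \o cst 1).
  apply/integrableP; split; first exact/measurable_EFinP/measurable_cst.
  under eq_integral do rewrite /= normr1.
  by rewrite integral_cst ?mul1e; [exact: leb_cube_lty|exact: measurable_cube].
have ip' : mu.-integrable (cube r) (fun x => (`|g x| `^ p)%:E).
  by apply: integrableS ip => //; exact: measurable_cube.
have := integrableD (measurable_cube r) ic ip'.
apply: le_integrable => //; first exact: measurable_cube.
  by apply: measurable_funTS; exact/measurable_EFinP.
move=> x _ /=; rewrite lee_fin [leRHS]ger0_norm ?addr_ge0 ?powR_ge0 //.
have [g1|g1] := leP `|g x| 1.
  by rewrite (le_trans g1) // lerDl powR_ge0.
by rewrite (le_trans (le1r_powR (ltW g1) p1)) // lerDr.
Qed.

Lemma integrable_restrict_cube r g : cube_integrable g ->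
  mu.-integrable setT (fun x => ((g \_ (cube r)) x)%:E).
Proof.
move=> [_ /(_ r) ig].
have h := (@integrable_mkcond _ _ _ mu (cube r) (EFin \o g) (measurable_cube r)).1 ig.
apply: eq_integrable h => // x _ /=.
by rewrite !patchE; case: ifP.
Qed.

Lemma integrable_mul_bounded r g psi : cube_integrable g ->
  bounded_in_cube r psi -> mu.-integrable setT (fun x => (g x * psi x)%:E).
Proof.
move=> lg [mpsi [C hC] sup]; have mg := lg.1.
have : mu.-integrable setT (fun x => ((g \_ (cube r)) x * C)%:E).
  exact: (integrableZr measurableT C (integrable_restrict_cube r lg)).
apply: le_integrable => //.
  by apply/measurable_EFinP; exact: measurable_funM.
move=> x _ /=; rewrite lee_fin.
have C0 : 0 <= C by rewrite (le_trans _ (hC x)).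
have [->|p0] := eqVneq (psi x) 0; first by rewrite mulr0 normr0.
rewrite patchE mem_set; last exact: sup.
by rewrite !normrM (ger0_norm C0) ler_wpM2l.
Qed.

Definition line i x (t : R) : 'rV[R]_n := x + t *: delta_mx ord0 i.

Lemma measurable_line i : measurable_fun setT
  (fun z : measurableTypeR R * 'rV[R]_n => line i z.2 z.1).
Proof.
apply: measurable_fun_rV => j; rewrite /line.
under eq_fun do rewrite !mxE.
apply: measurable_funD.
  by apply: (measurableT_comp (measurable_coord j)); exact: measurable_snd.
apply: measurable_funM => //; exact: measurable_fst.
Qed.

Definition unit_step (h t : R) : R := \1_(`[0, h]%classic : set R) t.

Lemma measurable_unit_step h : measurable_fun setT (unit_step h).
Proof. exact: measurable_indic. Qed.

(** Integrand, in the pair of [t] and [x], of the line integral of [g] over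
    [x + [0, h] e_i] tested against [psi]; Fubini's theorem is applied to it. *)
Definition flow_kernel i (h : R) g psi (z : measurableTypeR R * 'rV[R]_n) : R :=
  unit_step h z.1 * (g (line i z.2 z.1) * psi z.2).

Lemma measurable_flow_kernel i h g psi : measurable_fun setT g ->
  measurable_fun setT psi -> measurable_fun setT (flow_kernel i h g psi).
Proof.
move=> mg mpsi; apply: measurable_funM.
  by apply: measurableT_comp; [exact: measurable_unit_step|exact: measurable_fst].
apply: measurable_funM; first exact: measurableT_comp (measurable_line i).
exact: measurableT_comp measurable_snd.
Qed.

Lemma cube_line i (r h : R) x t : cube r x -> `|t| <= h -> cube (r + h) (line i x t).
Proof.
move=> hx th j; have /andP[h1 h2] := hx j; rewrite !mxE.
move: th; rewrite ler_norml => /andP[t1 t2].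
have h0 : 0 <= h by lra.
by case: (j == i); rewrite ?mulr1 ?mulr0 /=; lra.
Qed.

(** For [t] in [[0, h]], the line starting in the support of [psi] has not left the
    cube of radius [r + h], so each time slice is a translate of a function dominated
    by [g] on that cube, with a bound independent of [t]. *)
Lemma integrable_flow_kernel i (h r : R) g psi : cube_integrable g ->
  bounded_in_cube r psi ->
  (lambda \x mu)%E.-integrable setT (EFin \o flow_kernel i h g psi).
Proof.
move=> lg bpsi; have [mg ig] := lg; have [mpsi [C hC] sup] := bpsi.
have mk := measurable_flow_kernel i h mg mpsi.
have mK : measurable_fun setT (EFin \o flow_kernel i h g psi) by exact/measurable_EFinP.
apply/(integrable12ltyP lambda mu mK).
pose M := (\int[mu]_x (`|(g \_ (cube (r + h))) x| * C)%:E)%E.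
have mgc : measurable_fun setT (fun x => (`|(g \_ (cube (r + h))) x| * C)%:E).
  apply/measurable_EFinP; apply: measurable_funM => //.
  apply: measurableT_comp => //.
  apply/(measurable_restrictT g (measurable_cube (r + h))).
  exact: measurable_funTS.
have Mfin : (M < +oo)%E.
  have := integrableZr measurableT C (integrable_abse (integrable_restrict_cube (r + h) lg)).
  move=> /integrableP[mk']; apply: le_lt_trans; rewrite /M; apply: ge0_le_integral => //.
  - by move=> x _; rewrite lee_fin mulr_ge0 // (le_trans _ (hC x)).
  - exact: measurableT_comp.
  - by move=> x _ /=; rewrite lee_fin ler_norm.
apply: (@le_lt_trans _ _ (\int[lambda]_t ((unit_step h t)%:E * M))%E).
  apply: ge0_le_integral => //.
  - by move=> t _; exact: integral_ge0.
  - apply: (measurable_fun_fubini_tonelli_F (abse \o (EFin \o flow_kernel i h g psi))).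
      by apply: measurableT_comp => //; exact: mK.
    by move=> z /=; rewrite lee_fin.
  - by apply: emeasurable_funM => //; apply/measurable_EFinP; exact: measurable_unit_step.
  - move=> t _; rewrite /flow_kernel /=.
    rewrite /unit_step indicE; case: (boolP (t \in _)) => ht; last first.
      rewrite mul0e; under eq_integral do rewrite mul0r normr0.
      by rewrite integral0.
    rewrite mul1e; under eq_integral do rewrite mul1r.
    rewrite /M -(@ge0_integral_translate _ (t *: delta_mx ord0 i)); last 2 first.
    - exact: mgc.
    - by move=> x; rewrite lee_fin mulr_ge0 // (le_trans _ (hC x)).
    apply: ge0_le_integral => //.
    + apply/measurable_EFinP; apply: measurableT_comp => //; apply: measurable_funM => //.
      exact: (measurableT_comp mg (measurable_translate _)).
    + apply: (measurableT_comp (f := fun x => (`|(g \_ (cube (r + h))) x| * C)%:E)); last first.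
        exact: measurable_translate.
      exact: mgc.
    + move=> x _; rewrite lee_fin normrM.
      have [->|p0] := eqVneq (psi x) 0.
        by rewrite normr0 mulr0 mulr_ge0 // (le_trans _ (hC x)).
      rewrite patchE mem_set ?ler_wpM2l //.
      apply: cube_line; first exact: sup.
      by move: ht; rewrite inE /= in_itv /= => /andP[t0 th]; rewrite ger0_norm.
rewrite ge0_integralZr //.
- rewrite integral_indic // setIT; apply: lte_mul_pinfty => //.
    have L : (lebesgue_measure `[0%R, h]%classic < +oo)%E.
      by rewrite lebesgue_measure_itv /=; case: ifP; rewrite ltry.
    by rewrite ge0_fin_numE.
- by apply/measurable_EFinP; exact: measurable_unit_step.
- by move=> t _; rewrite lee_fin /unit_step indicE.
- apply: integral_ge0 => x _; rewrite lee_fin mulr_ge0 // (le_trans _ (hC x)) //.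
Qed.

End integral_translation.

(** * Smooth functions of one variable *)

Section smooth_functions.
Context {R : realType}.
Implicit Types (f g : R -> R) (x y a b : R) (P : {poly R}).

(** One-variable counterpart of [Ck]. The derivative is a witness, which lets
    sums and products be treated by induction on [k]. *)
Fixpoint smooth (k : nat) f : Prop :=
  match k with
  | 0 => continuous f
  | k'.+1 => exists2 f', (forall x, is_derive x 1 f (f' x)) & smooth k' f'
  end.

Lemma is_derive_continuous f (f' : R -> R) :
  (forall x, is_derive x 1 f (f' x)) -> continuous f.
Proof.
by move=> df x; apply/differentiable_continuous/derivable1_diffP; case: (df x).
Qed.

Lemma smoothW k f : smooth k.+1 f -> smooth k f.
Proof.
elim: k f => [|k IHk] f [f' df sf]; first exact: is_derive_continuous df.
by exists f' => //; exact: IHk.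
Qed.

Lemma smooth_continuous k f : smooth k f -> continuous f.
Proof. by case: k => // k [f' df _]; exact: is_derive_continuous df. Qed.

Lemma smoothD k f g : smooth k f -> smooth k g -> smooth k (f + g).
Proof.
elim: k f g => [|k IHk] f g.
  by move=> cf cg x; apply: cvgD; [exact: cf|exact: cg].
move=> [f' df sf] [g' dg sg]; exists (f' + g'); last exact: IHk.
by move=> x; apply: is_deriveD.
Qed.

Lemma smoothM k f g : smooth k f -> smooth k g -> smooth k (f * g).
Proof.
elim: k f g => [|k IHk] f g.
  by move=> cf cg x; apply: cvgM; [exact: cf|exact: cg].
move=> sf sg; have [f' df sf'] := sf; have [g' dg sg'] := sg.
exists (f * g' + g * f'); last by apply: smoothD; apply: IHk => //; exact: smoothW.
by move=> x; apply: is_deriveM.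
Qed.

Lemma smooth_affine k f a b : smooth k f -> smooth k (fun x => f (a * x + b)).
Proof.
have da x : is_derive x 1 (fun y => a * y + b) a.
  have -> : (fun y => a * y + b) = (a \*: id) + cst b by [].
  by apply: is_derive_eq; rewrite addr0 scaler1.
elim: k f => [|k IHk] f.
  move=> cf x; apply: (@continuous_comp _ _ _ (fun y => a * y + b) f).
    exact: (is_derive_continuous da).
  exact: cf.
move=> [f' df sf].
exists (cst a * (fun x => f' (a * x + b))).
  move=> x; have := @is_derive1_comp _ f (fun y => a * y + b) _ _ _ (df (a * x + b)) (da x).
  by move=> h; apply: is_derive_eq; rewrite mulrC.
apply: smoothM; last exact: IHk.
elim: (k) (a) => [|m IHm] c; first exact: cst_continuous.
by exists (cst 0) => // x; exact: is_derive_cst.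
Qed.

(** The family [P(1/x) exp(-1/x)], extended by zero to [x <= 0], is closed under
    differentiation; this is why [exp(-1/x)] is smooth at [0]. *)
Definition flat P x : R := if 0 < x then P.[x^-1] * expR (- x^-1) else 0.

Lemma poly_growth P : exists2 C : R, 0 <= C &
  forall y, 1 <= y -> `|P.[y]| <= C * y ^+ size P.
Proof.
exists (\sum_(i < size P) `|P`_i|); first exact: sumr_ge0.
move=> y y1; rewrite horner_coef mulr_suml (le_trans (ler_norm_sum _ _ _)) //.
apply: ler_sum => i _; rewrite normrM normrX (ger0_norm (le_trans ler01 y1)).
by rewrite ler_wpM2l // ler_weXn2l // ltnW.
Qed.

(** With [y = 1 / x], the left-hand side is the difference quotient of [flat P] at
    [0], so this is the differentiability of [flat P] there. *)
Lemma poly_expN_small P : exists2 C : R, 0 <= C &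
  forall y, 1 <= y -> `|y * P.[y] * expR (- y)| <= C / y.
Proof.
have [C C0 hC] := poly_growth P.
set m := (size P).+1.
exists (C * m.+1`!%:R); first by rewrite mulr_ge0.
move=> y y1; have y0 : 0 < y by exact: lt_le_trans y1.
have fm : 0 < m.+1`!%:R :> R by rewrite ltr0n fact_gt0.
rewrite !normrM (gtr0_norm y0) (ger0_norm (expR_ge0 _)) ler_pdivlMr //.
rewrite expRN mulrAC ler_pdivrMr ?expR_gt0 //.
have h : y ^+ m.+1 <= m.+1`!%:R * expR y.
  rewrite mulrC -ler_pdivrMr // (le_trans _ (expR_ge1Dxn m (ltW y0))) //.
  by rewrite lerDr.
apply: le_trans (_ : C * y ^+ m.+1 <= _).
  rewrite /m mulrAC !exprS mulrCA -expr2; apply: le_trans (ler_wpM2l (sqr_ge0 y) (hC y y1)) _.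
  by rewrite le_eqVlt; apply/orP; left; apply/eqP; ring.
by rewrite -mulrA ler_wpM2l.
Qed.

Lemma is_derive_flat P x : is_derive x 1 (flat P) (flat ('X^2 * (P - P^`())) x).
Proof.
have [x0|x0|->] := ltgtP x 0.
- rewrite /flat ltNge (ltW x0) /=.
  apply: (@near_eq_is_derive _ _ _ (cst 0) (fun y => if 0 < y then _ else 0)).
  by apply: filterS (lt_nbhsl x0) => y y0; rewrite ltNge ltW.
- rewrite {2}/flat x0.
  apply: (@near_eq_is_derive _ _ _ (fun y => P.[y^-1] * expR (- y^-1))).
    by apply: filterS (open_nbhs_nbhs (conj (@open_gt R 0) x0)) => y y0; rewrite /flat y0.
  have dV : is_derive x 1 (fun y : R => y^-1) (- x^-2).
    apply: DeriveDef; first by apply: derivableV; rewrite ?lt0r_neq0.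
    by rewrite deriveV ?lt0r_neq0 // derive_id scaler1.
  have dP := is_derive1_comp (is_derive_poly P x^-1) dV.
  have dN : is_derive x 1 (fun y : R => - y^-1) (x^-2).
    by apply: is_derive_eq; rewrite opprK.
  have dE := @is_derive1_comp _ expR (fun y : R => - y^-1) _ _ _ (is_derive_expR _) dN.
  have := is_deriveM dP dE; set A := (X in is_derive _ _ X).
  have -> : A = (fun y => P.[y^-1] * expR (- y^-1)) by [].
  move=> h; apply: is_derive_eq; rewrite /GRing.scale /= hornerM hornerD hornerN hornerXn exprVn; ring.
- rewrite {2}/flat ltxx.
  have [C C0 hC] := poly_expN_small P.
  have L : (fun h : R => h^-1 *: (flat P (h *: 1 + 0) - flat P 0)) @ 0^' --> (0 : R).
    apply/cvgrPdist_le => e e0; near=> h; rewrite sub0r normrN.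
    have h0 : h != 0 by near: h; exact: nbhs_dnbhs_neq.
    have h1 : `|h| <= 1 by near: h; apply: dnbhs0_le.
    have h2 : `|h| <= e / (C + 1).
      by near: h; apply: dnbhs0_le; rewrite divr_gt0 // ltr_wpDl.
    rewrite [_ *: 1]mulr1 addr0 /flat ltxx subr0; case: ifPn => hp; last first.
      by rewrite scaler0 normr0 ltW.
    rewrite gtr0_norm // in h1 h2.
    have := hC h^-1; rewrite invr_ge1 ?unitfE // h1 => /(_ isT).
    rewrite invrK /GRing.scale /= mulrA => /le_trans; apply.
    move: h2; rewrite ler_pdivlMr ?ltr_wpDl // => h2.
    by rewrite (le_trans _ h2) // mulrC ler_pM2l // lerDl.
  apply: DeriveDef; first by apply/cvg_ex; exists 0.
  exact: cvg_lim L.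
Unshelve. all: by end_near. Qed.

Lemma smooth_flat k P : smooth k (flat P).
Proof.
elim: k P => [|k IHk] P; first exact: is_derive_continuous (is_derive_flat P).
by exists (flat ('X^2 * (P - P^`()))) => //; exact: is_derive_flat.
Qed.

Lemma flat1_gt0 x : 0 < x -> flat 1 x = expR (- x^-1).
Proof. by move=> x0; rewrite /flat x0 hornerC mul1r. Qed.

Lemma flat1_le0 x : x <= 0 -> flat 1 x = 0.
Proof. by move=> x0; rewrite /flat ltNge x0. Qed.

Lemma flat1_ge0 x : 0 <= flat 1 x.
Proof.
by have [/flat1_gt0 ->|/flat1_le0 ->] := ltP 0 x; rewrite ?expR_ge0.
Qed.

Lemma flat1_le1 x : flat 1 x <= 1.
Proof.
have [x0|/flat1_le0 ->//] := ltP 0 x.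
by rewrite flat1_gt0 // -[leRHS]expR0 ler_expR oppr_le0 invr_ge0 ltW.
Qed.

(** Smooth, supported in [[a, b]], and increasing to the indicator of [`]a, b[] as
    [m] grows, since [exp(-1/(m y))] tends to [1] for [y > 0]. *)
Definition plateau (m : nat) a b x : R :=
  flat 1 (m.+1%:R * (x - a)) * flat 1 (m.+1%:R * (b - x)).

Lemma smooth_plateau k m a b : smooth k (plateau m a b).
Proof.
apply: smoothM.
  have := smooth_affine m.+1%:R (- (m.+1%:R * a)) (smooth_flat k 1).
  by congr smooth; apply/funext => x; rewrite -mulrBr.
have := smooth_affine (- m.+1%:R) (m.+1%:R * b) (smooth_flat k 1).
by congr smooth; apply/funext => x; congr flat; ring.
Qed.

Lemma plateau_ge0 m a b x : 0 <= plateau m a b x.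
Proof. by rewrite mulr_ge0 // flat1_ge0. Qed.

Lemma plateau_le1 m a b x : plateau m a b x <= 1.
Proof. by rewrite mulr_ile1 // ?flat1_ge0 // flat1_le1. Qed.

Lemma plateau_support m a b x : plateau m a b x != 0 -> a < x < b.
Proof.
apply: contraNT; rewrite negb_and -!leNgt => /orP[h|h]; rewrite /plateau.
  by rewrite flat1_le0 ?mul0r // pmulr_rle0 // subr_le0.
by rewrite [X in _ * X]flat1_le0 ?mulr0 // pmulr_rle0 // subr_le0.
Qed.

Lemma plateau_cvg a b x :
  plateau m a b x @[m --> \oo] --> (\1_(`]a, b[%classic : set R) x : R).
Proof.
have flat_cvg (y : R) : 0 < y -> flat 1 (m.+1%:R * y) @[m --> \oo] --> (1 : R).
  move=> y0.
  have : expR (- (m.+1%:R^-1 * y^-1)) @[m --> \oo] --> expR (- (0 * y^-1)).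
    apply: (@cvg_comp _ _ _ (fun m : nat => - (m.+1%:R^-1 * y^-1)) expR); last exact: continuous_expR.
    by apply: cvgN; apply: cvgMr_tmp; exact: cvg_harmonic.
  rewrite mul0r oppr0 expR0.
  rewrite (_ : (fun m : nat => _) = (fun m : nat => flat 1 (m.+1%:R * y))) //.
  by apply/funext => m; rewrite flat1_gt0 ?mulr_gt0 // invfM.
rewrite indicE; case: (boolP (x \in _)) => h.
  move: h; rewrite inE /= in_itv /= => /andP[ax xb].
  rewrite -[X in _ --> X]mulr1; apply: cvgM; apply: flat_cvg; rewrite subr_gt0 //.
have -> : (fun m => plateau m a b x) = cst 0; last exact: cvg_cst.
apply/funext => m; apply/eqP; apply: contraNT h => /plateau_support ?.
by rewrite inE /= in_itv.
Qed.

End smooth_functions.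

(** * Product bumps and the fundamental lemma of the calculus of variations *)

Section tensor_test_functions.
Context {R : realType} {n : nat}.
Local Notation mu := (@leb R n).
Implicit Types (eta : 'I_n -> R -> R) (x : 'rV[R]_n) (a b : 'I_n -> R) (i : 'I_n).

Definition tensor eta x : R := \prod_(i < n) eta i (x ord0 i).

Lemma continuous_tensor eta : (forall i, continuous (eta i)) -> continuous (tensor eta).
Proof.
move=> ceta x; rewrite /tensor; elim: (index_enum _) => [|j s IHs].
  rewrite (_ : (fun _ => _) = cst 1); first exact: cst_continuous.
  by apply/funext => y; rewrite big_nil.
rewrite (_ : (fun _ => _) = (fun y : 'rV[R]_n =>
    eta j (y ord0 j) * \prod_(i <- s) eta i (y ord0 i))); last first.
  by apply/funext => y; rewrite big_cons.
apply: (@continuousM _ _ (fun y : 'rV[R]_n => eta j (y ord0 j))); last exact: IHs.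
apply: (@continuous_comp _ _ _ (fun y : 'rV[R]_n => y ord0 j) (eta j)).
  exact: coord_continuous.
exact: ceta.
Qed.

Lemma is_derive_tensor eta i (d : R -> R) x :
  (forall t : R, is_derive t 1 (eta i) (d t)) ->
  is_derive x (delta_mx ord0 i) (tensor eta)
    (tensor (fun j => if j == i then d else eta j) x).
Proof.
move=> deta.
pose c := \prod_(j < n | j != i) eta j (x ord0 j).
have E1 (h : R) : tensor eta (h *: delta_mx ord0 i + x) = eta i (h + x ord0 i) * c.
  rewrite /tensor (bigD1 i) //= !mxE !eqxx /= mulr1; congr (_ * _).
  by apply: eq_bigr => j ji; rewrite !mxE (negbTE ji) andbF mulr0 add0r.
have E2 : tensor (fun j => if j == i then d else eta j) x = d (x ord0 i) * c.
  rewrite /tensor (bigD1 i) //= eqxx; congr (_ * _).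
  by apply: eq_bigr => j ji; rewrite (negbTE ji).
have [dD dV] := deta (x ord0 i).
have L : (fun h : R => h^-1 *: (tensor eta (h *: delta_mx ord0 i + x) - tensor eta x))
    @ 0^' --> d (x ord0 i) * c.
  have -> : (fun h : R => h^-1 *: (tensor eta (h *: delta_mx ord0 i + x) - tensor eta x))
     = (fun h : R => h^-1 *: (eta i (h *: 1 + x ord0 i) - eta i (x ord0 i)) * c).
    apply/funext => h; rewrite E1.
    have := E1 0; rewrite scale0r !add0r => ->.
    by rewrite -mulrBl [h *: 1]mulr1 /GRing.scale /= mulrA.
  apply: cvgMr_tmp; rewrite -dV; exact: dD.
rewrite E2; apply: DeriveDef; first by apply/cvg_ex; eexists; exact: L.
exact: cvg_lim L.
Qed.

Lemma Ck_tensor k eta : (forall i, smooth k (eta i)) -> Ck k setT (tensor eta).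
Proof.
elim: k eta => [|k IHk] eta seta; split => //.
- by move=> x _; apply: continuous_tensor => i; exact: smooth_continuous (seta i).
- by move=> x _; apply: continuous_tensor => i; exact: smooth_continuous (seta i).
- move=> i; have [d deta sd] := seta i.
  have D x := is_derive_tensor x deta.
  split; first by move=> x _; case: (D x).
  have -> : partial (tensor eta) i = tensor (fun j => if j == i then d else eta j).
    by apply/funext => x; rewrite /partial; case: (D x).
  by apply: IHk => j; case: ifP => _ //; exact: smoothW (seta j).
Qed.

Lemma test_function_tensor eta a b : (forall k i, smooth k (eta i)) ->
  (forall i t, eta i t != 0 -> a i < t < b i) -> test_function (tensor eta).
Proof.
move=> seta sup; split; first by move=> k; apply: Ck_tensor => i; exact: seta.
have Kc : compact [set v : 'rV[R]_n | forall i, `[a i, b i]%classic (v ord0 i)].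
  apply: (@rV_compact R n (fun i => `[a i, b i]%classic)) => i.
  exact: segment_compact.
apply: (subclosed_compact (@closed_closure _ _) Kc).
have -> : [set v : 'rV[R]_n | forall i, `[a i, b i]%classic (v ord0 i)] =
    closure [set v : 'rV[R]_n | forall i, `[a i, b i]%classic (v ord0 i)].
  by apply/closure_id; apply: compact_closed => //; exact: norm_hausdorff.
apply: closure_subset => x /= h i.
have : eta i (x ord0 i) != 0.
  by apply: contra h => /eqP h; rewrite /tensor (bigD1 i) //= h mul0r.
by move=> /sup /andP[h1 h2]; rewrite /= in_itv /= !ltW.
Qed.

Definition box a b : set 'rV[R]_n := [set x | forall i, a i < x ord0 i < b i].

Definition bump m a b := tensor (fun i => plateau m (a i) (b i)).

Lemma test_function_bump m a b : test_function (bump m a b).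
Proof.
apply: (test_function_tensor (a := a) (b := b)) => [k i|i t].
  exact: smooth_plateau.
exact: plateau_support.
Qed.

Lemma bump_ge0 m a b x : 0 <= bump m a b x.
Proof. by apply: prodr_ge0 => i _; exact: plateau_ge0. Qed.

Lemma bump_le1 m a b x : bump m a b x <= 1.
Proof.
apply: prodr_ile1 => i _; first by rewrite plateau_ge0 plateau_le1.
Qed.

Lemma bump_support m a b x : bump m a b x != 0 -> box a b x.
Proof.
move=> h i; apply: (@plateau_support _ m); apply: contra h => /eqP h.
by rewrite /bump /tensor (bigD1 i) //= h mul0r.
Qed.

Lemma bump_cvg a b x : bump m a b x @[m --> \oo] --> (\1_(box a b) x : R).
Proof.
have -> : (\1_(box a b) x : R) = \prod_(i < n) \1_(`]a i, b i[%classic : set R) (x ord0 i).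
  rewrite indicE; case: (boolP (x \in box a b)) => h.
    rewrite big1 // => i _; rewrite indicE mem_set //=.
    by move: h; rewrite inE => /(_ i); rewrite in_itv.
  have /existsNP[i hi] : ~ forall i, a i < x ord0 i < b i.
    by move=> k; move: h => /negP; apply; rewrite inE.
  rewrite (bigD1 i) //= indicE memNset ?mul0r //=.
rewrite /bump /tensor; elim: (index_enum _) => [|j s IHs].
  rewrite big_nil (_ : (fun _ => _) = cst 1); first exact: cvg_cst.
  by apply/funext => m; rewrite big_nil.
rewrite big_cons (_ : (fun _ => _) = (fun m : nat => plateau m (a j) (b j) (x ord0 j) *
    \prod_(i <- s) plateau m (a i) (b i) (x ord0 i))); last first.
  by apply/funext => m; rewrite big_cons.
by apply: cvgM => //; exact: plateau_cvg.
Qed.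

Lemma measurable_box a b : measurable (box a b).
Proof.
apply: (measurable_rV_box (A := fun i => [set y : R | a i < y < b i])) => i.
have -> : [set y : R | a i < y < b i] = `]a i, b i[%classic.
  by apply/seteqP; split => y /=; rewrite in_itv.
exact: measurable_itv.
Qed.

Definition boxes : set (set 'rV[R]_n) := [set A | exists a b, A = box a b].

Lemma cube_box (r : R) : @cube R n r = box (fun=> - r) (fun=> r).
Proof. by []. Qed.

Lemma boxI a b c d :
  box a b `&` box c d = box (fun i => Num.max (a i) (c i)) (fun i => Num.min (b i) (d i)).
Proof.
apply/seteqP; split => [x [h1 h2] i|x h].
  by have := h1 i; have := h2 i; rewrite gt_max lt_min => /andP[-> ->] /andP[-> ->].
by split => i; have := h i; rewrite gt_max lt_min => /andP[/andP[h1 h2] /andP[h3 h4]]; apply/andP.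
Qed.

Lemma setI_closed_boxes : setI_closed boxes.
Proof. by move=> _ _ [a [b ->]] [c [d ->]]; rewrite boxI; do 2 eexists. Qed.

(** A slab [c < x_i < d] is the increasing union of its intersections with cubes,
    which are boxes. Boxes are also stable under intersection, so measures are
    determined by their values on boxes. *)
Lemma measurable_boxes : @measurable _ 'rV[R]_n = <<s boxes >>.
Proof.
apply/seteqP; split; last first.
  apply: smallest_sub; first exact: sigma_algebra_measurable.
  by move=> _ [a [b ->]]; exact: measurable_box.
have sb : sigma_algebra setT (<<s boxes >>) by exact: smallest_sigma_algebra.
apply: smallest_sub => //; rewrite -bigcup_seq; apply: bigcup_sub => i _.
pose f (x : g_sigma_algebraType boxes) : R := (x : 'rV[R]_n) ord0 i.
have mf : measurable_fun setT f.
  apply: (measurability _ (RGenOpens.measurableE R)) => //.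
  move=> _ [_ [c [d ->]] <-]; rewrite setTI.
  have -> : f @^-1` `]c, d[%classic = \bigcup_k
     (box (fun j => if j == i then c else - k%:R) (fun j => if j == i then d else k%:R)).
    apply/seteqP; split => [x /= h|x [k _ /(_ i)] /=]; last by rewrite eqxx in_itv.
    have [k hk] := cube_cover (x : 'rV[R]_n); exists k => // j.
    by case: eqP => [->|_]; [move: h; rewrite in_itv|exact: hk].
  apply: bigcupT_measurable => k; apply: sub_sigma_algebra.
  by do 2 eexists.
by move=> A [B mB <-]; exact: mf.
Qed.

(** The positive and negative parts of [G] are densities of two finite measures that
    agree on boxes, hence everywhere. *)
Lemma integral_boxes_eq0 (G : 'rV[R]_n -> \bar R) : mu.-integrable setT G ->
  (forall a b, (\int[mu]_(x in box a b) G x = 0)%E) ->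
  forall E, measurable E -> (\int[mu]_(x in E) G x = 0)%E.
Proof.
move=> iG G0.
have mG : measurable_fun setT G by case/integrableP : iG.
have fin A : measurable A ->
    (\int[mu]_(x in A) (G^\+ x)%E \is a fin_num)%E /\
    (\int[mu]_(x in A) (G^\- x)%E \is a fin_num)%E.
  move=> mA; have iA := integrableS measurableT mA (@subsetT _ A) iG.
  by split; apply: integrable_fin_num => //; [exact: integrable_funepos|exact: integrable_funeneg].
have pack (h : 'rV[R]_n -> \bar R) : measurable_fun setT h -> (forall x, 0 <= h x)%E ->
    exists m : {measure set 'rV[R]_n -> \bar R}, forall A, m A = (\int[mu]_(x in A) h x)%E.
  move=> mh h0; pose nu A := (\int[mu]_(x in A) h x)%E.
  have nu0 : nu set0 = 0%E by exact: integral_set0.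
  have nu_ge0 A : (0 <= nu A)%E by exact: integral_ge0.
  have nu_sa : semi_sigma_additive nu by exact: semi_sigma_additive_nng_induced.
  exists (HB.pack_for {measure set 'rV[R]_n -> \bar R} nu
      (isMeasure.Build _ _ _ nu nu0 nu_ge0 nu_sa)).
  by [].
have [mp hmp] := pack _ (measurable_funepos mG) (funepos_ge0 G).
have [mn hmn] := pack _ (measurable_funeneg mG) (funeneg_ge0 G).
have eqm : forall A, measurable A -> mp A = mn A.
  apply: (measure_unique boxes (fun k => cube k%:R)).
  - exact: measurable_boxes.
  - exact: setI_closed_boxes.
  - by move=> k; rewrite cube_box; do 2 eexists.
  - by apply/seteqP; split => // x _; have [k hk] := cube_cover x; exists k.
  - move=> _ [a [b ->]]; rewrite hmp hmn.
    have [f1 f2] := fin _ (measurable_box a b).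
    by have := G0 a b; rewrite integralE => /eqP; rewrite sube_eq ?fin_num_adde_defl // add0e => /eqP.
  - move=> k; rewrite hmp; have [f1 _] := fin _ (measurable_cube (n := n) k%:R).
    by rewrite -ge0_fin_numE //; apply: integral_ge0.
move=> E mE; rewrite integralE.
by have := eqm E mE; rewrite hmp hmn => ->; rewrite subee //; have [] := fin E mE.
Qed.

(** Bumps converge boundedly to the indicator of a box, so [g] has integral zero on
    every box, hence on every measurable subset of a cube. *)
Lemma fundamental_lemma (g : 'rV[R]_n -> R) : cube_integrable g ->
  (forall m a b, (\int[mu]_x (g x * bump m a b x)%:E = 0)%E) ->
  {ae mu, forall x, g x = 0}.
Proof.
move=> lg g0.
have key (r : R) a b : (\int[mu]_(x in box a b) ((g \_ (cube r)) x)%:E = 0)%E.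
  rewrite integral_mkcond.
  set c := fun i => Num.max (a i) (- r); set d := fun i => Num.min (b i) r.
  transitivity (\int[mu]_x ((g x * \1_(box c d) x)%:E))%E.
    apply: eq_integral => x _; rewrite patchE /= patchE -boxI -cube_box indicI /=.
    rewrite !indicE; case: (x \in box a b); case: (x \in cube r) => /=;
      by rewrite ?mulr1 ?mulr0 // ?mul0r ?mulr0.
  have := @dominated_convergence _ _ _ mu setT measurableT
    (fun m x => (g x * bump m c d x)%:E) (fun x => (g x * \1_(box c d) x)%:E)
    (fun x => `| ((g \_ (cube r)) x)%:E |%E).
  case.
  - move=> m; apply/measurable_EFinP; apply: measurable_funM; first exact: lg.1.
    apply: continuous_measurable_rV; first exact: openT.
    by have [+ _] := test_function_bump m c d => /(_ 0)[].
  - apply/measurable_EFinP; apply: measurable_funM; first exact: lg.1.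
    by apply: measurable_indic; exact: measurable_box.
  - apply: aeW => x _; apply: cvg_EFin; first by apply: nearW.
    by apply: cvgMl_tmp; exact: bump_cvg.
  - exact: integrable_abse (integrable_restrict_cube r lg).
  - apply: aeW => x m _ /=; rewrite lee_fin normrM (ger0_norm (bump_ge0 _ _ _ _)).
    have [->|h] := eqVneq (bump m c d x) 0; first by rewrite mulr0.
    have := bump_support h; rewrite -boxI => -[_ hx].
    rewrite patchE mem_set //; by rewrite ler_piMr // bump_le1.
  move=> _ _; under eq_fun do rewrite g0.
  by move=> /cvg_lim; rewrite lim_cst //; move=> <-.
have zero (r : nat) : {ae mu, forall x, setT x -> ((g \_ (cube r%:R)) x)%:E = 0%E}.
  have ig := integrable_restrict_cube r%:R lg.
  apply: (@integral_ae_eq _ _ _ mu setT measurableT (cst 0%E)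
    (EFin \o (g \_ (cube r%:R)))) => //.
  move=> E _ mE; rewrite integral0.
  set G := EFin \o (g \_ (cube r%:R)) in ig *.
  by apply: (integral_boxes_eq0 (G := G)) => //; exact: key.
have all0 : {ae mu, forall x, forall r : nat, (g \_ (cube r%:R)) x = 0}.
  apply/ae_foralln => r.
  by apply: filterS (zero r) => x /(_ I) [].
apply: filterS all0 => x h; have [r hr] := cube_cover x.
by have := h r; rewrite patchE mem_set.
Qed.

End tensor_test_functions.

(** * Integrals along lines and their duality *)

Section fubini_right.
Local Open Scope ereal_scope.
Context d1 d2 (T1 : measurableType d1) (T2 : measurableType d2) (R : realType).
Variable m1 : {sigma_finite_measure set T1 -> \bar R}.
Variable m2 : {sigma_finite_measure set T2 -> \bar R}.
Variable f : T1 * T2 -> \bar R.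

Lemma integrable_fubini_G : (m1 \x m2).-integrable setT f ->
  m2.-integrable setT (fun y => \int[m1]_x f (x, y)).
Proof.
move=> intf; have /integrableP[mf _] := intf.
apply/integrableP; split; first exact: measurable_fubini_G intf.
apply: le_lt_trans ((integrable21ltyP m1 m2 mf).1 intf).
apply: ge0_le_integral => //.
- by apply: measurableT_comp => //; exact: measurable_fubini_G intf.
- apply: (measurable_fun_fubini_tonelli_G (abse \o f)).
    exact: measurableT_comp.
  by move=> z; exact: abse_ge0.
- move=> y _; apply: le_abse_integral => //.
  exact: (measurableT_comp mf (measurable_pair2 y)).
Qed.

End fubini_right.

Section flow.
Context {R : realType} {n : nat}.
Local Notation mu := (@leb R n).
Local Notation lambda := (@lebesgue_measure R).
Implicit Types (f g u psi : 'rV[R]_n -> R) (x a : 'rV[R]_n) (i : 'I_n).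

Lemma bounded_in_cube_line i r t psi : bounded_in_cube r psi ->
  bounded_in_cube (r + `|t|) (fun x => psi (line i x t)).
Proof.
move=> [mpsi [C hC] sup]; split.
- exact: (measurableT_comp mpsi (measurable_translate _)).
- by exists C.
- move=> x /sup hx.
  have -> : x = line i (line i x t) (- t) by rewrite /line scaleNr addrK.
  by apply: cube_line => //; rewrite normrN.
Qed.

Definition line_int i h g x : R := fine (\int[lambda]_t (unit_step h t * g (line i x t))%:E).

Definition pairing i g psi (t : R) : \bar R :=
  (\int[mu]_x (g x * psi (line i x (- t)))%:E)%E.

Lemma lineK i x t : line i (line i x t) (- t) = x.
Proof. by rewrite /line scaleNr addrK. Qed.

Lemma line0 i x : line i x 0 = x.
Proof. by rewrite /line scale0r addr0. Qed.

Lemma integrable_pairing i g psi r t : cube_integrable g -> bounded_in_cube r psi ->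
  mu.-integrable setT (fun x => (g x * psi (line i x (- t)))%:E).
Proof.
move=> lg bpsi; exact: (integrable_mul_bounded lg (bounded_in_cube_line i (- t) bpsi)).
Qed.

Lemma flow_kernel_pairing i h r g psi t : cube_integrable g -> bounded_in_cube r psi ->
  (\int[mu]_x (flow_kernel i h g psi (t, x))%:E =
   (unit_step h t)%:E * pairing i g psi t)%E.
Proof.
move=> lg bpsi; rewrite /flow_kernel /=.
have ip := integrable_pairing i t lg bpsi.
rewrite /pairing -integralZl //.
rewrite -(@integral_translate _ _ (fun x => unit_step h t * (g x * psi (line i x (- t))))
   (t *: delta_mx ord0 i)).
  by apply: eq_integral => x _; rewrite -/(line i x t) lineK.
exact: (integrableZl measurableT (unit_step h t) ip).
Qed.

Lemma flow_kernel_fubini i h r g psi : cube_integrable g -> bounded_in_cube r psi ->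
  (\int[mu]_x \int[lambda]_t (flow_kernel i h g psi (t, x))%:E =
   \int[lambda]_t ((unit_step h t)%:E * pairing i g psi t))%E.
Proof.
move=> lg bpsi.
rewrite -(Fubini (integrable_flow_kernel i h lg bpsi)).
by apply: eq_integral => t _; exact: flow_kernel_pairing bpsi.
Qed.

Lemma integrable_pairing_time i h r g psi : cube_integrable g -> bounded_in_cube r psi ->
  lambda.-integrable setT (fun t => ((unit_step h t)%:E * pairing i g psi t)%E).
Proof.
move=> lg bpsi.
have := integrable_fubini_F (integrable_flow_kernel i h lg bpsi).
apply: eq_integrable => // t _.
by rewrite -(flow_kernel_pairing i h t lg bpsi).
Qed.

(** The kernel [flow_kernel] after the change of variable [x - t e_i], which moves
    the flow from [g] to [psi]. *)
Definition dual_kernel i h g psi (z : measurableTypeR R * 'rV[R]_n) : R :=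
  unit_step h z.1 * (g z.2 * psi (line i z.2 (- z.1))).

Lemma integrable_dual_kernel i h r g psi : cube_integrable g -> bounded_in_cube r psi ->
  (lambda \x mu)%E.-integrable setT (EFin \o dual_kernel i h g psi).
Proof.
move=> lg bpsi; have [mpsi _ _] := bpsi.
have mK : measurable_fun setT (EFin \o dual_kernel i h g psi).
  apply/measurable_EFinP; apply: measurable_funM.
    by apply: measurableT_comp; [exact: measurable_unit_step|exact: measurable_fst].
  apply: measurable_funM; first exact: (measurableT_comp lg.1 measurable_snd).
  apply: (measurableT_comp mpsi).
  pose neg (z : measurableTypeR R * 'rV[R]_n) : measurableTypeR R * 'rV[R]_n := (- z.1, z.2).
  apply: (measurableT_comp (measurable_line i) (g := neg)).
  apply/measurable_fun_pairP; split; last exact: measurable_snd.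
  exact: (measurableT_comp (@oppr_measurable R setT) measurable_fst).
apply/(integrable12ltyP lambda mu mK).
have iF := integrable_flow_kernel i h lg bpsi.
have /integrableP[mF _] := iF.
move/(integrable12ltyP lambda mu mF) : iF; apply: le_lt_trans.
rewrite le_eqVlt; apply/orP; left; apply/eqP; apply: eq_integral => t _.
rewrite -(@ge0_integral_translate _ _ (fun x => `|(EFin \o dual_kernel i h g psi) (t, x)|%E)
  (t *: delta_mx ord0 i)) //.
  by apply: eq_integral => x _; rewrite /= /dual_kernel /= -/(line i x t) lineK.
apply: (measurableT_comp _ (f := abse)) => //.
exact: (measurableT_comp mK (measurable_pair1 t)).
Qed.

Lemma dual_kernel_fubini i h r g psi : cube_integrable g -> bounded_in_cube r psi ->
  (\int[mu]_x \int[lambda]_t (dual_kernel i h g psi (t, x))%:E =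
   \int[lambda]_t ((unit_step h t)%:E * pairing i g psi t))%E.
Proof.
move=> lg bpsi.
rewrite -(Fubini (integrable_dual_kernel i h lg bpsi)).
apply: eq_integral => t _; rewrite /pairing -integralZl //.
exact: integrable_pairing bpsi.
Qed.

Lemma measurable_line_int i h g : measurable_fun setT g -> measurable_fun setT (line_int i h g).
Proof.
move=> mg; apply: measurableT_comp; first exact: fine_measurable.
pose k (z : measurableTypeR R * 'rV[R]_n) : \bar R := (unit_step h z.1 * g (line i z.2 z.1))%:E.
have mk : measurable_fun setT k.
  apply/measurable_EFinP; apply: measurable_funM.
    by apply: measurableT_comp; [exact: measurable_unit_step|exact: measurable_fst].
  exact: (measurableT_comp mg (measurable_line i)).
(* [g] is merely measurable, so the integral is split into its two parts in order to
   apply Tonelli's theorem *)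
have -> : (fun x => \int[lambda]_t (unit_step h t * g (line i x t))%:E)%E =
    (fun x => (\int[lambda]_t (k^\+ (t, x))) - (\int[lambda]_t (k^\- (t, x))))%E.
  apply/funext => x; rewrite integralE; congr (_ - _)%E; apply: eq_integral => t _.
    by rewrite !funeposE.
  by rewrite !funenegE.
apply: emeasurable_funB.
  apply: (measurable_fun_fubini_tonelli_G (m1 := lambda) k^\+%E) => //.
  exact: measurable_funepos.
apply: (measurable_fun_fubini_tonelli_G (m1 := lambda) k^\-%E) => //.
exact: measurable_funeneg.
Qed.

Lemma bounded_in_cube_indic r : @bounded_in_cube R n r (\1_(cube r)).
Proof.
split.
- by apply: measurable_indic; exact: measurable_cube.
- by exists 1 => x; rewrite indicE; case: (_ \in _); rewrite ?normr1 ?normr0.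
- by move=> x; rewrite indicE; case: (boolP (x \in _)); rewrite ?eqxx // inE.
Qed.

Lemma ae_integrable_line i h g : cube_integrable g ->
  {ae mu, forall x, lambda.-integrable setT (fun t => (unit_step h t * g (line i x t))%:E)}.
Proof.
move=> lg.
have : {ae mu, forall x, forall r : nat, lambda.-integrable setT
    (fun t => (flow_kernel i h g (\1_(cube r%:R)) (t, x))%:E)}.
  apply/ae_foralln => r.
  exact: (ae_integrable2 (integrable_flow_kernel i h lg (bounded_in_cube_indic r%:R))).
apply: filterS => x hx; have [r hr] := cube_cover x.
apply: eq_integrable (hx r) => // t _.
have e1 : \1_(cube r%:R) x = 1 :> R by rewrite indicE mem_set.
by rewrite /flow_kernel /= e1 mulr1.
Qed.

Lemma flow_kernel_line_int i h r g psi : cube_integrable g -> bounded_in_cube r psi ->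
  {ae mu, forall x, (\int[lambda]_t (flow_kernel i h g psi (t, x))%:E =
    (line_int i h g x * psi x)%:E)%E}.
Proof.
move=> lg bpsi; apply: filterS (ae_integrable_line i h lg) => x ix.
rewrite EFinM /line_int fineK; last exact: integrable_fin_num.
rewrite -integralZr //; apply: eq_integral => t _.
by rewrite /flow_kernel /= -EFinM mulrA.
Qed.

Lemma cube_integrable_line_int i h g : cube_integrable g -> cube_integrable (line_int i h g).
Proof.
move=> lg; split; first exact: measurable_line_int lg.1.
move=> r; have b1 := bounded_in_cube_indic r.
have iG := integrable_fubini_G (integrable_flow_kernel i h lg b1).
have := integrableS measurableT (measurable_cube (n := n) r) (@subsetT _ _) iG.
have mA : measurable_fun (cube r) (EFin \o line_int i h g).
  by apply/measurable_EFinP; apply: measurable_funTS; exact: measurable_line_int lg.1.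
move=> iC; apply/integrableP; split => //.
have /integrableP[mC] := iC; apply: le_lt_trans.
rewrite le_eqVlt; apply/orP; left; apply/eqP; apply: ge0_ae_eq_integral => //.
- exact: measurable_cube.
- exact: measurableT_comp.
- exact: measurableT_comp.
- apply: filterS (flow_kernel_line_int i h lg b1) => x /= hx xr.
  have e1 : \1_(cube r) x = 1 :> R by rewrite indicE mem_set.
  by rewrite /fubini_G /= hx e1 mulr1.
Qed.

(** Fubini's theorem and translation invariance carry the line integral from [g] to
    the function it is tested against. *)
Lemma line_int_pairing i h r g psi : cube_integrable g -> bounded_in_cube r psi ->
  (\int[mu]_x (line_int i h g x * psi x)%:E =
   \int[lambda]_t ((unit_step h t)%:E * pairing i g psi t))%E.
Proof.
move=> lg bpsi; rewrite -(flow_kernel_fubini i h lg bpsi).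
have iG := integrable_fubini_G (integrable_flow_kernel i h lg bpsi).
apply: ae_eq_integral => //.
- apply/measurable_EFinP; apply: measurable_funM; first exact: measurable_line_int lg.1.
  by case: bpsi.
- by case/integrableP : iG.
- by apply: filterS (flow_kernel_line_int i h lg bpsi) => x /= ->.
Qed.

End flow.

(** * Weak derivatives and absolute continuity along lines *)

Section test_function_calculus.
Context {R : realType} {n : nat}.
Local Notation mu := (@leb R n).
Local Notation lambda := (@lebesgue_measure R).
Implicit Types (g u phi psi : 'rV[R]_n -> R) (x : 'rV[R]_n) (i : 'I_n).

Lemma coord_le_norm x i : `|x ord0 i| <= `|x|.
Proof.
apply/ler_addgt0Pr => e e0.
have : ball x (`|x| + e) 0.
  by rewrite -ball_normE /= subr0 ltrDl.
move=> [_ /(_ ord0 i)]; rewrite /ball /= mxE subr0 => /ltW; exact.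
Qed.

Lemma compact_cube (K : set 'rV[R]_n) : compact K -> exists r, K `<=` cube r.
Proof.
move=> /compact_bounded [M [_ hM]]; exists (M + 2) => x Kx i.
rewrite -ltr_norml (le_lt_trans (coord_le_norm x i)) //.
by rewrite (le_lt_trans (hM (M + 1) _ x Kx)) ?ltrDl // ltrD2l ltr1n.
Qed.

Lemma continuous_bounded_in_cube phi : continuous phi ->
  compact (closure [set x | phi x != 0]) -> exists r, bounded_in_cube r phi.
Proof.
move=> cphi cK; set K := closure _ in cK.
have [r Kr] := compact_cube cK; exists r; split.
- by apply: continuous_measurable_rV; [exact: openT|move=> x _; exact: cphi].
- have : compact (phi @` K).
    by apply: continuous_compact => //; apply: continuous_subspaceT.
  move=> /compact_bounded [M [_ hM]]; exists (`|M| + 1) => x.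
  have [->|p0] := eqVneq (phi x) 0; first by rewrite normr0 addr_ge0.
  apply: (hM (`|M| + 1)); first by rewrite (le_lt_trans (ler_norm M)) // ltrDl.
  by exists x => //; exact: subset_closure.
- by move=> x p0; apply: Kr; exact: subset_closure.
Qed.

Lemma test_function_continuous phi : test_function phi -> continuous phi.
Proof. by move=> [/(_ 0)[c _] _] x; apply: c; rewrite inE. Qed.

Lemma partial_continuous phi i : test_function phi -> continuous (partial phi i).
Proof. by move=> [/(_ 1)[_ /(_ i)[_ [c _]]] _] x; apply: c; rewrite inE. Qed.

Lemma partial_derivable phi i x : test_function phi -> derivable phi x (delta_mx ord0 i).
Proof. by move=> [/(_ 1)[_ /(_ i)[d _]] _]; exact: d. Qed.

Lemma test_function_bounded phi : test_function phi -> exists r, bounded_in_cube r phi.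
Proof.
by move=> tphi; apply: continuous_bounded_in_cube; [exact: test_function_continuous|case: tphi].
Qed.

Lemma partial_bounded phi i : test_function phi -> exists r, bounded_in_cube r (partial phi i).
Proof.
move=> tphi; apply: continuous_bounded_in_cube; first exact: partial_continuous.
have [_ cK] := tphi; apply: (subclosed_compact (@closed_closure _ _) cK).
rewrite [X in _ `<=` X](closure_id _).1; last exact: closed_closure.
apply: closure_subset => x; apply: contraPP => xK /=; apply/negP; rewrite negbK.
have : open (~` closure [set x | phi x != 0]) by apply: closed_openC; exact: closed_closure.
move=> oK; have nx : nbhs x (~` closure [set x | phi x != 0]).
  exact: open_nbhs_nbhs (conj oK xK).
apply/eqP; rewrite /partial -[RHS](@derive_cst _ _ _ (0 : R) x (delta_mx ord0 i)).
apply: near_eq_derive; apply: filterS nx => y /= yK.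
by apply/eqP; apply: contrapT => /negP h; apply: yK; exact: subset_closure.
Qed.

Lemma is_derive_line phi i x (t : R) : test_function phi ->
  is_derive t 1 (fun t => phi (line i x t)) (partial phi i (line i x t)).
Proof.
move=> tphi; have d := @partial_derivable phi i (line i x t) tphi.
have E (h : R) : line i x (h *: 1 + t) = h *: delta_mx ord0 i + line i x t.
  by rewrite /line [h *: 1]mulr1 scalerDl addrCA.
have E2 : (fun h : R => h^-1 *: (phi (line i x (h *: 1 + t)) - phi (line i x t))) =
   (fun h : R => h^-1 *: (phi (h *: delta_mx ord0 i + line i x t) - phi (line i x t))).
  by apply/funext => h; rewrite E.
apply: DeriveDef; first by rewrite /derivable /= E2.
by rewrite /derive /= E2.
Qed.

Lemma continuous_line i x : continuous (line i x).
Proof.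
move=> t; apply: cvgD; first exact: cvg_cst.
by apply: cvgZr_tmp; exact: cvg_id.
Qed.

Lemma continuous_partial_line phi i x : test_function phi ->
  continuous (fun t : R => partial phi i (line i x (- t))).
Proof.
move=> tphi t.
apply: (@continuous_comp _ _ _ (fun t : R => line i x (- t)) (partial phi i)).
  apply: (@continuous_comp _ _ _ (fun t : R => - t) (line i x)).
    exact: oppr_continuous.
  exact: continuous_line.
exact: partial_continuous.
Qed.

Lemma integrable_unit_step (h : R) : lambda.-integrable setT (EFin \o unit_step h).
Proof. exact: integrable_indic_itv. Qed.

Lemma test_function_FTC phi i x (h : R) : test_function phi -> 0 < h ->
  (\int[lambda]_t (unit_step h t * partial phi i (line i x (- t)))%:E =
   (phi x - phi (line i x (- h)))%:E)%E.
Proof.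
move=> tphi h0.
have D (t : R) : is_derive t 1 (fun t => - phi (line i x (- t))) (partial phi i (line i x (- t))).
  have d1 := is_derive_line i x (- t) tphi.
  have d2 : is_derive t 1 (fun t : R => - t) (- 1) by apply: is_deriveNid.
  have d3 := is_derive1_comp (f := fun t => phi (line i x t)) (g := fun t => - t) d1 d2.
  have := is_deriveN d3; rewrite mulrN1 opprK.
  by have -> : - ((fun t => phi (line i x t)) \o -%R) = (fun t => - phi (line i x (- t))) by [].
have cF : continuous (fun t => - phi (line i x (- t))) by exact: is_derive_continuous D.
have := @continuous_FTC2 R (fun t => partial phi i (line i x (- t)))
   (fun t => - phi (line i x (- t))) 0 h h0.
rewrite -EFinB oppr0 line0 opprK addrC => <-.
- rewrite [RHS]integral_mkcond; apply: eq_integral => t _.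
  by rewrite patchE /unit_step indicE; case: ifP => _; rewrite ?mul1r ?mul0r.
- by apply: continuous_subspaceT; exact: continuous_partial_line.
- split; first by move=> t _; case: (D t).
    by apply: cvg_at_right_filter; exact: cF.
  by apply: cvg_at_left_filter; exact: cF.
- by move=> t _; rewrite derive1E; case: (D t).
Qed.

(** Translation moves the increment of [u] to the test function, where the
    fundamental theorem of calculus writes it as a line integral of a partial
    derivative. *)
Lemma increment_pairing u phi i h : cube_integrable u -> test_function phi -> 0 < h ->
  (\int[mu]_x ((u (line i x h) - u x) * phi x)%:E =
   - \int[lambda]_t ((unit_step h t)%:E * pairing i u (partial phi i) t))%E.
Proof.
move=> lu tphi h0; have [r bphi] := test_function_bounded tphi.
have [r' bd] := partial_bounded i tphi.
rewrite -(dual_kernel_fubini i h lu bd).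
have -> : (\int[mu]_x \int[lambda]_t (dual_kernel i h u (partial phi i) (t, x))%:E =
   \int[mu]_x (u x * phi x - u x * phi (line i x (- h)))%:E)%E.
  apply: eq_integral => x _; rewrite -mulrBr EFinM -test_function_FTC // -integralZl //.
    by apply: eq_integral => t _; rewrite /dual_kernel /= -EFinM mulrCA.
  have [mb [C hC] _] := bd.
  have := integrableZr measurableT C (integrable_unit_step h).
  apply: le_integrable => //.
    apply/measurable_EFinP; apply: measurable_funM; first exact: measurable_unit_step.
    have cp : continuous (fun t : R => partial phi i (line i x (- t))).
      exact: continuous_partial_line.
    exact: continuous_measurable_fun.
  move=> t _ /=; rewrite lee_fin !normrM ler_wpM2l // (le_trans (hC _)) // ler_norm //.
have i1 := integrable_mul_bounded lu bphi.
have i2 := integrable_pairing i h lu bphi.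
rewrite integralB_EFin // fin_num_oppeB; last exact: integrable_fin_num.
have i3 := integrable_translate (h *: delta_mx ord0 i) i2.
rewrite -(integral_translate (h *: delta_mx ord0 i) i2) addeC -integralB_EFin //.
apply: eq_integral => x _; rewrite -/(line i x h) lineK mulrBl //.
Qed.

Definition weak_partial i u g := forall phi, test_function phi ->
  (\int[mu]_x (u x * partial phi i x)%:E = - \int[mu]_x (g x * phi x)%:E)%E.

Lemma partial_line phi i t x :
  partial (fun y => phi (line i y t)) i x = partial phi i (line i x t).
Proof.
rewrite /partial /derive /=.
have -> // : (fun h : R => h^-1 *: (phi (line i (h *: delta_mx ord0 i + x) t) - phi (line i x t)))
  = (fun h : R => h^-1 *: (phi (h *: delta_mx ord0 i + line i x t) - phi (line i x t))).
by apply/funext => h; rewrite /line addrA.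
Qed.

Lemma bump_line m (a b : 'I_n -> R) i x (t : R) :
  bump m a b (line i x (- t)) =
  bump m (fun j => if j == i then a j + t else a j)
         (fun j => if j == i then b j + t else b j) x.
Proof.
apply: eq_bigr => j _; rewrite !mxE eqxx /=; case: eqP => _; last first.
  by rewrite mulr0 addr0.
by rewrite mulr1 /plateau; congr (flat _ (_ * _) * flat _ (_ * _)); ring.
Qed.

Lemma cube_integrableB u g : cube_integrable u -> cube_integrable g ->
  cube_integrable (fun x => u x - g x).
Proof.
move=> [mu1 iu] [mg ig]; split; first exact: measurable_funB.
by move=> r; have := integrableB (measurable_cube r) (iu r) (ig r).
Qed.

Lemma cube_integrable_line u i t : cube_integrable u ->
  cube_integrable (fun x => u (line i x t)).
Proof.
move=> lu; split; first exact: (measurableT_comp lu.1 (measurable_translate _)).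
move=> r; have h := integrable_translate (t *: delta_mx ord0 i)
  (integrable_restrict_cube (r + `|t|) lu).
have := integrableS measurableT (measurable_cube r) (@subsetT _ _) h.
apply: eq_integrable; first exact: measurable_cube.
move=> x /set_mem xr /=; rewrite patchE mem_set //.
exact: cube_line xr _.
Qed.

Lemma weak_partial_unique i u g g' : cube_integrable g -> cube_integrable g' ->
  weak_partial i u g -> weak_partial i u g' -> {ae mu, forall x, g x = g' x}.
Proof.
move=> lg lg' wg wg'.
have := fundamental_lemma (cube_integrableB lg lg').
have h m a b : (\int[mu]_x ((g x - g' x) * bump m a b x)%:E = 0)%E.
  have tb := test_function_bump m a b; have [r bb] := test_function_bounded tb.
  have i1 := integrable_mul_bounded lg bb; have i2 := integrable_mul_bounded lg' bb.
  under eq_integral do rewrite mulrBl.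
  rewrite integralB_EFin //; have := wg _ tb; rewrite (wg' _ tb) => /oppe_inj ->.
  by rewrite subee //; exact: integrable_fin_num.
move=> /(_ h); apply: filterS => x /eqP; rewrite subr_eq0 => /eqP.
exact.
Qed.

(** Absolute continuity along lines. Tested against a bump, both sides are integrals
    over [[0, h]] of pairings with translates of that bump; translated bumps are
    again test functions, so the definition of the weak derivative identifies these
    pairings for each time. *)
Lemma weak_partial_increment i u g h : cube_integrable u -> cube_integrable g ->
  weak_partial i u g -> 0 < h ->
  {ae mu, forall x, u (line i x h) - u x = line_int i h g x}.
Proof.
move=> lu lg wg h0.
have lD := cube_integrableB (cube_integrable_line i h lu) lu.
have lA := cube_integrable_line_int i h lg.
have := fundamental_lemma (cube_integrableB lD lA).
have H m a b : (\int[mu]_x ((u (line i x h) - u x - line_int i h g x) * bump m a b x)%:E = 0)%E.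
  have tb := test_function_bump m a b; have [r bb] := test_function_bounded tb.
  have i1 := integrable_mul_bounded lD bb; have i2 := integrable_mul_bounded lA bb.
  under eq_integral do rewrite mulrBl.
  rewrite integralB_EFin // increment_pairing // (line_int_pairing _ _ lg bb).
  have P t : pairing i u (partial (bump m a b) i) t = (- pairing i g (bump m a b) t)%E.
    rewrite /pairing.
    under eq_integral do rewrite -partial_line.
    rewrite wg //.
    rewrite (_ : (fun _ => _) = bump m (fun j => if j == i then a j + t else a j)
         (fun j => if j == i then b j + t else b j)); first exact: test_function_bump.
    by apply/funext => x; exact: bump_line.
  under [X in (- X - _)%E]eq_integral do rewrite P muleN.
  have it := integrable_pairing_time i h lg bb.
  rewrite integralN ?oppeK ?subee //; first exact: integrable_fin_num.
  exact: integrable_add_def.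
move=> /(_ H); apply: filterS => x /eqP; rewrite subr_eq0 => /eqP.
exact.
Qed.

Lemma pairing_cvg i g psi r (t : nat -> R) : cube_integrable g -> bounded_in_cube r psi ->
  continuous psi -> (forall k, `|t k| <= 1) -> t @ \oo --> 0 ->
  pairing i g psi (t k) @[k --> \oo] --> pairing i g psi 0.
Proof.
move=> lg bpsi cpsi t1 t0; have [mpsi [C hC] sup] := bpsi.
have C0 : 0 <= C by rewrite (le_trans _ (hC 0)).
have := @dominated_convergence _ _ _ mu setT measurableT
  (fun k x => (g x * psi (line i x (- t k)))%:E)
  (fun x => (g x * psi (line i x (- 0)))%:E)
  (fun x => `| ((g \_ (cube (r + 1))) x * C)%:E |%E).
case=> //.
- by move=> k; have /integrableP[] := integrable_pairing i (t k) lg bpsi.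
- by have /integrableP[] := integrable_pairing i 0 lg bpsi.
- apply: aeW => x _; apply: cvg_EFin; first exact: nearW.
  apply: cvgMl_tmp.
  have c : {for (0 : R), continuous (fun s : R => psi (line i x (- s)))}.
    apply: (@continuous_comp _ _ _ (fun s : R => line i x (- s)) psi); last exact: cpsi.
    apply: (@continuous_comp _ _ _ (fun s : R => - s) (line i x)).
      exact: oppr_continuous.
    exact: continuous_line.
  exact: cvg_comp t0 c.
- apply: integrable_abse.
  exact: (integrableZr measurableT C (integrable_restrict_cube (r + 1) lg)).
- apply: aeW => x k _ /=; rewrite lee_fin !normrM (ger0_norm C0).
  have [->|p0] := eqVneq (psi (line i x (- t k))) 0.
    by rewrite normr0 mulr0 mulr_ge0.
  rewrite patchE mem_set ?ler_wpM2l //.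
  rewrite -[x](lineK i x (- t k)) opprK.
  apply: cube_line => //; exact: sup.
Qed.

(** The converse of the previous characterization. Let [C t] be the sum of the
    pairings of [u] with the derivative of [phi] and of [g] with [phi], after a
    translation by [t]. The hypothesis says that [C] has integral zero on every
    [[0, h]]; as [C] is continuous at [0], it vanishes there, and [C 0 = 0] is the
    definition of the weak derivative. *)
Lemma weak_partial_of_increments i u g : cube_integrable u -> cube_integrable g ->
  (forall h, 0 < h -> {ae mu, forall x, u (line i x h) - u x = line_int i h g x}) ->
  weak_partial i u g.
Proof.
move=> lu lg inc phi tphi.
have [r bphi] := test_function_bounded tphi.
have [r' bd] := partial_bounded i tphi.
pose A t := fine (pairing i u (partial phi i) t).
pose B t := fine (pairing i g phi t).
have fA t : pairing i u (partial phi i) t = (A t)%:E.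
  by rewrite fineK //; apply: integrable_fin_num => //; exact: integrable_pairing bd.
have fB t : pairing i g phi t = (B t)%:E.
  by rewrite fineK //; apply: integrable_fin_num => //; exact: integrable_pairing bphi.
have I0 h : 0 < h -> (\int[lambda]_t (unit_step h t * (A t + B t))%:E = 0)%E.
  move=> h0.
  have iA := integrable_pairing_time i h lu bd.
  have iB := integrable_pairing_time i h lg bphi.
  have := increment_pairing i lu tphi h0.
  have -> : (\int[mu]_x ((u (line i x h) - u x) * phi x)%:E =
    \int[mu]_x (line_int i h g x * phi x)%:E)%E.
    have lD := cube_integrableB (cube_integrable_line i h lu) lu.
    have lA := cube_integrable_line_int i h lg.
    apply: ae_eq_integral => //.
    - by have /integrableP[] := integrable_mul_bounded lD bphi.
    - by have /integrableP[] := integrable_mul_bounded lA bphi.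
    - by apply: filterS (inc h h0) => x /= -> _.
  rewrite (line_int_pairing _ _ lg bphi) => e.
  under eq_integral do rewrite mulrDr EFinD.
  rewrite integralD //; first last.
  - by apply: eq_integrable iB => // t _; rewrite fB EFinM.
  - by apply: eq_integrable iA => // t _; rewrite fA EFinM.
  under eq_integral do rewrite EFinM -fA.
  under [X in (_ + X)%E]eq_integral do rewrite EFinM -fB.
  by rewrite e subee //; exact: integrable_fin_num.
suff AB0 : A 0 + B 0 = 0.
  have a0 := fA 0; have b0 := fB 0.
  move: a0 b0; rewrite /pairing; under eq_integral do rewrite oppr0 line0.
  move=> ->; under eq_integral do rewrite oppr0 line0.
  by move=> ->; rewrite -EFinN; congr EFin; apply/eqP; rewrite -addr_eq0; apply/eqP.
apply/eqP; apply: contrapT => /negP c0.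
set C := fun t => A t + B t; set c := A 0 + B 0 in c0.
have Ccvg (t : nat -> R) : (forall k, `|t k| <= 1) -> t @ \oo --> 0 -> C (t k) @[k --> \oo] --> c.
  move=> t1 t0; apply: cvgD.
    have := @pairing_cvg i _ _ _ _ lu bd (@partial_continuous phi i tphi) t1 t0.
    by rewrite fA; move/fine_cvg.
  have := @pairing_cvg i _ _ _ _ lg bphi (test_function_continuous tphi) t1 t0.
  by rewrite fB; move/fine_cvg.
have c2 : 0 < `|c| / 2 by rewrite divr_gt0 // normr_gt0.
(* on [[0, d]], [C] stays within half of [`|c|] from [c], so [C * c >= c ^+ 2 / 2] *)
have [d /andP[d0 d1] hd] : exists2 d : R, 0 < d <= 1 &
    forall t, 0 <= t <= d -> `|C t - c| <= `|c| / 2.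
  apply: contrapT => /forall2NP H.
  have /choice[t ht] : forall k : nat, exists t : R,
      0 <= t <= k.+1%:R^-1 /\ `|c| / 2 < `|C t - c|.
    move=> k; have [/negP|/existsNP[t /not_implyP[h1 h2]]] := H k.+1%:R^-1.
      by rewrite invr_gt0 ltr0n /= invf_le1 // ler1n.
    by exists t; split => //; rewrite ltNge; apply/negP.
  have t1 k : `|t k| <= 1.
    have [/andP[h1 h2] _] := ht k.
    by rewrite ger0_norm // (le_trans h2) // invf_le1 // ler1n.
  have t0 : t @ \oo --> (0 : R).
    apply: (@squeeze_cvgr _ _ _ _ (cst 0) (fun k => k.+1%:R^-1)).
    - by apply: nearW => k; have [] := ht k.
    - exact: cvg_cst.
    - exact: cvg_harmonic.
  have /cvgrPdist_le/(_ _ c2)[k _ /(_ k (leqnn k))] := Ccvg t t1 t0.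
  rewrite /= distrC; apply/negP; rewrite -ltNge; by have [] := ht k.
have iC : lambda.-integrable setT (fun t => (unit_step d t * C t)%:E).
  have iA := integrable_pairing_time i d lu bd.
  have iB := integrable_pairing_time i d lg bphi.
  have := integrableD measurableT iA iB; apply: eq_integrable => // t _.
  by rewrite fA fB -!EFinM -EFinD /C mulrDr.
have : (\int[lambda]_t (unit_step d t * (c ^+ 2 / 2))%:E <=
        \int[lambda]_t (unit_step d t * C t * c)%:E)%E.
  apply: le_integral => //.
  - exact: (integrableZr measurableT (c ^+ 2 / 2) (integrable_unit_step d)).
  - exact: (integrableZr measurableT c iC).
  - move=> t _; rewrite lee_fin -mulrA /unit_step indicE.
    case: (boolP (t \in _)) => td; last by rewrite !mul0r.
    rewrite !mul1r; move: td; rewrite inE /= in_itv /= => /hd.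
    move=> h; have : `|(C t - c) * c| <= `|c| / 2 * `|c| by rewrite normrM ler_wpM2r.
    rewrite ler_norml mulrAC -expr2 real_normK ?num_real // => /andP[+ _].
    by rewrite expr2; lra.
have -> : (\int[lambda]_t (unit_step d t * C t * c)%:E = 0)%E.
  under eq_integral do rewrite EFinM.
  by rewrite integralZr // I0 // mul0e.
under eq_integral do rewrite EFinM.
rewrite integralZr //; last exact: integrable_unit_step.
have -> : (\int[lambda]_t (unit_step d t)%:E = d%:E)%E.
  rewrite /unit_step integral_indic // setIT.
  have := @lebesgue_measure_itv R `[0, d]; rewrite /= lte_fin d0 => ->.
  by rewrite oppr0 adde0.
rewrite -EFinM lee_fin leNgt => /negP; apply.
by rewrite mulr_gt0 // divr_gt0 // exprn_even_gt0.
Qed.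

End test_function_calculus.

(** * Riemann-Stieltjes sums *)

Section chain_on_a_line.
Context {R : realType}.
Local Notation lambda := (@lebesgue_measure R).
Variable h : R.
Hypothesis h0 : 0 < h.

Definition grid (m k : nat) : R := k%:R * h / m.+1%:R.

Lemma grid0 m : grid m 0 = 0.
Proof. by rewrite /grid mul0r mul0r. Qed.

Lemma grid_last m : grid m m.+1 = h.
Proof. by rewrite /grid mulrAC mulfV ?mul1r. Qed.

Lemma ler_grid m k l : (k <= l)%N -> grid m k <= grid m l.
Proof. by move=> kl; rewrite ler_wpM2r ?invr_ge0 // ler_wpM2r ?ler_nat // ltW. Qed.

Lemma grid_ge0 m k : 0 <= grid m k.
Proof. by rewrite -(grid0 m) ler_grid. Qed.

Lemma grid_step m k : grid m k.+1 - grid m k = h / m.+1%:R.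
Proof. by rewrite /grid -mulrBl -mulrBl -natr1 addrAC subrr add0r mul1r. Qed.

Lemma unit_stepE (c t : R) : 0 <= t -> unit_step c t = (t <= c)%R%:R.
Proof. by move=> t0; rewrite /unit_step indicE mem_setE in_itv /= t0. Qed.

Lemma grid_locate m (t : R) : 0 < t <= h ->
  exists k, [/\ (k < m.+1)%N, grid m k < t & t <= grid m k.+1].
Proof.
move=> /andP[t0 th].
have ex : exists k, t <= grid m k.+1 by exists m; rewrite grid_last.
exists (ex_minn ex); case: ex_minnP => k tk kmin; split => //.
  by rewrite ltnS; apply: kmin; rewrite grid_last.
case: k tk kmin => [|k] tk kmin; first by rewrite grid0.
rewrite ltNge; apply/negP => /kmin; by rewrite ltnn.
Qed.

Definition step_function (A : nat -> nat -> R) m (t : R) : R :=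
  \sum_(k < m.+1) (unit_step (grid m k.+1) t - unit_step (grid m k) t) * A m k.

Lemma step_functionE A m k (t : R) : (k < m.+1)%N -> grid m k < t -> t <= grid m k.+1 ->
  step_function A m t = A m k.
Proof.
move=> km kt tk; have t0 : 0 <= t by rewrite (le_trans (grid_ge0 m k)) // ltW.
rewrite /step_function (bigD1 (Ordinal km)) //= !unit_stepE // tk leNgt kt subr0 mul1r.
rewrite big1 ?addr0 // => j jk; rewrite !unit_stepE //.
have [jk'|kj|jk'] := ltngtP j k.
- have lt1 : grid m j.+1 < t by rewrite (le_lt_trans _ kt) // ler_grid.
  have lt0 : grid m j < t by rewrite (le_lt_trans _ kt) // ler_grid // ltnW.
  by rewrite !leNgt lt1 lt0 subrr mul0r.
- have le0 : t <= grid m j by rewrite (le_trans tk) // ler_grid.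
  have le1 : t <= grid m j.+1 by rewrite (le_trans tk) // ler_grid // ltnW.
  by rewrite le0 le1 subrr mul0r.
- by move: jk; rewrite -val_eqE /= jk' eqxx.
Qed.

Lemma measurable_step_function A m : measurable_fun setT (step_function A m).
Proof.
apply: measurable_sum => k; apply: measurable_funM => //.
by apply: measurable_funB; exact: measurable_unit_step.
Qed.

(** Convergence of Riemann-Stieltjes sums with respect to [G(t) dt]. The bounded
    array [A] holds one value for each interval of the grid, and [kappa m] is the
    index of the interval of the m-th grid that contains [t]: if the values found
    there tend to [a t], dominated convergence applies to the step functions. *)
Lemma step_function_cvg (A : nat -> nat -> R) (a G : R -> R) (C : R) :
  measurable_fun setT G ->
  lambda.-integrable setT (fun t => (unit_step h t * G t)%:E) ->
  measurable_fun setT a ->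
  (forall m k, (k < m.+1)%N -> `|A m k| <= C) ->
  {ae lambda, forall t, 0 < t <= h -> forall kappa : nat -> nat,
     (forall m, [/\ (kappa m < m.+1)%N, grid m (kappa m) < t & t <= grid m (kappa m).+1]) ->
     A m (kappa m) @[m --> \oo] --> a t} ->
  (fun m => \sum_(k < m.+1) A m k *
     fine (\int[lambda]_t ((unit_step (grid m k.+1) t - unit_step (grid m k) t) * G t)%:E))
    @ \oo --> fine (\int[lambda]_t (unit_step h t * (a t * G t))%:E) /\
  lambda.-integrable setT (fun t => (unit_step h t * (a t * G t))%:E).
Proof.
move=> mG iG ma AC cvA.
have C0 : 0 <= C by rewrite (le_trans _ (AC 0 0 (ltnSn 0))).
have iu (m k : nat) : (k <= m.+1)%N -> lambda.-integrable setT
   (fun t => (unit_step (grid m k) t * G t)%:E).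
  move=> km; have := iG; apply: le_integrable => //.
    by apply/measurable_EFinP; apply: measurable_funM => //; exact: measurable_unit_step.
  move=> t _; rewrite lee_fin !normrM ler_wpM2r // /unit_step !indicE.
  case: (boolP (t \in _)) => ht; last by rewrite normr0.
  rewrite mem_set //; move: ht; rewrite inE /= !in_itv /= => /andP[-> h2] /=.
  by rewrite (le_trans h2) // -(grid_last m) ler_grid.
have id (m : nat) (k : 'I_m.+1) : lambda.-integrable setT
    (fun t => ((unit_step (grid m k.+1) t - unit_step (grid m k) t) * G t)%:E).
  have := integrableB measurableT (iu m k.+1 (ltn_ord k)) (iu m k (ltnW (ltn_ord k))).
  by apply: eq_integrable => // t _; rewrite -EFinB mulrBl.
have fin m : \sum_(k < m.+1) A m k *
     fine (\int[lambda]_t ((unit_step (grid m k.+1) t - unit_step (grid m k) t) * G t)%:E)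
   = fine (\int[lambda]_t (step_function A m t * G t)%:E).
  have -> : (\int[lambda]_t (step_function A m t * G t)%:E =
     \sum_(k < m.+1) \int[lambda]_t ((A m k)%:E *
       ((unit_step (grid m k.+1) t - unit_step (grid m k) t) * G t)%:E))%E.
    rewrite -integral_sum //; last first.
      by move=> k; exact: (integrableZl measurableT (A m k) (id m k)).
    apply: eq_integral => t _; rewrite /step_function mulr_suml -sumEFin.
    by apply: eq_bigr => k _; rewrite -EFinM; congr EFin; ring.
  rewrite -sum_fine.
    by apply: eq_bigr => k _; rewrite integralZl // fineM // integrable_fin_num.
  by move=> k _; apply: integrable_fin_num => //; exact: (integrableZl measurableT (A m k) (id m k)).
have neq0 : {ae lambda, forall t : R, t != 0}.
  exists [set 0]; split => //; first exact: lebesgue_measure_set1.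
  by move=> t /= /negP; rewrite negbK => /eqP.
have := @dominated_convergence _ _ _ lambda setT measurableT
  (fun m t => (step_function A m t * G t)%:E)
  (fun t => (unit_step h t * (a t * G t))%:E)
  (fun t => `| (C * (unit_step h t * G t))%:E |%E).
have out m t : ~ (0 < t <= h) -> t != 0 -> step_function A m t = 0.
  move=> tn t0; apply: big1 => k _; rewrite /unit_step !indicE !memNset ?subrr ?mul0r //=.
    rewrite in_itv /= => /andP[h1 h2]; apply: tn; rewrite lt_neqAle eq_sym t0 h1 /=.
    by rewrite (le_trans h2) // -(grid_last m) ler_grid // ltnW.
  rewrite in_itv /= => /andP[h1 h2]; apply: tn; rewrite lt_neqAle eq_sym t0 h1 /=.
  by rewrite (le_trans h2) // -(grid_last m) ler_grid.
case.
- move=> m; apply/measurable_EFinP; apply: measurable_funM => //.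
  exact: measurable_step_function.
- apply/measurable_EFinP; apply: measurable_funM; first exact: measurable_unit_step.
  exact: measurable_funM.
- apply: (@filterS2 _ _ (ae_filter_ringOfSetsType lambda) _ _ _ _ cvA neq0) => t ct t0 _.
  apply: cvg_EFin; first exact: nearW.
  rewrite /comp /=.
  have [th|tn] := pselect (0 < t <= h).
    have /choice[kappa hk] : forall m, exists k, [/\ (k < m.+1)%N, grid m k < t & t <= grid m k.+1].
      by move=> m; exact: grid_locate.
    have -> : (fun m => step_function A m t * G t) = (fun m => A m (kappa m) * G t).
      by apply/funext => m; have [h1 h2 h3] := hk m; rewrite (step_functionE _ h1 h2 h3).
    case/andP: (th) => t1 t2; have us : unit_step h t = 1 by rewrite unit_stepE ?(ltW t1) // t2.
    rewrite us mul1r.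
    by apply: cvgMr_tmp; exact: ct.
  rewrite (_ : unit_step h t = 0); last first.
    rewrite /unit_step indicE memNset //= in_itv /= => /andP[h1 h2].
    by apply: tn; rewrite lt_neqAle eq_sym t0 h1.
  rewrite mul0r; rewrite (_ : (fun m => _) = cst 0); first exact: cvg_cst.
  by apply/funext => m; rewrite out // mul0r.
- by apply: integrable_abse; exact: (integrableZl measurableT C iG).
- apply: (@filterS _ _ (ae_filter_ringOfSetsType lambda) _ _ _ neq0) => t t0 m _.
  rewrite /= lee_fin !normrM (ger0_norm C0).
  have [th|tn] := pselect (0 < t <= h); last first.
    by rewrite out // normr0 mul0r !mulr_ge0.
  have [k [h1 h2 h3]] := grid_locate m th.
  rewrite (step_functionE _ h1 h2 h3); case/andP: (th) => t1 t2.
  have us : unit_step h t = 1 by rewrite unit_stepE ?(ltW t1) // t2.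
  by rewrite us normr1 mul1r ler_wpM2r // AC.
move=> ia _ cv; split => //.
rewrite (_ : (fun m => _) = (fun m => fine (\int[lambda]_t (step_function A m t * G t)%:E))).
  by apply: fine_cvg; rewrite fineK //; exact: integrable_fin_num.
by apply/funext => m.
Qed.

End chain_on_a_line.

(** * Product and chain rule for weak derivatives *)

Section chain_rule.
Context {R : realType} {n : nat}.
Local Notation mu := (@leb R n).
Local Notation lambda := (@lebesgue_measure R).
Implicit Types (g u v w : 'rV[R]_n -> R) (x : 'rV[R]_n) (i : 'I_n).

Lemma integrable_unit_stepS (c h : R) (G : R -> R) : c <= h -> measurable_fun setT G ->
  lambda.-integrable setT (fun t => (unit_step h t * G t)%:E) ->
  lambda.-integrable setT (fun t => (unit_step c t * G t)%:E).
Proof.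
move=> ch mG; apply: le_integrable => //.
  by apply/measurable_EFinP; apply: measurable_funM => //; exact: measurable_unit_step.
move=> t _; rewrite lee_fin !normrM ler_wpM2r // /unit_step !indicE.
case: (boolP (t \in _)) => ht; last by rewrite normr0.
rewrite mem_set //; move: ht; rewrite inE /= !in_itv /= => /andP[-> h2] /=.
by rewrite (le_trans h2).
Qed.

Lemma measurable_along i g x : measurable_fun setT g ->
  measurable_fun setT (fun t : measurableTypeR R => g (line i x t)).
Proof.
move=> mg; have := measurableT_comp mg (measurable_line i).
by move=> h; exact: (measurableT_comp h (measurable_pair2 x)).
Qed.

Lemma line_int0 i g x : measurable_fun setT g -> line_int i 0 g x = 0.
Proof.
move=> mg; rewrite /line_int (ae_eq_integral (cst 0%E)) ?integral0 //.
  apply/measurable_EFinP; apply: measurable_funM; first exact: measurable_unit_step.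
  exact: measurable_along.
have neq0 : {ae lambda, forall t : R, t != 0}.
  exists [set 0]; split => //; first exact: lebesgue_measure_set1.
  by move=> t /= /negP; rewrite negbK => /eqP.
apply: (@filterS _ _ (ae_filter_ringOfSetsType lambda) _ _ _ neq0) => t t0 _.
rewrite /unit_step indicE memNset ?mul0r //= in_itv /= => /andP[h1 h2].
by move: t0; rewrite eq_le h1 h2.
Qed.

Lemma line_int_cvg i g x (h t : R) (s : nat -> R) : measurable_fun setT g ->
  lambda.-integrable setT (fun t => (unit_step h t * g (line i x t))%:E) ->
  (forall m, s m <= h) -> s @ \oo --> t ->
  line_int i (s m) g x @[m --> \oo] --> line_int i t g x.
Proof.
move=> mg ih sh st.
have neqt : {ae lambda, forall r : R, r != t}.
  exists [set t]; split => //; first exact: lebesgue_measure_set1.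
  by move=> r /= /negP; rewrite negbK => /eqP.
have := @dominated_convergence _ _ _ lambda setT measurableT
  (fun m r => (unit_step (s m) r * g (line i x r))%:E)
  (fun r => (unit_step t r * g (line i x r))%:E)
  (fun r => `| (unit_step h r * g (line i x r))%:E |%E).
have mgl := measurable_along i x mg.
case.
- by move=> m; apply/measurable_EFinP; apply: measurable_funM => //; exact: measurable_unit_step.
- by apply/measurable_EFinP; apply: measurable_funM => //; exact: measurable_unit_step.
- apply: (@filterS _ _ (ae_filter_ringOfSetsType lambda) _ _ _ neqt) => r rt _.
  apply: cvg_EFin; first exact: nearW.
  rewrite /comp /=; apply: cvgMr_tmp.
  have [r0|r0] := leP 0 r; last first.
    have z c : unit_step c r = 0.
      by rewrite /unit_step indicE memNset //= in_itv /= leNgt r0.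
    by rewrite z (_ : (fun _ => _) = cst 0); [exact: cvg_cst|apply/funext => m].
  rewrite (unit_stepE _ r0).
  have e (b : bool) : (\forall m \near \oo, (r <= s m) = b) ->
      unit_step (s m) r @[m --> \oo] --> (b%:R : R).
    move=> eb; apply: cvg_near_cst; apply: filterS eb => m <-.
    by rewrite unit_stepE.
  move: rt; rewrite neq_lt => /orP[rt|tr].
    rewrite (ltW rt); apply: e.
    by apply: filterS (cvgr_gt t st r rt) => m /ltW ->.
  rewrite leNgt tr; apply: e.
  by apply: filterS (cvgr_lt t st r tr) => m ?; apply/negbTE; rewrite -ltNge.
- exact: integrable_abse.
- apply: aeW => r m _ /=; rewrite lee_fin !normrM ler_wpM2r // /unit_step !indicE.
  case: (boolP (r \in _)) => hr; last by rewrite normr0.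
  rewrite mem_set //; move: hr; rewrite inE /= !in_itv /= => /andP[-> h2] /=.
  exact: le_trans h2 (sh m).
move=> it _ cv; apply: fine_cvg; rewrite fineK //; exact: integrable_fin_num.
Qed.

Lemma measurable_line_int_joint i g : measurable_fun setT g ->
  measurable_fun setT (fun z : measurableTypeR R * 'rV[R]_n => line_int i z.1 g z.2).
Proof.
move=> mg; apply: measurableT_comp; first exact: fine_measurable.
pose k (z : (measurableTypeR R * 'rV[R]_n) * measurableTypeR R) : \bar R :=
  (unit_step z.1.1 z.2 * g (line i z.1.2 z.2))%:E.
have m11 : measurable_fun setT (fun z : (measurableTypeR R * 'rV[R]_n) * measurableTypeR R => z.1.1).
  exact: (measurableT_comp measurable_fst measurable_fst).
have m12 : measurable_fun setT (fun z : (measurableTypeR R * 'rV[R]_n) * measurableTypeR R => z.1.2).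
  exact: (measurableT_comp measurable_snd measurable_fst).
have mk : measurable_fun setT k.
  apply/measurable_EFinP; apply: measurable_funM.
    rewrite (_ : (fun z => _) = (fun z : (measurableTypeR R * 'rV[R]_n) * measurableTypeR R =>
        ((0 <= z.2)%R && (z.2 <= z.1.1)%R)%:R)); last first.
      by apply/funext => z; rewrite /unit_step indicE mem_setE in_itv.
    rewrite (_ : (fun z => _) = (fun z : (measurableTypeR R * 'rV[R]_n) * measurableTypeR R =>
        if (0 <= z.2)%R && (z.2 <= z.1.1)%R then 1 else 0)); last first.
      by apply/funext => z; case: (_ && _).
    apply: measurable_fun_ifT => //.
    apply: measurable_and.
      by apply: measurable_fun_ler => //; exact: measurable_snd.
    by apply: measurable_fun_ler => //; exact: measurable_snd.
  apply: (measurableT_comp mg).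
  apply: (measurableT_comp (measurable_line i)
     (g := fun z : (measurableTypeR R * 'rV[R]_n) * measurableTypeR R => (z.2, z.1.2))).
  by apply/measurable_fun_pairP; split => //; exact: measurable_snd.
have -> : (fun z : measurableTypeR R * 'rV[R]_n =>
     \int[lambda]_t (unit_step z.1 t * g (line i z.2 t))%:E)%E =
    (fun z => (\int[lambda]_t (k^\+ (z, t))) - (\int[lambda]_t (k^\- (z, t))))%E.
  apply/funext => z; rewrite integralE; congr (_ - _)%E; apply: eq_integral => t _.
    by rewrite !funeposE.
  by rewrite !funenegE.
apply: emeasurable_funB.
  apply: (measurable_fun_fubini_tonelli_F (m2 := lambda) k^\+%E) => //.
  exact: measurable_funepos.
apply: (measurable_fun_fubini_tonelli_F (m2 := lambda) k^\-%E) => //.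
exact: measurable_funeneg.
Qed.

(** For each [t] the increment formula fails on a null set of [x] depending on [t];
    Fubini's theorem exchanges the quantifiers, at the price of a null set of [t]. *)
Lemma ae_ae_increment i u g : measurable_fun setT u -> measurable_fun setT g ->
  (forall h, 0 < h -> {ae mu, forall x, u (line i x h) - u x = line_int i h g x}) ->
  {ae mu, forall x, {ae lambda, forall t : R, 0 < t -> u (line i x t) - u x = line_int i t g x}}.
Proof.
move=> mu1 mg inc.
pose D (z : measurableTypeR R * 'rV[R]_n) : R :=
  if (0 < z.1)%R then `|u (line i z.2 z.1) - u z.2 - line_int i z.1 g z.2| else 0.
have mD : measurable_fun setT (EFin \o D).
  apply/measurable_EFinP; apply: measurable_fun_ifT => //.
    by apply: measurable_fun_ltr => //; exact: measurable_fst.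
  apply: measurableT_comp => //; apply: measurable_funB; last exact: measurable_line_int_joint.
  apply: measurable_funB; first exact: (measurableT_comp mu1 (measurable_line i)).
  exact: (measurableT_comp mu1 measurable_snd).
have D0 z : (0 <= (EFin \o D) z)%E by rewrite /D /= lee_fin; case: ifP.
have ft := fubini_tonelli (m1 := lambda) (m2 := mu) (EFin \o D) mD D0.
have L0 : (\int[lambda]_t \int[mu]_x (EFin \o D) (t, x) = 0)%E.
  apply: integral0_eq => t _; rewrite /D /=.
  case: (boolP (0 < t)%R) => t0; last by rewrite integral0.
  rewrite (ae_eq_integral (cst 0%E)) ?integral0 //.
    have := measurableT_comp mD (measurable_pair1 t).
    by rewrite /comp /D /= t0.
  apply: filterS (inc t t0) => x hx _.
  by rewrite hx subrr normr0.
rewrite L0 in ft.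
have mF : measurable_fun setT (fun x => (\int[lambda]_t (EFin \o D) (t, x))%E).
  by apply: (measurable_fun_fubini_tonelli_G (m1 := lambda) (EFin \o D)).
have : (\int[mu]_x `|\int[lambda]_t (EFin \o D) (t, x)| = 0)%E.
  by rewrite ft; apply: eq_integral => x _; rewrite gee0_abs //; exact: integral_ge0.
move/(ae_eq_integral_abs mu measurableT mF); apply: filterS => x /(_ I) hx.
have mDx := measurableT_comp mD (measurable_pair2 x).
have : (\int[lambda]_t `|(EFin \o D) (t, x)| = 0)%E.
  by rewrite -[RHS]hx; apply: eq_integral => t _; rewrite gee0_abs.
move/(ae_eq_integral_abs lambda measurableT mDx).
apply: (@filterS _ _ (ae_filter_ringOfSetsType lambda)) => t /(_ I) /= [+] t0.
by rewrite /D /= t0 => /normr0_eq0/eqP; rewrite subr_eq0 => /eqP.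
Qed.

Lemma cube_integrable_bounded_mul (c g : 'rV[R]_n -> R) (C : R) : measurable_fun setT c ->
  (forall x, `|c x| <= C) -> cube_integrable g -> cube_integrable (fun x => c x * g x).
Proof.
move=> mc hC [mg ig]; split; first exact: measurable_funM.
move=> r; have := integrableZl (measurable_cube r) C (ig r).
apply: le_integrable; first exact: measurable_cube.
  by apply/measurable_EFinP; apply: measurable_funTS; exact: measurable_funM.
by move=> x _; rewrite /= lee_fin !normrM ler_wpM2r // (le_trans (hC x)) // ler_norm.
Qed.

Lemma cube_integrable_bounded (c : 'rV[R]_n -> R) (C : R) : measurable_fun setT c ->
  (forall x, `|c x| <= C) -> cube_integrable c.
Proof.
move=> mc hC.
have l1 : @cube_integrable R n (cst 1).
  split; first exact: measurable_cst.
  move=> r; apply/integrableP; split; first exact/measurable_EFinP/measurable_cst.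
  under eq_integral do rewrite /= normr1.
  by rewrite integral_cst ?mul1e; [exact: leb_cube_lty|exact: measurable_cube].
have := cube_integrable_bounded_mul mc hC l1.
by rewrite (_ : (fun x => _) = c) //; apply/funext => x; rewrite mulr1.
Qed.

Lemma cube_integrableD g1 g2 : cube_integrable g1 -> cube_integrable g2 ->
  cube_integrable (fun x => g1 x + g2 x).
Proof.
move=> [m1 i1] [m2 i2]; split; first exact: measurable_funD.
by move=> r; have := integrableD (measurable_cube r) (i1 r) (i2 r).
Qed.

Lemma between_cvg (a b c : nat -> R) (l : R) : a @ \oo --> l -> b @ \oo --> l ->
  (forall k, Num.min (a k) (b k) <= c k <= Num.max (a k) (b k)) -> c @ \oo --> l.
Proof.
move=> al bl hc; apply/cvgrPdist_le => e e0.
move/cvgrPdist_le : al => /(_ e e0) al; move/cvgrPdist_le : bl => /(_ e e0).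
apply: filterS2 al => k; rewrite !ler_distl => /andP[a1 a2] /andP[b1 b2].
have := hc k; rewrite ge_min le_max => /andP[/orP[h1|h1] /orP[h2|h2]];
  apply/andP; split; lra.
Qed.

(** Bounded with a bounded continuous derivative, in mean value form. The mean
    value property is asked between points of [J] only, where the functions composed
    with [F] take their values almost everywhere, so that [F] may have corners
    outside [J]. *)
Definition bounded_C1_on (J : set R) (F f : R -> R) :=
  [/\ continuous F, continuous f,
      exists C : R, forall a, `|F a| <= C /\ `|f a| <= C &
      forall a b, J a -> J b -> exists c,
        Num.min a b <= c <= Num.max a b /\ F b - F a = f c * (b - a)].

Lemma line_int_increment i g x (h s t : R) : measurable_fun setT g ->
  lambda.-integrable setT (fun t => (unit_step h t * g (line i x t))%:E) ->
  s <= h -> t <= h ->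
  fine (\int[lambda]_r ((unit_step t r - unit_step s r) * g (line i x r))%:E) =
  line_int i t g x - line_int i s g x.
Proof.
move=> mg ih sh th; have mgl := measurable_along i x mg.
have is_ := integrable_unit_stepS sh mgl ih.
have it := integrable_unit_stepS th mgl ih.
under eq_integral do rewrite mulrBl.
rewrite integralB_EFin // fineB //; exact: integrable_fin_num.
Qed.

Lemma grid_increments i u g h : measurable_fun setT g -> 0 < h ->
  (forall h, 0 < h -> {ae mu, forall x, u (line i x h) - u x = line_int i h g x}) ->
  {ae mu, forall x, forall m k, u (line i x (grid h m k)) = u x + line_int i (grid h m k) g x}.
Proof.
move=> mg h0 inc; apply/ae_foralln => m; apply/ae_foralln => -[|k].
  by apply: aeW => x; rewrite grid0 line0 line_int0 // addr0.
have gk : 0 < grid h m k.+1 by rewrite /grid divr_gt0 // mulr_gt0.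
by apply: filterS (inc _ gk) => x <-; rewrite addrC subrK.
Qed.

Lemma grid_cvg (h t : R) (kappa : nat -> nat) : 0 < h ->
  (forall m, [/\ (kappa m < m.+1)%N, grid h m (kappa m) < t & t <= grid h m (kappa m).+1]) ->
  grid h m (kappa m) @[m --> \oo] --> t /\ grid h m (kappa m).+1 @[m --> \oo] --> t.
Proof.
move=> h0 hk.
have hz : h / m.+1%:R @[m --> \oo] --> (0 : R).
  by rewrite -(mulr0 h); apply: cvgMl_tmp; exact: cvg_harmonic.
split.
  apply: (@squeeze_cvgr _ _ _ _ (fun m => t - h / m.+1%:R) (cst t)).
  - apply: nearW => m; have [_ h1 h2] := hk m; have := grid_step h m (kappa m).
    by move=> e; rewrite (ltW h1) andbT -e; lra.
  - by rewrite -[X in _ --> X]subr0; apply: cvgB => //; exact: cvg_cst.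
  - exact: cvg_cst.
apply: (@squeeze_cvgr _ _ _ _ (cst t) (fun m => t + h / m.+1%:R)).
- apply: nearW => m; have [_ h1 h2] := hk m; have := grid_step h m (kappa m).
  by move=> e; rewrite h2 /= -e; lra.
- exact: cvg_cst.
- by rewrite -[X in _ --> X]addr0; apply: cvgD => //; exact: cvg_cst.
Qed.

(** Product and chain rule for weak derivatives, by absolute continuity along lines.
    On almost every line, the increment of [P(u) * Q(v)] telescopes over a grid; the
    mean value property turns each term into increments of [u] and [v], that is into
    integrals of [g1] and [g2] over a grid interval, with coefficients that converge
    as the grid is refined. *)
Lemma weak_partial_mul_comp i u v g1 g2 (J1 J2 : set R) (P p Q q : R -> R) :
  cube_integrable u -> cube_integrable v -> cube_integrable g1 -> cube_integrable g2 ->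
  weak_partial i u g1 -> weak_partial i v g2 ->
  {ae mu, forall x, J1 (u x)} -> {ae mu, forall x, J2 (v x)} ->
  bounded_C1_on J1 P p -> bounded_C1_on J2 Q q ->
  weak_partial i (fun x => P (u x) * Q (v x))
    (fun x => p (u x) * Q (v x) * g1 x + P (u x) * q (v x) * g2 x).
Proof.
move=> lu lv lg1 lg2 wu wv uJ vJ [cP cp [C hC] slP] [cQ cq [D hD] slQ].
have C0 : 0 <= C by rewrite (le_trans _ (hC 0).1).
have D0 : 0 <= D by rewrite (le_trans _ (hD 0).1).
have mf (F : R -> R) (z : 'rV[R]_n -> R) : continuous F -> measurable_fun setT z ->
    measurable_fun setT (fun x => F (z x)).
  by move=> cF mz; exact: (measurableT_comp (continuous_measurable_fun cF) mz).
have [mu1 mv1 mg1 mg2] := And4 lu.1 lv.1 lg1.1 lg2.1.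
apply: weak_partial_of_increments.
- apply: (@cube_integrable_bounded _ (C * D)).
    by apply: measurable_funM; exact: mf.
  by move=> x; rewrite normrM ler_pM // ?(hC _).1 ?(hD _).1.
- apply: cube_integrableD.
    apply: (@cube_integrable_bounded_mul _ _ (C * D)) => //.
      by apply: measurable_funM; exact: mf.
    by move=> x; rewrite normrM ler_pM // ?(hC _).2 ?(hD _).1.
  apply: (@cube_integrable_bounded_mul _ _ (C * D)) => //.
    by apply: measurable_funM; exact: mf.
  by move=> x; rewrite normrM ler_pM // ?(hC _).1 ?(hD _).2.
move=> h h0.
have incu h := @weak_partial_increment _ _ i u g1 h lu lg1 wu.
have incv h := @weak_partial_increment _ _ i v g2 h lv lg2 wv.
have gridJ (J : set R) (z : 'rV[R]_n -> R) : {ae mu, forall x, J (z x)} ->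
    {ae mu, forall x, forall m k, J (z (line i x (grid h m k)))}.
  by move=> zJ; apply/ae_foralln => m; apply/ae_foralln => k; exact: (ae_translate _ zJ).
have E1 := grid_increments mg1 h0 incu; have E2 := grid_increments mg2 h0 incv.
have E3 := gridJ _ _ uJ; have E4 := gridJ _ _ vJ.
have E5 := ae_ae_increment mu1 mg1 incu; have E6 := ae_ae_increment mv1 mg2 incv.
have E7 := ae_integrable_line i h lg1; have E8 := ae_integrable_line i h lg2.
(* a base point on whose line the increments are known at all grid points and at
   almost every time *)
near=> x.
have e1 : forall m k, u (line i x (grid h m k)) = u x + line_int i (grid h m k) g1 x by near: x.
have e2 : forall m k, v (line i x (grid h m k)) = v x + line_int i (grid h m k) g2 x by near: x.
have e3 : forall m k, J1 (u (line i x (grid h m k))) by near: x.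
have e4 : forall m k, J2 (v (line i x (grid h m k))) by near: x.
have e5 : {ae lambda, forall t : R, 0 < t -> u (line i x t) - u x = line_int i t g1 x} by near: x.
have e6 : {ae lambda, forall t : R, 0 < t -> v (line i x t) - v x = line_int i t g2 x} by near: x.
have e7 : lambda.-integrable setT (fun t => (unit_step h t * g1 (line i x t))%:E) by near: x.
have e8 : lambda.-integrable setT (fun t => (unit_step h t * g2 (line i x t))%:E) by near: x.
have /choice[xi hxi] : forall mk : nat * nat, exists c,
    let a := u (line i x (grid h mk.1 mk.2)) in
    let b := u (line i x (grid h mk.1 mk.2.+1)) in
    Num.min a b <= c <= Num.max a b /\ P b - P a = p c * (b - a).
  by move=> mk; exact: slP.
have /choice[eta heta] : forall mk : nat * nat, exists c,
    let a := v (line i x (grid h mk.1 mk.2)) in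
    let b := v (line i x (grid h mk.1 mk.2.+1)) in
    Num.min a b <= c <= Num.max a b /\ Q b - Q a = q c * (b - a).
  by move=> mk; exact: slQ.
pose A m k := p (xi (m, k)) * Q (v (line i x (grid h m k.+1))).
pose B m k := P (u (line i x (grid h m k))) * q (eta (m, k)).
have mal (z : 'rV[R]_n -> R) : measurable_fun setT z -> measurable_fun setT (fun t : R => z (line i x t)).
  exact: measurable_along.
have gle m k : (k <= m.+1)%N -> grid h m k <= h.
  by move=> km; rewrite -[leRHS](grid_last h m) ler_grid.
have ucv (t : R) (kappa : nat -> nat) : u (line i x t) - u x = line_int i t g1 x ->
    (forall m, [/\ (kappa m < m.+1)%N, grid h m (kappa m) < t & t <= grid h m (kappa m).+1]) ->
    u (line i x (grid h m (kappa m))) @[m --> \oo] --> u (line i x t) /\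
    u (line i x (grid h m (kappa m).+1)) @[m --> \oo] --> u (line i x t).
  move=> ut hk; have [s1 s2] := grid_cvg h0 hk.
  have -> : u (line i x t) = u x + line_int i t g1 x by rewrite -ut addrC subrK.
  split.
    under eq_fun do rewrite e1; apply: cvgD; first exact: cvg_cst.
    apply: (line_int_cvg mg1 e7) => // m; apply: gle; have [k1 _ _] := hk m; exact: ltnW.
  under eq_fun do rewrite e1; apply: cvgD; first exact: cvg_cst.
  by apply: (line_int_cvg mg1 e7) => // m; apply: gle; have [k1 _ _] := hk m.
have vcv (t : R) (kappa : nat -> nat) : v (line i x t) - v x = line_int i t g2 x ->
    (forall m, [/\ (kappa m < m.+1)%N, grid h m (kappa m) < t & t <= grid h m (kappa m).+1]) ->
    v (line i x (grid h m (kappa m))) @[m --> \oo] --> v (line i x t) /\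
    v (line i x (grid h m (kappa m).+1)) @[m --> \oo] --> v (line i x t).
  move=> ut hk; have [s1 s2] := grid_cvg h0 hk.
  have -> : v (line i x t) = v x + line_int i t g2 x by rewrite -ut addrC subrK.
  split.
    under eq_fun do rewrite e2; apply: cvgD; first exact: cvg_cst.
    apply: (line_int_cvg mg2 e8) => // m; apply: gle; have [k1 _ _] := hk m; exact: ltnW.
  under eq_fun do rewrite e2; apply: cvgD; first exact: cvg_cst.
  by apply: (line_int_cvg mg2 e8) => // m; apply: gle; have [k1 _ _] := hk m.
have := @step_function_cvg _ h h0 A (fun t => p (u (line i x t)) * Q (v (line i x t)))
  (fun t => g1 (line i x t)) (C * D) (mal _ mg1) e7.
case.
- apply: measurable_funM.
    exact: (measurableT_comp (continuous_measurable_fun cp) (mal _ mu1)).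
  exact: (measurableT_comp (continuous_measurable_fun cQ) (mal _ mv1)).
- by move=> m k _; rewrite normrM ler_pM // ?(hC _).2 ?(hD _).1.
- apply: (@filterS2 _ _ (ae_filter_ringOfSetsType lambda) _ _ _ _ e5 e6) => t ut vt /andP[t0 _] kappa hk.
  have [c1 c2] := ucv t kappa (ut t0) hk; have [d1 d2] := vcv t kappa (vt t0) hk.
  apply: cvgM; last exact: (cvg_comp _ _ d2 (cQ _)).
  apply: (cvg_comp (fun m => xi (m, kappa m)) p); last exact: cp.
  by apply: (between_cvg c1 c2) => m; have [] := hxi (m, kappa m).
move=> cvA iA.
have := @step_function_cvg _ h h0 B (fun t => P (u (line i x t)) * q (v (line i x t)))
  (fun t => g2 (line i x t)) (C * D) (mal _ mg2) e8.
case.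
- apply: measurable_funM.
    exact: (measurableT_comp (continuous_measurable_fun cP) (mal _ mu1)).
  exact: (measurableT_comp (continuous_measurable_fun cq) (mal _ mv1)).
- by move=> m k _; rewrite normrM ler_pM // ?(hC _).1 ?(hD _).2.
- apply: (@filterS2 _ _ (ae_filter_ringOfSetsType lambda) _ _ _ _ e5 e6) => t ut vt /andP[t0 _] kappa hk.
  have [c1 c2] := ucv t kappa (ut t0) hk; have [d1 d2] := vcv t kappa (vt t0) hk.
  apply: cvgM; first exact: (cvg_comp _ _ c1 (cP _)).
  apply: (cvg_comp (fun m => eta (m, kappa m)) q); last exact: cq.
  by apply: (between_cvg d1 d2) => m; have [] := heta (m, kappa m).
move=> cvB iB.
pose w (t : R) := P (u (line i x t)) * Q (v (line i x t)).
pose I g m k := fine (\int[lambda]_t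
  ((unit_step (grid h m k.+1) t - unit_step (grid h m k) t) * g (line i x t))%:E).
have : \sum_(k < m.+1) (A m k * I g1 m k + B m k * I g2 m k) @[m --> \oo] -->
    fine (\int[lambda]_t (unit_step h t *
      (p (u (line i x t)) * Q (v (line i x t)) * g1 (line i x t)))%:E) +
    fine (\int[lambda]_t (unit_step h t *
      (P (u (line i x t)) * q (v (line i x t)) * g2 (line i x t)))%:E).
  by under eq_fun do rewrite big_split; exact: (cvgD cvA cvB).
rewrite (_ : (fun m => _) = cst (w h - w 0)); last first.
  apply/funext => m; rewrite /I.
  transitivity (\sum_(0 <= k < m.+1) (w (grid h m k.+1) - w (grid h m k))).
    rewrite big_mkord; apply: eq_bigr => k _.
    rewrite !(@line_int_increment _ _ _ h) //; try (by apply: gle; rewrite ?ltn_ord // ltnW).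
    have [_ f1] := hxi (m, nat_of_ord k); have [_ f2] := heta (m, nat_of_ord k).
    rewrite /= !e1 !e2 in f1 f2.
    rewrite /A /B /w !e1 !e2.
    (* the discrete product rule that matches the choice of endpoints in [A] and [B] *)
    have split_ (a b c d : R) : a * c - b * d = (a - b) * c + b * (c - d) by ring.
    rewrite split_ f1 f2; ring.
  by rewrite telescope_sumr // grid0 grid_last.
move=> /cvg_lim; rewrite lim_cst // => /(_ (@Rhausdorff R)).
rewrite /w line0 => ->; rewrite /line_int -fineD; try exact: integrable_fin_num.
rewrite -integralD //; congr fine; apply: eq_integral => t _.
by rewrite -EFinD -mulrDr.
Unshelve. all: by end_near.
Qed.

End chain_rule.

(** * Powers as bounded functions *)

Section powers.
Context {R : realType}.
Implicit Types (a b c e p q r x : R).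

Lemma continuous_powR_pos r x : 0 < x -> {for x, continuous (fun y : R => y `^ r)}.
Proof.
move=> x0; apply/differentiable_continuous/derivable1_diffP/derivable_powR.
by rewrite in_itv /= x0.
Qed.

Lemma continuous_maxr_powR r : 0 < r -> continuous (fun y : R => Num.max y 0 `^ r).
Proof.
move=> r0 x; have [x0|x0] := ltP 0 x.
  apply: (@continuous_comp _ _ _ (fun y : R => Num.max y 0) (fun y => y `^ r)).
    by apply: continuous_max; [exact: cvg_id|exact: cvg_cst].
  by apply: continuous_powR_pos; rewrite lt_max x0.
have m0 : Num.max x 0 = 0 by apply/max_idPr.
apply/cvgrPdist_le => e e0; rewrite m0 powR0 ?lt0r_neq0 //.
have d0 : 0 < e `^ r^-1 by rewrite powR_gt0.
have xd : x < e `^ r^-1 by exact: le_lt_trans x0 d0.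
apply: filterS (lt_nbhsl xd) => y yd.
rewrite sub0r normrN ger0_norm ?powR_ge0 //.
have -> : e = (e `^ r^-1) `^ r by rewrite -powRrM mulVf ?lt0r_neq0 // powRr1 // ltW.
by apply: ge0_ler_powR; rewrite ?nnegrE ?le_max ?lexx ?orbT ?ge_max ?ltW.
Qed.

Lemma C1_slopes (J : set R) (F f : R -> R) : continuous F ->
  (forall a b x, J a -> J b -> a < x < b -> is_derive x 1 F (f x)) ->
  forall a b, J a -> J b -> exists c,
        Num.min a b <= c <= Num.max a b /\ F b - F a = f c * (b - a).
Proof.
move=> cF dF.
have lt_case a b : J a -> J b -> a < b -> exists c,
        Num.min a b <= c <= Num.max a b /\ F b - F a = f c * (b - a).
  move=> Ja Jb ab; have [||c] := @MVT _ F f a b ab.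
  - by move=> x; rewrite in_itv /= => /(dF a b x Ja Jb).
  - exact: continuous_subspaceT.
  rewrite in_itv /= => /andP[h1 h2] e; exists c; split => //.
  by rewrite ge_min le_max (ltW h1) (ltW h2) orbT.
move=> a b Ja Jb; have : [|| a < b, b < a | a == b] by case: (ltgtP a b).
case/or3P => [ab|ba|/eqP ->]; first exact: lt_case.
  have [c [h e]] := lt_case _ _ Jb Ja ba; exists c; rewrite minC maxC; split => //.
  by rewrite -opprB e -mulrN opprB.
by exists b; rewrite minxx maxxx lexx !subrr mulr0.
Qed.

Definition clamp (M y : R) : R := Num.max (Num.min y M) 0.

Lemma clamp_id (M y : R) : 0 <= y <= M -> clamp M y = y.
Proof. by move=> /andP[y0 yM]; rewrite /clamp (min_idPl yM) (max_idPl y0). Qed.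

Lemma clamp_bound (M y : R) : 0 <= M -> 0 <= clamp M y <= M.
Proof.
move=> M0; rewrite /clamp le_max lexx orbT /= ge_max M0 andbT.
by rewrite ge_min lexx orbT.
Qed.

Lemma continuous_clamp_powR (M r : R) : 0 < r -> continuous (fun y : R => clamp M y `^ r).
Proof.
move=> r0 x.
apply: (@continuous_comp _ _ _ (fun y : R => Num.min y M) (fun y => Num.max y 0 `^ r)).
  by apply: continuous_min; [exact: cvg_id|exact: cvg_cst].
exact: continuous_maxr_powR.
Qed.

Lemma bounded_C1_clamp_powR (M p : R) : 0 <= M -> 1 < p ->
  bounded_C1_on [set y | 0 <= y <= M] (fun y => clamp M y `^ p)
    (fun y => p * clamp M y `^ (p - 1)).
Proof.
move=> M0 p1; have p0 : 0 < p := lt_trans ltr01 p1; have pm : 0 < p - 1 by rewrite subr_gt0.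
have bd r y : 0 < r -> `|clamp M y `^ r| <= M `^ r.
  move=> r0; have /andP[c0 cM] := clamp_bound y M0.
  by rewrite ger0_norm ?powR_ge0 // ge0_ler_powR ?nnegrE // ltW.
split.
- exact: continuous_clamp_powR.
- by move=> x; apply: cvgMl_tmp; exact: continuous_clamp_powR.
- exists (M `^ p + p * M `^ (p - 1)) => a; split.
    by rewrite (le_trans (bd _ _ p0)) // lerDl mulr_ge0 ?powR_ge0 // ltW.
  rewrite normrM (gtr0_norm p0) (le_trans (ler_wpM2l (ltW p0) (bd _ _ pm))) //.
  by rewrite lerDr powR_ge0.
- apply: C1_slopes; first exact: continuous_clamp_powR.
  move=> a b x /= /andP[a0 aM] /andP[b0 bM] /andP[ax xb].
  have x0 : 0 < x := le_lt_trans a0 ax; have xM : x < M := lt_le_trans xb bM.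
  rewrite clamp_id ?(ltW x0) ?(ltW xM) //.
  apply: (@near_eq_is_derive _ _ _ (fun y => y `^ p)); last exact: is_derive1_powR.
  have n1 := lt_nbhsl xM; have n2 := open_nbhs_nbhs (conj (@open_gt R 0) x0).
  by apply: filterS2 n1 n2 => y y1 y2; rewrite clamp_id // !ltW.
Qed.

Lemma bounded_C1_shift_powRN (e p : R) : 0 < e -> 1 < p ->
  bounded_C1_on [set y | 0 <= y] (fun y => (Num.max y 0 + e) `^ (1 - p))
    (fun y => (1 - p) * (Num.max y 0 + e) `^ (- p)).
Proof.
move=> e0 p1; have p0 : 0 < p := lt_trans ltr01 p1.
have cont r : continuous (fun y : R => (Num.max y 0 + e) `^ r).
  move=> x; apply: (@continuous_comp _ _ _ (fun y : R => Num.max y 0 + e) (fun y => y `^ r)).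
    apply: cvgD; last exact: cvg_cst.
    by apply: continuous_max; [exact: cvg_id|exact: cvg_cst].
  by apply: continuous_powR_pos; rewrite ltr_wpDl // le_max lexx orbT.
have bd r y : 0 <= r -> `|(Num.max y 0 + e) `^ (- r)| <= e `^ (- r).
  move=> r0; rewrite ger0_norm ?powR_ge0 // !powRN lef_pV2 ?posrE ?powR_gt0 //; last first.
    by rewrite ltr_wpDl // le_max lexx orbT.
  by rewrite ge0_ler_powR ?nnegrE ?addr_ge0 ?le_max ?lexx ?orbT ?lerDr ?(ltW e0) // le_max lexx orbT.
split.
- exact: cont.
- by move=> x; apply: cvgMl_tmp; exact: cont.
- exists (e `^ (1 - p) + `|1 - p| * e `^ (- p)) => a; split.
    rewrite -(opprB p 1) (le_trans (bd _ _ _)) ?subr_ge0 ?(ltW p1) //.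
    by rewrite lerDl mulr_ge0 ?powR_ge0.
  by rewrite normrM (le_trans (ler_wpM2l _ (bd _ _ (ltW p0)))) // lerDr powR_ge0.
- apply: C1_slopes; first exact: cont.
  move=> a b x /= a0 b0 /andP[ax xb]; have x0 : 0 < x := le_lt_trans a0 ax.
  rewrite (max_idPl (ltW x0)).
  apply: (@near_eq_is_derive _ _ _ (fun y => (y + e) `^ (1 - p))).
    apply: filterS (open_nbhs_nbhs (conj (@open_gt R 0) x0)) => y y0.
    by rewrite (max_idPl (ltW y0)).
  have dx : is_derive x 1 (fun y : R => y + e) 1.
    have -> : (fun y : R => y + e) = id + cst e by [].
    by apply: is_derive_eq; rewrite addr0.
  have xe : 0 < x + e by rewrite addr_gt0.
  have := @is_derive1_comp _ (fun y => y `^ (1 - p)) (fun y : R => y + e) _ _ _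
    (is_derive1_powR (1 - p) xe) dx.
  by move=> h; apply: is_derive_eq; rewrite mulr1 addrAC subrr add0r.
Qed.

Lemma powR_div a c q : 0 <= a -> 0 < c -> (a / c) `^ q = a `^ q * c `^ (- q).
Proof.
move=> a0 c0; rewrite powRM ?invr_ge0 ?(ltW c0) //; congr (_ * _).
by rewrite -powR_inv1 ?(ltW c0) // -powRrM mulN1r.
Qed.

Lemma powR_mulN a q : 0 < a -> a `^ q * a `^ (- q) = 1.
Proof. by move=> a0; rewrite powRN divff // gt_eqF // powR_gt0. Qed.

Lemma picone_testE p a c : 0 <= a -> 0 < c ->
  a `^ p * c `^ (1 - p) = c * (a / c) `^ p.
Proof.
move=> a0 c0; rewrite powR_div // mulrCA; congr (_ * _).
by rewrite powRD ?powRr1 ?(ltW c0) // (gt_eqF c0) implybT.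
Qed.

Lemma picone_rhs p a b : 0 < a -> 0 < b ->
  (b ^+ 2 / a) `^ (p - 1) * (a `^ p * b `^ (1 - p)) = b `^ (p - 1) * a.
Proof.
move=> a0 b0; rewrite powR_div ?sqr_ge0 // expr2 powRM ?(ltW b0) // opprB.
have -> : a `^ p = a `^ (p - 1) * a.
  by rewrite -[X in _ * X](powRr1 (ltW a0)) -powRD ?subrK // (gt_eqF a0) implybT.
have := powR_mulN (p - 1) b0; have := powR_mulN (p - 1) a0; rewrite opprB => ha hb.
transitivity ((b `^ (p - 1) * b `^ (1 - p)) * (a `^ (p - 1) * a `^ (1 - p)) *
  (b `^ (p - 1) * a)); first by ring.
by rewrite ha hb !mul1r.
Qed.

Lemma picone_test_cvg p a b (e : nat -> R) : 0 < b -> e @ \oo --> 0 ->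
  a `^ p * (b + e k) `^ (1 - p) @[k --> \oo] --> a `^ p * b `^ (1 - p).
Proof.
move=> b0 e0; apply: cvgM; first exact: cvg_cst.
have be : b + e k @[k --> \oo] --> b.
  by rewrite -[X in _ --> X]addr0; apply: cvgD => //; exact: cvg_cst.
apply: (cvg_comp (fun k => b + e k) (fun y : R => y `^ (1 - p))); last exact: continuous_powR_pos.
exact: be.
Qed.

Lemma powR_le_shift p b e : 1 <= p -> 0 < b -> 0 <= e ->
  (b + e) `^ (1 - p) <= b `^ (1 - p).
Proof.
move=> p1 b0 e0; rewrite -opprB !powRN lef_pV2 ?posrE ?powR_gt0 ?ltr_wpDr //.
by rewrite ge0_ler_powR ?nnegrE ?subr_ge0 ?addr_ge0 ?(ltW b0) // lerDl.
Qed.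

End powers.

(** * The test function *)

Section picone_test_function.
Context {R : realType} {n : nat}.
Local Notation mu := (@leb R n).
Implicit Types (f g u v : 'rV[R]_n -> R) (x : 'rV[R]_n) (p e C : R).

Lemma Lfun_dominated p C f g : 1 <= p -> measurable_fun setT f ->
  (forall x, `|f x| <= C * `|g x|) -> g \in Lfun mu p%:E -> f \in Lfun mu p%:E.
Proof.
move=> p1 mf fg gL; have p0 : 0 < p := lt_le_trans ltr01 p1.
have ig := Lfun_integrable p1 gL.
have iC := integrableZl measurableT (`|C| `^ p) ig.
have iF : mu.-integrable setT (fun x => (`|f x| `^ p)%:E).
  apply: le_integrable iC => //.
    apply/measurable_EFinP.
    apply: (measurableT_comp (f := fun y : R => y `^ p)); first exact: measurable_powR.
    exact: measurableT_comp.
  move=> x _; rewrite /= lee_fin (ger0_norm (powR_ge0 _ _)).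
  rewrite (ger0_norm (mulr_ge0 (powR_ge0 _ _) (powR_ge0 _ _))).
  rewrite -powRM // ge0_ler_powR ?nnegrE ?mulr_ge0 ?(ltW p0) //.
  by rewrite (le_trans (fg x)) // ler_wpM2r // ler_norm.
rewrite inE; apply/andP; split; rewrite inE //=.
rewrite /finite_norm unlock /=.
rewrite poweR_lty //.
have /integrableP[_] := iF; apply: le_lt_trans.
rewrite le_eqVlt; apply/orP; left; apply/eqP; apply: eq_integral => x _ /=.
by rewrite (ger0_norm (powR_ge0 _ _)).
Qed.

Lemma Lfun_measurable q f : f \in Lfun mu q -> measurable_fun setT f.
Proof. by move=> /sub_Lfun_mfun; rewrite inE. Qed.

Lemma LfunD_fun p f g : 1 <= p -> f \in Lfun mu p%:E -> g \in Lfun mu p%:E ->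
  (fun x => f x + g x) \in Lfun mu p%:E.
Proof.
move=> p1 fL gL.
have p1' : (1 <= p%:E)%E by rewrite lee_fin.
have [_ h] := @Lfun_addr_closed _ _ _ mu p%:E p1'.
exact: (h f g fL gL).
Qed.

Lemma weak_gradient_spec p u : W1p p u -> is_weak_gradient p u (weak_gradient p u).
Proof.
move=> [_ [G hG]]; rewrite /weak_gradient.
exact: (@xgetPex _ (fun=> 0) [set G | is_weak_gradient p u G] (ex_intro _ G hG)).
Qed.

Lemma is_weak_gradient_partial p u G i : is_weak_gradient p u G ->
  weak_partial i u (fun x => G x ord0 i).
Proof. by move=> /(_ i)[_]. Qed.

Lemma weak_gradient_unique p u G : 1 <= p -> is_weak_gradient p u G -> W1p p u ->
  {ae mu, forall x, weak_gradient p u x = G x}.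
Proof.
move=> p1 hG uW; have hW := weak_gradient_spec uW.
have : {ae mu, forall x, forall i, weak_gradient p u x ord0 i = G x ord0 i}.
  apply: filter_forall => i.
  apply: (@weak_partial_unique _ _ i u).
  - exact: (cube_integrable_Lfun p1 (hW i).1).
  - exact: (cube_integrable_Lfun p1 (hG i).1).
  - exact: is_weak_gradient_partial hW.
  - exact: is_weak_gradient_partial hG.
by apply: filterS => x h; apply/rowP.
Qed.

(** This is [u `^ p * (v + e) `^ (1 - p)] where [0 <= u <= M] and [0 <= v]; the
    truncations make both factors bounded, with bounded derivatives, on the whole
    line. *)
Definition picone_fun p M e u v x : R :=
  clamp M (u x) `^ p * (Num.max (v x) 0 + e) `^ (1 - p).

(** The gradient formula is the chain rule, put in the shape of the anisotropic Picone
    inequality with [t = u / (v + e)]. As the first factor is at most [M `^ (p - 1) * u]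
    and vanishes with [u], the function is p-integrable and vanishes outside [Omega]. *)
Lemma picone_fun_spec p M e u v (Omega : set 'rV[R]_n) :
  1 < p -> 0 <= M -> 0 < e -> W01p p Omega u -> W01p p Omega v ->
  {ae mu, forall x, 0 <= u x <= M} -> {ae mu, forall x, 0 <= v x} ->
  let phi := picone_fun p M e u v in
  W01p p Omega phi /\
  {ae mu, forall x, weak_gradient p phi x =
    (p * (u x / (v x + e)) `^ (p - 1)) *: weak_gradient p u x -
    ((p - 1) * (u x / (v x + e)) `^ p) *: weak_gradient p v x}.
Proof.
move=> p1 M0 e0 [uW uO] [vW vO] uJ vJ phi.
have p1' := ltW p1; have p0 : 0 < p := lt_trans ltr01 p1.
have hu := weak_gradient_spec uW; have hv := weak_gradient_spec vW.
have [cP cp [C hC] sP] := bounded_C1_clamp_powR M0 p1.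
have [cQ cq [D hD] sQ] := bounded_C1_shift_powRN e0 p1.
pose P (a : R) := clamp M a `^ p; pose dP (a : R) := p * clamp M a `^ (p - 1).
pose Q (b : R) := (Num.max b 0 + e) `^ (1 - p).
pose dQ (b : R) := (1 - p) * (Num.max b 0 + e) `^ (- p).
have C0 : 0 <= C by rewrite (le_trans _ (hC 0).1).
have D0 : 0 <= D by rewrite (le_trans _ (hD 0).1).
have {}hC a : `|P a| <= C /\ `|dP a| <= C := hC a.
have {}hD b : `|Q b| <= D /\ `|dQ b| <= D := hD b.
have mu1 := Lfun_measurable uW.1; have mv1 := Lfun_measurable vW.1.
have mc (F : R -> R) (z : 'rV[R]_n -> R) : continuous F -> measurable_fun setT z ->
    measurable_fun setT (fun x => F (z x)).
  by move=> cF mz; exact: (measurableT_comp (continuous_measurable_fun cF) mz).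
have mP := mc P u cP mu1; have mdP := mc dP u cp mu1.
have mQ := mc Q v cQ mv1; have mdQ := mc dQ v cq mv1.
pose G x := (dP (u x) * Q (v x)) *: weak_gradient p u x +
            (P (u x) * dQ (v x)) *: weak_gradient p v x.
have GE x i : G x ord0 i = dP (u x) * Q (v x) * weak_gradient p u x ord0 i +
            P (u x) * dQ (v x) * weak_gradient p v x ord0 i.
  by rewrite !mxE.
have hG : is_weak_gradient p phi G.
  move=> i; have -> : (fun x => G x ord0 i) = fun x =>
     dP (u x) * Q (v x) * weak_gradient p u x ord0 i +
     P (u x) * dQ (v x) * weak_gradient p v x ord0 i by apply/funext => x.
  split; last first.
    suff : weak_partial i (fun x => P (u x) * Q (v x)) (fun x =>
        dP (u x) * Q (v x) * weak_gradient p u x ord0 i +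
        P (u x) * dQ (v x) * weak_gradient p v x ord0 i).
      move=> h psi /h; rewrite /phi /picone_fun => ->; congr (- _)%E.
      by apply: eq_integral => x _; rewrite GE.
    apply: (@weak_partial_mul_comp _ _ i u v _ _ [set y | 0 <= y <= M] [set y | 0 <= y]).
    - exact: (cube_integrable_Lfun p1' uW.1).
    - exact: (cube_integrable_Lfun p1' vW.1).
    - exact: (cube_integrable_Lfun p1' (hu i).1).
    - exact: (cube_integrable_Lfun p1' (hv i).1).
    - exact: is_weak_gradient_partial hu.
    - exact: is_weak_gradient_partial hv.
    - exact: uJ.
    - exact: vJ.
    - exact: bounded_C1_clamp_powR.
    - exact: bounded_C1_shift_powRN.
  apply: LfunD_fun => //.
    apply: (@Lfun_dominated _ (C * D) _ _ p1' _ _ (hu i).1).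
      by apply: measurable_funM; [exact: measurable_funM|exact: Lfun_measurable (hu i).1].
    by move=> x; rewrite normrM (normrM (dP _)) ler_wpM2r // ler_pM // ?(hC (u x)).2 ?(hD (v x)).1.
  apply: (@Lfun_dominated _ (C * D) _ _ p1' _ _ (hv i).1).
    by apply: measurable_funM; [exact: measurable_funM|exact: Lfun_measurable (hv i).1].
  by move=> x; rewrite normrM (normrM (P _)) ler_wpM2r // ler_pM // ?(hC (u x)).1 ?(hD (v x)).2.
have phiL : phi \in Lfun mu p%:E.
  apply: (@Lfun_dominated _ (M `^ (p - 1) * D) _ _ p1' _ _ uW.1).
    exact: measurable_funM.
  move=> x; rewrite /phi /picone_fun normrM.
  have /andP[c0 cM] := clamp_bound (u x) M0.
  rewrite -mulrA (mulrC D) mulrA ler_pM // ?(hD (v x)).1 //.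
  rewrite ger0_norm ?powR_ge0 // -(mulr_powRB1 c0 p0) mulrC ler_pM ?powR_ge0 //.
    by rewrite ge0_ler_powR ?nnegrE ?subr_ge0.
  rewrite /clamp ge_max normr_ge0 andbT ge_min; apply/orP; left.
  exact: ler_norm.
have phiW : W1p p phi by split => //; exists G.
have ve_gt0 x : 0 <= v x -> 0 < v x + e by move=> ?; rewrite ltr_wpDl.
split.
- split => //; apply: filterS uO => x h /h ux.
  by rewrite /phi /picone_fun ux clamp_id ?lexx // powR0 ?mul0r // gt_eqF.
- have := weak_gradient_unique p1' hG phiW.
  apply: filterS3 uJ vJ => x hu0 v0 ->; have ve := ve_gt0 x v0.
  have /andP[u0 _] := hu0.
  rewrite /G /P /dP /Q /dQ clamp_id // (max_idPl v0) -scaleNr.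
  congr (_ *: _ + _ *: _).
  + by rewrite powR_div // mulrA opprB.
  + by rewrite powR_div // mulrCA mulrA -mulNr opprB mulrA.
Qed.

End picone_test_function.

(** * Almost everywhere and integrals *)

Section almost_everywhere.
Context d (T : measurableType d) (R : realType) (mu : {measure set T -> \bar R}).
Implicit Types (D : set T) (h : T -> R).

(** The integral is the difference of the integrals of the positive and negative
    parts; it is not finite as soon as one of them is infinite. *)
Lemma integral_fin_num_integrable D h : measurable D -> measurable_fun D h ->
  (\int[mu]_(x in D) (h x)%:E)%E \is a fin_num -> mu.-integrable D (EFin \o h).
Proof.
move=> mD mh; have mEh : measurable_fun D (EFin \o h) by exact/measurable_EFinP.
rewrite integralE fin_numB => /andP[fp fn].
apply/integrableP; split => //.
under eq_integral do rewrite -/((abse \o (EFin \o h)) _) fune_abse.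
rewrite ge0_integralD //; last 2 first.
- exact: measurable_funepos.
- exact: measurable_funeneg.
by rewrite lte_add_pinfty // ltey_eq ?fp ?fn.
Qed.

Lemma ae_le_integral D h1 h2 : measurable D ->
  mu.-integrable D (EFin \o h1) -> mu.-integrable D (EFin \o h2) ->
  {ae mu, forall x, D x -> h1 x <= h2 x} ->
  (\int[mu]_(x in D) (h1 x)%:E <= \int[mu]_(x in D) (h2 x)%:E)%E.
Proof.
move=> mD i1 i2 h12.
have /measurable_EFinP m1 := measurable_int mu i1.
have /measurable_EFinP m2 := measurable_int mu i2.
have mm : measurable_fun D (fun x => Num.min (h1 x) (h2 x)) by exact: measurable_minr.
have -> : (\int[mu]_(x in D) (h1 x)%:E = \int[mu]_(x in D) (Num.min (h1 x) (h2 x))%:E)%E.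
  apply: ae_eq_integral => //; [exact/measurable_EFinP|exact/measurable_EFinP|].
  by apply: filterS h12 => x hx Dx; rewrite (min_idPl (hx Dx)).
apply: le_integral => //.
  apply: (le_integrable mD (g := fun x => (`|h1 x| + `|h2 x|)%:E)).
  - exact/measurable_EFinP.
  - move=> x _; rewrite lee_fin [leRHS]ger0_norm ?addr_ge0 //.
    by case: (leP (h1 x) (h2 x)) => _; rewrite ?lerDl ?lerDr.
  - by rewrite (_ : (fun x => _) = (fun x => `|(EFin \o h1) x| + `|(EFin \o h2) x|)%E) //;
       apply: integrableD => //; apply: integrable_abse.
by move=> x _; rewrite lee_fin ge_min lexx orbT.
Qed.

(** By Fatou's lemma the lower limit of the positive parts has integral zero, hence
    vanishes almost everywhere, and a limit coincides with the lower limit. *)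
Lemma ae_cvg0_of_integral_cvg0 (h : nat -> T -> R) (c : nat -> \bar R) :
  (forall k, mu.-integrable setT (EFin \o h k)) ->
  (forall k, {ae mu, forall x, 0 <= h k x}) ->
  (forall k, (\int[mu]_x (h k x)%:E <= c k)%E) -> (c @ \oo --> 0)%E ->
  {ae mu, forall x, forall l : R, h ^~ x @ \oo --> l -> l = 0}.
Proof.
move=> ih h0 hc c0.
pose g k x := (Num.max (h k x) 0)%:E.
have mh k : measurable_fun setT (h k) by have /measurable_EFinP := measurable_int mu (ih k).
have mg k : measurable_fun setT (g k).
  by apply/measurable_EFinP; apply: measurable_maxr.
have g0 k x : (0 <= g k x)%E by rewrite lee_fin le_max lexx orbT.
have Ig k : (\int[mu]_x g k x <= c k)%E.
  apply: le_trans (hc k); rewrite le_eqVlt; apply/orP; left; apply/eqP.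
  apply: ae_eq_integral => //; first exact: measurable_int (ih k).
  by apply: filterS (h0 k) => x hx _; rewrite /g (max_idPl hx).
pose G x := limn_einf (g ^~ x).
have mG : measurable_fun setT G.
  rewrite /G /limn_einf; apply: measurableT_comp => //.
  apply: measurable_fun_limn_esup => k.
  exact: measurableT_comp.
have G0 x : (0 <= G x)%E.
  rewrite /G limn_einf_lim; apply: lime_ge; first exact: is_cvg_einfs.
  by apply: nearW => k; apply: le_ereal_inf_tmp => _ [m /= _ <-].
have IG : (\int[mu]_x `|G x| = 0)%E.
  under eq_integral do rewrite gee0_abs //.
  apply/eqP; rewrite eq_le integral_ge0 // andbT.
  apply: le_trans (fatou mu measurableT mg (fun k x _ => g0 k x)) _.
  have [<- _] := cvg_limn_einf_sup c0.
  rewrite !limn_einf_lim; apply: lee_lim; [exact: is_cvg_einfs|exact: is_cvg_einfs|].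
  apply: nearW => k; apply: le_ereal_inf_tmp => _ [m /= km <-].
  by apply: ge_ereal_inf; exists (\int[mu]_x g m x)%E; [exists m|exact: Ig].
have := (ae_eq_integral_abs mu measurableT mG).1 IG.
have : {ae mu, forall x k, 0 <= h k x} by exact: ae_foralln.
apply: filterS2 => x hx /(_ Logic.I) Gx l hl.
have gl : (g k x @[k --> \oo] --> l%:E)%E.
  apply: cvg_EFin; first exact: nearW.
  by apply: cvg_trans hl; apply: near_eq_cvg; apply: nearW => k /=; rewrite (max_idPl (hx k)).
have [+ _] := cvg_limn_einf_sup gl.
by rewrite -/(G x) Gx => -[<-].
Qed.

End almost_everywhere.

Section product_almost_everywhere.
Context d1 d2 (T1 : measurableType d1) (T2 : measurableType d2) (R : realType).
Variable m1 : {sigma_finite_measure set T1 -> \bar R}.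
Variable m2 : {sigma_finite_measure set T2 -> \bar R}.

Lemma ae_fst (P : set T1) : {ae m1, forall x, P x} ->
  {ae (m1 \x m2)%E, forall z, P z.1}.
Proof.
move=> [N [mN N0 sN]]; exists (N `*` setT); split => /=.
- exact: measurableX.
- apply: etrans (product_measure1E m1 m2 mN measurableT) _.
  by apply: etrans (mul0e _); congr (_ * _)%E; exact: N0.
- by move=> z nz; split => //; exact: sN.
Qed.

Lemma ae_snd (P : set T2) : {ae m2, forall y, P y} ->
  {ae (m1 \x m2)%E, forall z, P z.2}.
Proof.
move=> [N [mN N0 sN]]; exists (setT `*` N); split => /=.
- exact: measurableX.
- apply: etrans (product_measure1E m1 m2 measurableT mN) _.
  by apply: etrans (mule0 _); congr (_ * _)%E; exact: N0.
- by move=> z nz; split => //; exact: sN.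
Qed.

Lemma ae_section (P : set (T1 * T2)) : {ae (m1 \x m2)%E, forall z, P z} ->
  {ae m1, forall x, {ae m2, forall y, P (x, y)}}.
Proof.
move=> [N [mN N0 sN]].
have := (ae_eq_integral_abs m1 measurableT (measurable_fun_xsection m2 mN)).1.
case.
  by under eq_integral do rewrite gee0_abs //.
move=> A [mA A0 sA]; exists A; split => // x nx; apply: sA => /(_ Logic.I) /= xs.
apply: nx; exists (xsection N x); split => //; first exact: measurable_xsection.
by move=> y ny; rewrite /xsection /= inE; exact: sN.
Qed.

End product_almost_everywhere.

(** * Integrability of the energy forms *)

Section measurable_forms.
Context {R : realType} {n : nat}.
Local Notation mu := (@leb R n).
Implicit Types (w phi : 'rV[R]_n -> R) (Omega : set 'rV[R]_n) (p s : R).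

Lemma measurable_enorm : measurable_fun setT (@enorm R n).
Proof.
apply: (measurableT_comp (f := @Num.sqrt R)).
  exact: continuous_measurable_fun (@sqrt_continuous R).
by apply: measurable_sum => i; apply: measurable_funM; exact: measurable_coord.
Qed.

(** The gradient of [H] is continuous off the origin, which is an open set; the
    origin is treated apart. *)
Lemma measurable_finsler_flux p (H : 'rV[R]_n -> R) (i : 'I_n) :
  finsler_minkowski H -> measurable_fun setT (fun x => finsler_flux p H x ord0 i).
Proof.
move=> hH; pose U := [set x : 'rV[R]_n | x != 0].
have oU : open U.
  have -> : U = ~` [set 0].
    by apply/seteqP; split => x /eqP.
  by apply: closed_openC; exact: accessible_closed_set1 (hausdorff_accessible (@norm_hausdorff _ _)) _.
have mU : measurable U by exact: open_measurable_rV.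
have [cH /(_ i)[_ [cdH _]]] := finsler_C1 hH.
rewrite -(setUv U); apply/(measurable_funU _ mU (measurableC mU)).
split.
  apply: (eq_measurable_fun (fun x => H x `^ (p - 1) * partial H i x)).
    by move=> x; rewrite inE /U /= /finsler_flux => /negPf ->; rewrite !mxE.
  apply: measurable_funM; last exact: continuous_measurable_rV.
  apply: (measurableT_comp (f := fun y : R => y `^ (p - 1))); first exact: measurable_powR.
  exact: continuous_measurable_rV.
apply: (eq_measurable_fun (cst (0 : R))).
  by move=> x; rewrite inE /U /= /finsler_flux => /negP; rewrite negbK => ->; rewrite mxE.
exact: measurable_cst.
Qed.

Lemma measurable_finsler_integrand p (H : 'rV[R]_n -> R) (G G' : 'rV[R]_n -> 'rV[R]_n) :
  finsler_minkowski H -> (forall i, measurable_fun setT (fun x => G x ord0 i)) ->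
  (forall i, measurable_fun setT (fun x => G' x ord0 i)) ->
  measurable_fun setT (fun x => dotp (finsler_flux p H (G x)) (G' x)).
Proof.
move=> hH mG mG'; apply: measurable_sum => i; apply: measurable_funM => //.
apply: (measurableT_comp (f := fun y => finsler_flux p H y ord0 i)).
  exact: measurable_finsler_flux.
exact: measurable_fun_rV.
Qed.

Definition kernel p s (z : 'rV[R]_n * 'rV[R]_n) : R :=
  enorm (z.1 - z.2) `^ (- (n%:R + p * s)).

Lemma measurable_kernel p s : measurable_fun setT (kernel p s).
Proof.
apply: (measurableT_comp (f := fun y : R => y `^ (- (n%:R + p * s)))).
  exact: measurable_powR.
apply: measurableT_comp; first exact: measurable_enorm.
apply: measurable_fun_rV => i.
rewrite (_ : (fun x => _) = fun x : 'rV[R]_n * 'rV[R]_n => x.1 ord0 i - x.2 ord0 i).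
  apply: measurable_funB.
    by apply: (measurableT_comp (measurable_coord i)); exact: measurable_fst.
  by apply: (measurableT_comp (measurable_coord i)); exact: measurable_snd.
by apply/funext => x; rewrite !mxE.
Qed.

Lemma kernel_gt0 p s z : z.1 != z.2 -> 0 < kernel p s z.
Proof.
move=> z12; rewrite /kernel powR_gt0 // lt0r sqrtr_ge0 andbT sqrtr_eq0 -ltNge.
rewrite lt0r sumr_ge0 ?andbT => [|i _]; last by rewrite -expr2 sqr_ge0.
rewrite psumr_neq0 => [|i _]; last by rewrite -expr2 sqr_ge0.
apply: contraNT z12 => /hasPn h; apply/eqP/rowP => i; apply/eqP.
have := h i; rewrite mem_index_enum => /(_ isT); rewrite -expr2 exprn_even_gt0 //=.
by rewrite negbK !mxE subr_eq0.
Qed.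

Definition fractional_integrand p s w phi z : R :=
  jump p (w z.1 - w z.2) * (phi z.1 - phi z.2) * kernel p s z.

Lemma measurable_fractional_integrand p s w phi :
  measurable_fun setT w -> measurable_fun setT phi ->
  measurable_fun setT (fractional_integrand p s w phi).
Proof.
have mB (h : 'rV[R]_n -> R) : measurable_fun setT h ->
    measurable_fun setT (fun z : 'rV[R]_n * 'rV[R]_n => h z.1 - h z.2).
  move=> mh; apply: measurable_funB.
    by apply: (measurableT_comp mh); exact: measurable_fst.
  by apply: (measurableT_comp mh); exact: measurable_snd.
move=> /mB mw /mB mphi; apply: measurable_funM; last exact: measurable_kernel.
apply: measurable_funM => //.
apply: (measurableT_comp (f := @jump R p)) => //.
apply: measurable_funM => //.
by apply: (measurableT_comp (f := fun y : R => y `^ (p - 2))); [exact: measurable_powR|].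
Qed.

(** A finite sum of two extended reals has finite terms. Since the integral against a
    test function is finite, so are the two forms, and their integrands are
    integrable. *)
Lemma weak_solution_integrable p s (H : 'rV[R]_n -> R) Omega w F phi :
  1 <= p -> finsler_minkowski H -> open Omega ->
  weak_solution p s H Omega w F -> W01p p Omega phi ->
  [/\ mu.-integrable Omega
        (fun x => (dotp (finsler_flux p H (weak_gradient p w x)) (weak_gradient p phi x))%:E),
      (mu \x mu)%E.-integrable setT (EFin \o fractional_integrand p s w phi),
      mu.-integrable Omega (fun x => (F x * phi x)%:E) &
      (finsler_form p H Omega w phi + \int[(mu \x mu)%E]_z (fractional_integrand p s w phi z)%:E =
       \int[mu]_(x in Omega) (F x * phi x)%:E)%E].
Proof.
move=> p1 hH oO [[wW _] /(_ phi)h] phiW; have [iF e] := h phiW.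
have mO := open_measurable_rV oO; have [{}phiW _] := phiW.
have e' : (finsler_form p H Omega w phi + \int[(mu \x mu)%E]_z (fractional_integrand p s w phi z)%:E =
       \int[mu]_(x in Omega) (F x * phi x)%:E)%E := e.
have := integrable_fin_num mO iF; rewrite -e' fin_numD => /andP[f1 f2].
split => //.
  apply: integral_fin_num_integrable => //.
  apply: measurable_funTS; apply: measurable_finsler_integrand => // i.
    exact: Lfun_measurable (weak_gradient_spec wW i).1.
  exact: Lfun_measurable (weak_gradient_spec phiW i).1.
apply: integral_fin_num_integrable => //.
apply: measurable_fractional_integrand.
  exact: Lfun_measurable wW.1.
exact: Lfun_measurable phiW.1.
Qed.

End measurable_forms.

(** * Proportionality of the solutions *)

Section bounds.
Context {R : realType} {n : nat}.
Local Notation mu := (@leb R n).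

Lemma lee_subD (A a' B b' X Y : \bar R) : X \is a fin_num -> Y \is a fin_num ->
  (A + a' = X -> B + b' = Y -> B <= A -> a' - b' <= X - Y)%E.
Proof.
move=> fX fY eX eY; move: fX fY; rewrite -{}eX -{}eY !fin_numD.
move=> /andP[/fineK<- /fineK<-] /andP[/fineK<- /fineK<-].
by rewrite -!EFinD !lee_fin => ?; lra.
Qed.

Lemma in_Linfty_bounded (Omega : set 'rV[R]_n) (u : 'rV[R]_n -> R) :
  in_Linfty Omega u ->
  exists M, 0 <= M /\ {ae mu, forall x, Omega x -> u x <= M}.
Proof.
rewrite /in_Linfty inE => /andP[_]; rewrite inE /= /finite_norm unlock /=.
case: ifPn => [mu0 fin|]; last first.
  rewrite -leNgt => mu0; exists 0; split => //.
  exists setT; split => //; apply/eqP; rewrite eq_le mu0; exact: measure_ge0.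
have := ess_sup_inf.ess_sup_ge mu (abse \o (EFin \o u \_ Omega)).
case: (ess_sup_inf.ess_sup _ _) fin => // [r _ h|_ h].
  exists (Num.max r 0); split; first by rewrite le_max lexx orbT.
  apply: filterS h => x; rewrite /= lee_fin patchE => + Ox.
  rewrite mem_set // => h; rewrite le_max; apply/orP; left.
  exact: le_trans (ler_norm _) h.
by exists 0; split => //; apply: filterS h => x /=; rewrite leeNy_eq.
Qed.

End bounds.

Theorem theorem2p27 (R : realType) (N : nat) (p s : R)
    (Omega : set 'rV[R]_N) (H f u v : 'rV[R]_N -> R)
    (hN : (2 <= N)%N) (hp : 1 < p) (hs : 0 < s < 1)
    (hOmega : bounded_C1_domain Omega) (hH : finsler_minkowski H)
    (f_Linfty : in_Linfty Omega f)
    (f_ge0 : {ae @leb R N, forall x, Omega x -> 0 <= f x})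
    (f_neq0 : ~ {ae @leb R N, forall x, Omega x -> f x = 0})
    (u_W : W01p p Omega u) (u_Linfty : in_Linfty Omega u)
    (v_W : W01p p Omega v)
    (u_gt0 : {ae @leb R N, forall x, Omega x -> 0 < u x})
    (v_gt0 : {ae @leb R N, forall x, Omega x -> 0 < v x})
    (u_sol : weak_solution p s H Omega u
      (fun x => f x * v x `^ (p - 1)))
    (v_sol : weak_solution p s H Omega v
      (fun x => f x * (v x ^+ 2 / u x) `^ (p - 1))) :
  exists k : R, 0 < k /\
    {ae @leb R N, forall x, Omega x -> v x = k * u x}.
Proof.
have p1 := ltW hp; have p0 : 0 < p := lt_trans ltr01 hp.
have oO := domain_open hOmega; have mO := open_measurable_rV oO.
have [M [M0 uM]] := in_Linfty_bounded u_Linfty.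
have uJ : {ae @leb R N, forall x, 0 <= u x <= M}.
  apply: filterS3 uM u_gt0 u_W.2 => x h1 h2 h3.
  have [Ox|nOx] := pselect (Omega x); first by rewrite (ltW (h2 Ox)) h1.
  by rewrite h3 // lexx.
have vJ : {ae @leb R N, forall x, 0 <= v x}.
  apply: filterS2 v_gt0 v_W.2 => x h2 h3.
  have [Ox|nOx] := pselect (Omega x); first by rewrite (ltW (h2 Ox)).
  by rewrite h3 // lexx.
(* the shift by [e k] keeps the denominator of the test function away from zero *)
pose e (k : nat) : R := k.+1%:R^-1.
have e_gt0 k : 0 < e k by rewrite invr_gt0 ltr0n.
have e_cvg : e @ \oo --> 0 by exact: cvg_harmonic.
pose phi k := picone_fun p M (e k) u v.
have phi_spec k := picone_fun_spec hp M0 (e_gt0 k) u_W v_W uJ vJ.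
have phiE k : {ae @leb R N, forall x, phi k x = u x `^ p * (v x + e k) `^ (1 - p)}.
  apply: filterS2 uJ vJ => x ux vx.
  by rewrite /phi /picone_fun clamp_id // (max_idPl vx).
have [iIu iJu iFu eu] := weak_solution_integrable p1 hH oO u_sol u_W.
have Sv k := weak_solution_integrable p1 hH oO v_sol (phi_spec k).1.
have local_le k : (finsler_form p H Omega v (phi k) <= finsler_form p H Omega u u)%E.
  have [iIv _ _ _] := Sv k; have [_ gradE] := phi_spec k.
  apply: ae_le_integral => //.
  apply: filterS3 gradE uJ vJ => x -> /andP[ux _] vx _.
  rewrite [leRHS](flux_self hH hp); apply: (finsler_picone hH hp).
  by rewrite divr_ge0 // addr_ge0 // ltW.
(* the deficit in the discrete Picone inequality, with [v + e k] in place of [v] *)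
pose h k z := fractional_integrand p s u u z - fractional_integrand p s v (phi k) z.
pose Y k := (\int[@leb R N]_(x in Omega) (f x * (v x ^+ 2 / u x) `^ (p - 1) * phi k x)%:E)%E.
pose X := (\int[@leb R N]_(x in Omega) (f x * v x `^ (p - 1) * u x)%:E)%E.
have X_fin : X \is a fin_num by exact: integrable_fin_num.
have all_ae : {ae @leb R N, forall x, [/\ 0 <= u x, 0 <= v x,
    Omega x -> 0 < u x /\ 0 < v x &
    forall k, phi k x = u x `^ p * (v x + e k) `^ (1 - p)]}.
  have : {ae @leb R N, forall x k, phi k x = u x `^ p * (v x + e k) `^ (1 - p)}.
    by apply/ae_foralln.
  have : {ae @leb R N, forall x, Omega x -> 0 < u x /\ 0 < v x}.
    by apply: filterS2 u_gt0 v_gt0 => x h1 h2 Ox; split; [exact: h1|exact: h2].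
  move=> h1 h2; apply: filterS3 (filterI uJ vJ) h1 h2 => x [/andP[ux _] vx] px ex.
  by split.
have ih k : (@leb R N \x @leb R N)%E.-integrable setT (EFin \o h k).
  have [_ iJv _ _] := Sv k.
  rewrite (_ : _ \o _ = (fun z => (EFin \o fractional_integrand p s u u) z -
    (EFin \o fractional_integrand p s v (phi k)) z)%E) //.
  exact: integrableB.
have hE k z : h k z = (`|u z.1 - u z.2| `^ p -
    jump p (v z.1 - v z.2) * (phi k z.1 - phi k z.2)) * kernel p s z.
  by rewrite /h /fractional_integrand (jump_mul hp) -mulrBl.
have h_ge0 k : {ae (@leb R N \x @leb R N)%E, forall z, 0 <= h k z}.
  apply: filterS2 (ae_fst _ all_ae) (ae_snd _ all_ae) => z [u1 v1 _ e1] [u2 v2 _ e2].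
  rewrite hE mulr_ge0 ?powR_ge0 // subr_ge0 e1 e2.
  have c1 : 0 < v z.1 + e k by rewrite ltr_wpDl.
  have c2 : 0 < v z.2 + e k by rewrite ltr_wpDl.
  rewrite !picone_testE // (_ : v z.1 - v z.2 = (v z.1 + e k) - (v z.2 + e k)); last by ring.
  by have [] := discrete_picone hp u1 u2 c1 c2.
(* subtracting the two equations leaves the deficit once the gradient terms are
   compared *)
have h_le k : (\int[(@leb R N \x @leb R N)%E]_z (h k z)%:E <= X - Y k)%E.
  have [_ iJv iFv ev] := Sv k; have := local_le k.
  have Y_fin : Y k \is a fin_num by exact: integrable_fin_num.
  rewrite /h integralB_EFin //.
  exact: (lee_subD X_fin Y_fin eu ev).
(* both right-hand sides are integrals of [f * v `^ (p - 1) * u], up to a factor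
   [(v / (v + e k)) `^ (p - 1)], which is at most [1] and tends to [1] *)
have h_cvg : (X - Y k @[k --> \oo] --> 0)%E.
  have YX : (Y k @[k --> \oo] --> X)%E.
    refine (let: And3 _ _ c := @dominated_convergence _ _ R (@leb R N) Omega mO
      (fun k x => (f x * (v x ^+ 2 / u x) `^ (p - 1) * phi k x)%:E)
      (fun x => (f x * v x `^ (p - 1) * u x)%:E)
      (fun x => (f x * v x `^ (p - 1) * u x)%:E) _ _ _ _ _ in c) => //.
    - by move=> k; have [_ _ iFv _] := Sv k; exact: measurable_int iFv.
    - exact: measurable_int iFu.
    - apply: filterS all_ae => x [_ _ pos ex] /pos[ux vx].
      apply: cvg_EFin; first exact: nearW.
      rewrite -mulrA -(picone_rhs p ux vx) mulrA.
      under eq_fun do rewrite /= ex.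
      by apply: cvgM; [exact: cvg_cst|exact: picone_test_cvg].
    - apply: filterS2 f_ge0 all_ae => x fx [_ _ pos ex] k Ox; have [ux vx] := pos Ox.
      have {}fx := fx Ox.
      rewrite lee_fin ger0_norm; last by rewrite ex !mulr_ge0 ?powR_ge0.
      rewrite ex -[leRHS]mulrA -(picone_rhs p ux vx) [leRHS]mulrA.
      rewrite ler_wpM2l ?mulr_ge0 ?powR_ge0 // ler_wpM2l ?powR_ge0 //.
      by rewrite powR_le_shift // ltW.
  have -> : (0 = X - X)%E by rewrite subee.
  by apply: cvgeB => //; [rewrite fin_num_adde_defr ?fin_numN|exact: cvg_cst].
have ratio : {ae (@leb R N \x @leb R N)%E, forall z, Omega z.1 -> Omega z.2 ->
    u z.1 / v z.1 = u z.2 / v z.2}.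
  have := ae_cvg0_of_integral_cvg0 ih h_ge0 h_le h_cvg.
  apply: filterS3 (ae_fst _ all_ae) (ae_snd _ all_ae) => z [_ _ pos1 e1] [_ _ pos2 e2] lim0.
  move=> /pos1[u1 v1] /pos2[u2 v2].
  have [->//|z12] := eqVneq z.1 z.2.
  have K0 := kernel_gt0 p s z12.
  pose l := (`|u z.1 - u z.2| `^ p - jump p (v z.1 - v z.2) *
    (u z.1 `^ p * v z.1 `^ (1 - p) - u z.2 `^ p * v z.2 `^ (1 - p))) * kernel p s z.
  have /lim0/eqP : h ^~ z @ \oo --> l.
    under eq_fun do rewrite hE e1 e2.
    apply: cvgM; last exact: cvg_cst.
    apply: cvgB; first exact: cvg_cst.
    apply: cvgM; first exact: cvg_cst.
    by apply: cvgB; exact: picone_test_cvg.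
  rewrite /l mulf_eq0 (gt_eqF K0) orbF subr_eq0 eq_sym !picone_testE ?(ltW u1) ?(ltW u2) //.
  by have [_ ->] := discrete_picone hp (ltW u1) (ltW u2) v1 v2; move/eqP.
(* [Omega] is not null, since [f] does not vanish almost everywhere on it *)
have [x0 [Ox0 u0 v0 rx0]] : exists x0, [/\ Omega x0, 0 < u x0, 0 < v x0 &
    {ae @leb R N, forall y, Omega x0 -> Omega y -> u x0 / v x0 = u y / v y}].
  apply: contrapT => nex; apply: f_neq0.
  apply: filterS2 (ae_section ratio) all_ae => x rx [_ _ pos _] Ox.
  by have [ux vx] := pos Ox; case: nex; exists x; split.
exists (v x0 / u x0); split; first by rewrite divr_gt0.
apply: filterS2 rx0 all_ae => x rx [_ _ pos _] Ox; have [ux vx] := pos Ox.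
have := rx Ox0 Ox => /(congr1 (fun t => v x * t * (v x0 / u x0))) E0.
have : v x * (u x0 / v x0) * (v x0 / u x0) = v x by field; rewrite !gt_eqF.
move=> <-; rewrite E0; field; rewrite !gt_eqF //.
Qed.
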